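(* (a) For $(k,\ell,m)=(\infty,2,4)$, the almost-dessins with $|E|=5$ form exactly 20 pure braid orbits, corresponding to $\mathrm{Belyi}^{(1)}$ maps named $O_1,\ldots,O_{20}$. Their branching patterns (cycle types of $g_0$; $g_1$; $g_\infty$) are as follows, with exactly one orbit for each listed pattern. After the colon come the name, the length of the orbit, and, where one is listed, the decomposition in square brackets; where there is no bracket, no decomposition is listed. $(2),(1^2),(1^2)$: $O_1$, 1; $(1^2),(1^2),(2)$: $O_2$, 1; $(3),(1,2),(1^3)$: $O_3$, 1; $(1,2),(1,2),(1,2)$: $O_4$, 4; $(1^3),(1,2),(3)$: $O_5$, 1; $(1^2,2),(1^2,2),(4)$: $O_6$, 4; $(4),(2^2),(1^4)$: $O_7$, 1 $[2\circ2]$; $(1,3),(2^2),(1^2,2)$: $O_8$, 3; $(2^2),(2^2),(1^2,2)$: $O_9$, 2 $[2\circ2]$; $(1^2,2),(2^2),(1,3)$: $O_{10}$, 3; $(1^2,2),(2^2),(2^2)$: $O_{11}$, 2 $[2\circ2]$; $(1^2,3),(1,2^2),(1,4)$: $O_{12}$, 10; $(1,2^2),(1,2^2),(1,4)$: $O_{13}$, 8; $(1^2,4),(2^3),(1^2,4)$: $O_{14}$, 6; $(1,2,3),(2^3),(1^2,4)$: $O_{15}$, 9; $(1^3,3),(2^3),(2,4)$: $O_{16}$, 2 $[2\circ3]$; $(1^2,2^2),(2^3),(2,4)$: $O_{17}$, 4 $[2\circ3]$; $(1^4,4),(2^4),(4^2)$: $O_{18}$, 2 $[2\circ2\circ2]$;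 $(1^3,2,3),(2^4),(4^2)$: $O_{19}$, 6 $[2\circ4]$; $(1^2,2^3),(2^4),(4^2)$: $O_{20}$, 4 $[2\circ2\circ2]$. There are no almost-dessins with pattern $(2^3),(2^3),(1^2,4)$. That is, there do not exist $g_0,g_1,g_t,g_\infty\in S_6$ such that each of $g_0,g_1$ is a product of 3 disjoint 2-cycles, $g_t$ is a 2-cycle, $g_\infty$ is a 4-cycle, $g_0g_1g_tg_\infty=1$, and $\langle g_0,g_1,g_t,g_\infty\rangle$ is transitive. (b) For $(k,\ell,m)=(\infty,2,6)$, the almost-dessins with $|E|=5$ form exactly 12 pure braid orbits, corresponding to $\mathrm{Belyi}^{(1)}$ maps named $P_1,\ldots,P_{12}$, with exactly one orbit for each of the following patterns (same conventions): $(2),(1^2),(1^2)$: $P_1$, 1; $(1^2),(1^2),(2)$: $P_2$, 1; $(3),(1,2),(1^3)$: $P_3$, 1; $(1,2),(1,2),(1,2)$: $P_4$, 4; $(1^3),(1,2),(3)$: $P_5$, 1; $(4),(2^2),(1^4)$: $P_6$, 1 $[2\circ2]$; $(1,3),(2^2),(1^2,2)$: $P_7$, 3; $(2^2),(2^2),(1^2,2)$: $P_8$, 2 $[2\circ2]$; $(1^2,2),(2^2),(1,3)$: $P_9$, 3; $(1^2,2),(2^2),(2^2)$: $P_{10}$, 2 $[2\circ2]$; $(1^4),(2^2),(4)$: $P_{11}$, 1 $[2\circ2]$; $(1^4,2),(2^3),(6)$: $P_{12}$, 2 $[2\circ3]$.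
   Context: A 4-constellation of degree $n$ is a list $[g_0,g_1,g_t,g_\infty]$ of permutations in $S_n$ with $g_0g_1g_tg_\infty=1$ generating a transitive subgroup of $S_n$. It is planar if the corresponding covering surface has genus zero, i.e. $\sum_i (n-\#g_i)=2n-2$, where $\#g$ is the number of cycles of $g$ including 1-cycles. An almost-dessin is a simultaneous-conjugacy class (under $S_n$) of planar 4-constellations $[g_0,g_1,g_t,g_\infty]$ with $g_t$ a 2-cycle. For $(k,\ell,m)=(\infty,2,m)$, $|E|$ of an almost-dessin is the number of all cycles of $g_0$ (including 1-cycles), plus the number of cycles of $g_1$ of odd length, plus the number of cycles of $g_\infty$ of length not divisible by $m$. Cycle types are written with exponents for multiplicity: e.g. $(1^2,3)$ means cycle lengths $1,1,3$. The braid group acts on 4-constellations via $\sigma_i:[g_1,\ldots,g_4]\mapsto[g_1,\ldots,g_{i-1},g_{i+1},g_{i+1}^{-1}g_ig_{i+1},g_{i+2},\ldots,g_4]$, $i=1,2,3$ (here $g_1,\ldots,g_4$ denote the four entries of the list in order). The pure braid group consists of the products of $\sigma_i^{\pm1}$ inducing the trivial permutation of the four positions; it acts on almost-dessins, and a pure braid orbit is an orbit of this action. The length of an orbit is the number of almost-dessins in it. A $\mathrm{Belyi}^{(1)}$ map is a rational function $f:\mathbb{P}^1\to\mathbb{P}^1$ over $\mathbb{C}$ with exactly one branch point $t$ outside $\{0,1,\infty\}$, this branch point being simple. Its monodromy around $0,1,t,\infty$ is given by a 4-constellation $[g_0,g_1,g_t,g_\infty]$ whose class is an almost-dessin. A $\mathrm{Belyi}^{(1)}$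 map for an orbit is one whose almost-dessin lies in that orbit. Decompositions: $[a\circ b]$ means that any $\mathrm{Belyi}^{(1)}$ map $f$ for the orbit equals $g\circ h$ for some $g,h$ of degrees $a,b$; likewise $[a\circ b\circ c]$ means a composition of three functions of degrees $a,b,c$. *)

(* Defs.v *)
From mathcomp Require Import all_boot all_order all_fingroup.

Set Implicit Arguments.
Unset Strict Implicit.
Unset Printing Implicit Defensive.

Local Open Scope group_scope.

(* Lists [g_0, g_1, g_t, g_oo]; entry g i is the permutation at position i,    *)
(* so that positions 0, 1, 2, 3 stand for 0, 1, t, oo.  Permutations compose  *)
(* from left to right: (s * u) x = u (s x).                                   *)
Notation quad n := (4.-tuple 'S_n).

Definition entry n (g : quad n) (i : nat) : 'S_n := nth 1 g i.

Definition constellation n (g : quad n) : bool :=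
  (entry g 0 * entry g 1 * entry g 2 * entry g 3 == 1)
  && [transitive <<[set s in (g : seq 'S_n)]>>, on [set: 'I_n] | 'P].

Definition planar n (g : quad n) : bool :=
  \sum_(i < 4) (n - #|porbits (entry g i)|) == n.*2 - 2.

Definition is_2cycle n (s : 'S_n) : bool :=
  [exists x, exists y, (x != y) && (s == tperm x y)].

(* The almost-dessin of g is conj_class g, for g satisfying this predicate. *)
Definition almost_dessin_rep n (g : quad n) : bool :=
  [&& constellation g, planar g & is_2cycle (entry g 2)].

Definition conj_quad n (g : quad n) (s : 'S_n) : quad n :=
  [tuple of map (fun u => u ^ s) g].

Definition conj_class n (g : quad n) : {set quad n} :=
  [set conj_quad g s | s : 'S_n].

(* |E| for (k, l, m) = (oo, 2, m). *)
Definition numE (m n : nat) (g : quad n) : nat :=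
  #|porbits (entry g 0)|
  + #|[set c in porbits (entry g 1) | odd #|c| ]|
  + #|[set c in porbits (entry g 3) | ~~ (m %| #|c|)]|.

Definition almost_dessins (m e n : nat) : {set {set quad n}} :=
  [set conj_class g | g in [set g : quad n | almost_dessin_rep g && (numE m g == e)]].

(* Branching patterns: cycle lengths of g_0, g_1, g_oo in increasing order. *)
Notation pattern := (seq nat * seq nat * seq nat)%type.

Definition cycle_type n (s : 'S_n) : seq nat :=
  sort leq [seq #|c| | c : {set 'I_n} in porbits s].

Definition quad_pattern n (g : quad n) : pattern :=
  (cycle_type (entry g 0), cycle_type (entry g 1), cycle_type (entry g 3)).

Definition sigma_fun n (i : 'I_3) (g : quad n) : quad n :=
  [tuple (if j == i :> nat then entry g i.+1
          else if j == i.+1 :> nat then entry g i ^ entry g i.+1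
          else entry g j) | j < 4].

Lemma sigma_fun_inj n i : injective (@sigma_fun n i).
Proof.
move=> g h E.
have H j (lj : j < 4) : entry (sigma_fun i g) j = entry (sigma_fun i h) j.
  by rewrite E.
have N (k : quad n) j : j < 4 -> entry (sigma_fun i k) j =
   (if j == i :> nat then entry k i.+1
          else if j == i.+1 :> nat then entry k i ^ entry k i.+1
          else entry k j).
  by move=> lj; rewrite /entry -(tnth_nth _ _ (Ordinal lj)) tnth_mktuple.
have li := ltn_ord i.
have e1 : entry g i.+1 = entry h i.+1.
  by have := H i (ltnW li); rewrite !N ?eqxx // ltnW.
have e0 : entry g i = entry h i.
  have := H i.+1 li; rewrite !N // eqxx gtn_eqF // e1; exact: conjg_inj.
apply/val_inj/(@eq_from_nth _ 1); rewrite ?size_tuple // => j lj.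
rewrite -!/(entry _ _).
have [->//|ni] := eqVneq j i; have [->//|ni1] := eqVneq j i.+1.
by have := H j lj; rewrite !N // (negPf ni) (negPf ni1).
Qed.

Definition sigma n (i : 'I_3) : {perm quad n} := perm (@sigma_fun_inj n i).

(* The transposition of positions induced by sigma_i. *)
Definition position_swap (i : 'I_3) : 'S_4 := tperm (inord i) (inord i.+1).

(* The image of the braid group in 'S_4 x Sym(quad n): each braid is recorded *)
(* together with the permutation of positions that it induces.                *)
Definition braid_image n : {set 'S_4 * {perm quad n}} :=
  <<[set (position_swap i, sigma n i) | i : 'I_3]>>.

Definition pure_braid_image n : {set {perm quad n}} :=
  [set s | (1, s) \in braid_image n].

(* A permutation s of quad n acts on a class A as the image s @: A ('P^* ). *)
Definition pure_braid_orbit n (A : {set quad n}) : {set {set quad n}} :=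
  orbit ('P^*)%act (pure_braid_image n) A.

Definition pure_braid_orbits (m e n : nat) : {set {set {set quad n}}} :=
  [set pure_braid_orbit A | A in almost_dessins m e n].

Definition orbit_has_pattern n (p : pattern) (O : {set {set quad n}}) : bool :=
  [forall A in O, forall g in A, quad_pattern g == p].

From mathcomp Require Import all_algebra complex.
From mathcomp Require Import all_classical all_reals all_analysis.
Import Order.TTheory GRing.Theory Num.Theory.
Import numFieldNormedType.Exports.

Local Open Scope group_scope.
Local Open Scope classical_set_scope.
Local Open Scope complex_scope.
Local Open Scope ring_scope.

(* The Riemann sphere; None is the point oo. *)
Notation P1 R := (one_point_compactification R[i]^o).

Section RationalFunctions.
Variable R : realType.
Local Notation C := R[i].

Record ratfun : Type := RatFun {
  ratnum : {poly C};
  ratden : {poly C};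
  _ : coprimep ratnum ratden
}.

Definition ratdeg (f : ratfun) : nat :=
  (maxn (size (ratnum f)) (size (ratden f))).-1.

Definition ratval (f : ratfun) (x : P1 R) : P1 R :=
  let (a, b) := match x with
    | Some z => ((ratnum f).[z], (ratden f).[z])
    | None => ((ratnum f)`_(ratdeg f), (ratden f)`_(ratdeg f))
    end in
  if b == 0 then None else Some (a / b).

(* The finite points of the fibre over w are the roots of fibre_poly f w. *)
Definition fibre_poly (f : ratfun) (w : P1 R) : {poly C} :=
  match w with
  | Some c => ratnum f - (c : C) *: ratden f
  | None => ratden f
  end.

(* Multiplicity of f at x; at x = oo it is the drop ratdeg f - deg q of the *)
(* degree of the fibre polynomial q.                                        *)
Definition ramification (f : ratfun) (x : P1 R) : nat :=
  let q := fibre_poly f (ratval f x) in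
  match x with
  | Some z => mup (z : C) q
  | None => ((ratdeg f).+1 - size q)%N
  end.

Definition branch_point (f : ratfun) (w : P1 R) : Prop :=
  exists2 x, ratval f x = w & (1 < ramification f x)%N.

Definition simple_branch_point (f : ratfun) (w : P1 R) : Prop :=
  exists x, [/\ ratval f x = w, ramification f x = 2%N &
    forall y, ratval f y = w -> y <> x -> ramification f y = 1%N].

Definition belyi1 (f : ratfun) (t : C) : Prop :=
  [/\ t != 0, t != 1, simple_branch_point f (Some t) &
    forall w, branch_point f w -> w \in [:: Some 0; Some 1; None; Some t]].

(* f = h_1 o ... o h_r as maps of the sphere, with deg h_i the i-th entry. *)
Definition decomposes (f : ratfun) (degs : seq nat) : Prop :=
  exists2 hs : seq ratfun, map ratdeg hs = degs &
    forall x, ratval f x = foldr ratval x hs.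

End RationalFunctions.

Section Monodromy.
Variable R : realType.
Local Notation C := R[i].
Local Notation I := ([set` `[0 : R, 1 : R]] : set R).

(* C minus {0, 1, t}, that is, the sphere minus {0, 1, t, oo}. *)
Definition punctured (t : C) : set C := [set z | z \notin [:: 0; 1; t]].

Definition loop (t b : C) (gam : R -> C) : Prop :=
  [/\ {within I, continuous (gam : R -> R[i]^o)},
      (forall s, I s -> punctured t (gam s)), gam 0 = b & gam 1 = b].

(* H u, for u in [0, 1], is a family of closed curves from gam to del. *)
Definition loop_homotopy (t : C) (H : R -> R -> C) (gam del : R -> C) : Prop :=
  [/\ {within [set us : R * R | I us.1 /\ I us.2],
         continuous ((fun us => H us.1 us.2) : R * R -> R[i]^o)},
      (forall u s, I u -> I s -> punctured t (H u s)),
      (forall u, I u -> H u 0 = H u 1),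
      (forall s, I s -> H 0 s = gam s) &
      (forall s, I s -> H 1 s = del s)].

Definition null_homotopic (t b : C) (gam : R -> C) : Prop :=
  exists2 H, loop_homotopy t H gam (fun=> b) & forall u, I u -> H u 0 = b.

Definition freely_homotopic (t : C) (gam del : R -> C) : Prop :=
  exists H, loop_homotopy t H gam del.

Definition concat (gam del : R -> C) (s : R) : C :=
  if s <= 1 / 2 then gam (2 * s) else del (2 * s - 1).

(* s |-> a + r exp(2 pi i k s) *)
Definition circle (k : R) (a : C) (r s : R) : C :=
  a + (r * cos (k * (2 * pi * s))) +i* (r * sin (k * (2 * pi * s))).

(* A loop around a in {0, 1, t}: freely homotopic to a small circle around a, *)
(* counterclockwise.                                                          *)
Definition loop_around (t b a : C) (gam : R -> C) : Prop :=
  loop t b gam /\ exists r : R, [/\ 0 < r,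
    (forall c : C, c \in [:: 0; 1; t] -> c != a -> r%:C < `|c - a|) &
    freely_homotopic t gam (circle 1 a r)].

(* Counterclockwise around oo is clockwise along a large circle. *)
Definition loop_around_infty (t b : C) (gam : R -> C) : Prop :=
  loop t b gam /\ exists r : R, [/\ 0 < r,
    (forall c : C, c \in [:: 0; 1; t] -> `|c| < r%:C) &
    freely_homotopic t gam (circle (-1) 0 r)].

Definition fibre_labelling n (f : ratfun R) (b : C) (lab : 'I_n -> P1 R) : Prop :=
  injective lab /\ forall x, ratval f x = Some b <-> exists i, x = lab i.

(* The lift of gam starting at the point labelled i ends at the point *)
(* labelled g i.                                                      *)
Definition lifts_to n (f : ratfun R) (lab : 'I_n -> P1 R) (gam : R -> C)
    (g : 'S_n) : Prop :=
  forall i : 'I_n, exists c : R -> P1 R,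
    [/\ {within I, continuous c}, (forall s, I s -> ratval f (c s) = Some (gam s)),
        c 0 = lab i & c 1 = lab (g i)].

(* g is the monodromy of f for some base point b, some labelling of the fibre *)
(* over b, and some standard generators of pi_1 of the sphere minus           *)
(* {0, 1, t, oo}: loops around 0, 1, t, oo whose product is trivial.  Other   *)
(* choices change g by conjugation and pure braids.                           *)
Definition monodromy n (f : ratfun R) (t : C) (g : quad n) : Prop :=
  exists (b : C) (lab : 'I_n -> P1 R) (gam0 gam1 gamt gamoo : R -> C),
    [/\ [/\ loop_around t b 0 gam0, loop_around t b 1 gam1,
            loop_around t b t gamt & loop_around_infty t b gamoo],
        null_homotopic t b (concat gam0 (concat gam1 (concat gamt gamoo))),
        fibre_labelling f b lab &
        [/\ lifts_to f lab gam0 (entry g 0), lifts_to f lab gam1 (entry g 1),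
            lifts_to f lab gamt (entry g 2) & lifts_to f lab gamoo (entry g 3)]].

Definition belyi1_for n (O : {set {set quad n}}) (f : ratfun R) : Prop :=
  exists t g, [/\ ratdeg f = n, belyi1 f t, monodromy f t g & conj_class g \in O].

End Monodromy.

(* Pattern, length of the orbit, degrees of the listed decomposition          *)
(* (empty if none is listed).                                                 *)
Notation orbit_row := (pattern * nat * seq nat)%type.

Definition row_holds (R : realType) (m e : nat) (r : orbit_row) : Prop :=
  let: (p, len, degs) := r in
  let n := sumn p.1.1 in
  exists O : {set {set quad n}},
    [/\ [set O' in pure_braid_orbits m e n | orbit_has_pattern p O']%SET = [set O]%SET,
        #|O| = len &
        degs <> [::] ->
        forall f : ratfun R, belyi1_for O f -> decomposes f degs].

(* All pure braid orbits of almost-dessins with |E| = e, of any degree. *)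
Definition all_orbits (m e : nat) : set {n : nat & {set {set quad n}}} :=
  [set o | tagged o \in pure_braid_orbits m e (tag o)].

Local Open Scope nat_scope.

(* Rows O_1, ..., O_20. *)
Definition tableO : seq orbit_row := [::
  (([:: 2], [:: 1; 1], [:: 1; 1]), 1, [::]);
  (([:: 1; 1], [:: 1; 1], [:: 2]), 1, [::]);
  (([:: 3], [:: 1; 2], [:: 1; 1; 1]), 1, [::]);
  (([:: 1; 2], [:: 1; 2], [:: 1; 2]), 4, [::]);
  (([:: 1; 1; 1], [:: 1; 2], [:: 3]), 1, [::]);
  (([:: 1; 1; 2], [:: 1; 1; 2], [:: 4]), 4, [::]);
  (([:: 4], [:: 2; 2], [:: 1; 1; 1; 1]), 1, [:: 2; 2]);
  (([:: 1; 3], [:: 2; 2], [:: 1; 1; 2]), 3, [::]);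
  (([:: 2; 2], [:: 2; 2], [:: 1; 1; 2]), 2, [:: 2; 2]);
  (([:: 1; 1; 2], [:: 2; 2], [:: 1; 3]), 3, [::]);
  (([:: 1; 1; 2], [:: 2; 2], [:: 2; 2]), 2, [:: 2; 2]);
  (([:: 1; 1; 3], [:: 1; 2; 2], [:: 1; 4]), 10, [::]);
  (([:: 1; 2; 2], [:: 1; 2; 2], [:: 1; 4]), 8, [::]);
  (([:: 1; 1; 4], [:: 2; 2; 2], [:: 1; 1; 4]), 6, [::]);
  (([:: 1; 2; 3], [:: 2; 2; 2], [:: 1; 1; 4]), 9, [::]);
  (([:: 1; 1; 1; 3], [:: 2; 2; 2], [:: 2; 4]), 2, [:: 2; 3]);
  (([:: 1; 1; 2; 2], [:: 2; 2; 2], [:: 2; 4]), 4, [:: 2; 3]);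
  (([:: 1; 1; 1; 1; 4], [:: 2; 2; 2; 2], [:: 4; 4]), 2, [:: 2; 2; 2]);
  (([:: 1; 1; 1; 2; 3], [:: 2; 2; 2; 2], [:: 4; 4]), 6, [:: 2; 4]);
  (([:: 1; 1; 2; 2; 2], [:: 2; 2; 2; 2], [:: 4; 4]), 4, [:: 2; 2; 2])].

(* Rows P_1, ..., P_12. *)
Definition tableP : seq orbit_row := [::
  (([:: 2], [:: 1; 1], [:: 1; 1]), 1, [::]);
  (([:: 1; 1], [:: 1; 1], [:: 2]), 1, [::]);
  (([:: 3], [:: 1; 2], [:: 1; 1; 1]), 1, [::]);
  (([:: 1; 2], [:: 1; 2], [:: 1; 2]), 4, [::]);
  (([:: 1; 1; 1], [:: 1; 2], [:: 3]), 1, [::]);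
  (([:: 4], [:: 2; 2], [:: 1; 1; 1; 1]), 1, [:: 2; 2]);
  (([:: 1; 3], [:: 2; 2], [:: 1; 1; 2]), 3, [::]);
  (([:: 2; 2], [:: 2; 2], [:: 1; 1; 2]), 2, [:: 2; 2]);
  (([:: 1; 1; 2], [:: 2; 2], [:: 1; 3]), 3, [::]);
  (([:: 1; 1; 2], [:: 2; 2], [:: 2; 2]), 2, [:: 2; 2]);
  (([:: 1; 1; 1; 1], [:: 2; 2], [:: 4]), 1, [:: 2; 2]);
  (([:: 1; 1; 1; 1; 2], [:: 2; 2; 2], [:: 6]), 2, [:: 2; 3])].

(* Main.v *)
Require Import Defs.
From mathcomp Require Import all_boot all_order all_fingroup all_algebra complex.
From mathcomp Require Import all_classical all_reals all_analysis.
From mathcomp Require Import ring lra zify.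

(* Planarity and |E| = 5 bound the degree by 8 (m = 4) or 6 (m = 6) and leave finitely many
   branching patterns, in all of which g_1 is an involution.  Conjugating g_oo to a standard
   permutation, one enumerates the pairs (g_1, g_t), from which g_0 follows.  Transitive
   constellations are conjugate if and only if numbering the points in their order of
   discovery, from suitable base points, turns them into the same list; this shows that
   everything found is conjugate to a pure braid image of one representative.

   For the decompositions, the monodromy only enters through its cycle type.  A loop around a
   is deformed into a small circle around a; lifting the deformation (through a trivialization
   of f over the square) sends each sheet to a neighbourhood of a point x over a, and by
   continuity of the roots exactly e_f(x) sheets go to x.  Hence e_f(x) is a sum of cycle
   lengths of the local monodromy.  When all e_f(x) over 1 and oo (or 0 and 1) are even,
   1 - f is the square of a rational function (or f / (f - 1) is), which gives the
   decomposition. *)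

(** The certificates are sound whatever their data. One orbit per pattern is obtained from a list of
    pure braids whose images of one representative are pairwise non-conjugate, and a check that
    every candidate is conjugate to one of these images or intransitive. Pure braids preserve cycle
    types, so a pattern identifies its orbit, and the counts 20 and 12 are the numbers of distinct
    patterns. The pattern excluded in (a) passes both numerical conditions; only the enumeration
    rules it out.

    On the analytic side, loops are compared with circles only up to free homotopy. The base point
    therefore moves, and with it the labelling of the fibre, but the permutation of the labels stays
    the same. Points at oo are treated like the others through the coordinate 1/(z - s), with s
    outside the fibre: every fibre becomes the set of roots of a polynomial of fixed degree. It is
    enough that e_f(x) is a sum of cycle lengths, not a single one, because divisibility passes to
    sums. Only the triple decompositions, where g_0 has fixed points, require counting labels. *)

Set Implicit Arguments.
Unset Strict Implicit.
Unset Printing Implicit Defensive.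

(** * Exploring the orbits of a family of maps *)

Section Exploration.
Variable T : eqType.
Implicit Types (b : seq T) (fs : seq (T -> T)).

Definition add_new b y := if y \in b then b else rcons b y.
(** New points are appended at the end, so a point keeps its position from the moment of its
    discovery; these positions are the labels used by [relabel]. *)
Definition explore_step fs b := foldl add_new b [seq f x | x <- b, f <- fs].
Definition explore k fs i := iter k (explore_step fs) [:: i].
Definition relabel fs b := [seq [seq index (f x) b | x <- b] | f <- fs].
Definition closed_under fs b := all (fun x => all (fun f => f x \in b) fs) b.

Lemma add_new_uniq b y : uniq b -> uniq (add_new b y).
Proof. by rewrite /add_new; case: ifPn => // nb; rewrite rcons_uniq nb. Qed.

Lemma foldl_add_new_uniq s b : uniq b -> uniq (foldl add_new b s).
Proof. by elim: s b => //= y s IH b ub; apply/IH/add_new_uniq. Qed.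

Lemma explore_uniq k fs i : uniq (explore k fs i).
Proof. elim: k => [|k IH] //; exact: foldl_add_new_uniq. Qed.

Lemma foldl_add_new_sub s b : {subset b <= foldl add_new b s}.
Proof.
elim: s b => [|y s IH] b x xb //=; apply: IH; rewrite /add_new.
by case: ifP => // _; rewrite mem_rcons inE xb orbT.
Qed.

Lemma mem_explore k fs i : i \in explore k fs i.
Proof.
elim: k => [|k IH] /=; first by rewrite mem_seq1.
exact: foldl_add_new_sub.
Qed.

Lemma foldl_add_new_ind (P : T -> Prop) s b :
  (forall x, x \in b -> P x) -> (forall x, x \in s -> P x) ->
  forall x, x \in foldl add_new b s -> P x.
Proof.
elim: s b => //= y s IH b Pb Ps; apply: IH => [x|x xs]; last first.
  by apply: Ps; rewrite inE xs orbT.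
rewrite /add_new; case: ifP => _; first exact: Pb.
rewrite mem_rcons inE => /orP[/eqP->|]; last exact: Pb.
by apply: Ps; rewrite mem_head.
Qed.

Lemma explore_ind (P : pred T) k fs i :
  P i -> (forall x, P x -> all (fun f => P (f x)) fs) ->
  forall x, x \in explore k fs i -> P x.
Proof.
move=> Pi Pf; elim: k => [|k IH] x /=; first by rewrite mem_seq1 => /eqP->.
move: x; apply: foldl_add_new_ind => // x.
have : forall y, y \in explore k fs i -> P y by exact: IH.
elim: (explore k fs i) => //= z s IHs Ps; rewrite mem_cat => /orP[|]; last first.
  by apply: IHs => y ys; apply: Ps; rewrite inE ys orbT.
have /Pf : P z by apply: Ps; rewrite mem_head.
elim: {IH IHs Ps Pf}fs => //= f fs IHf /andP[Pfz Pz].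
by rewrite inE => /orP[/eqP->//|]; apply: IHf.
Qed.

End Exploration.

Section Equivariance.
Variables (T T' : eqType) (h : T -> T') (C : Type).
Variables (F : C -> T -> T) (F' : C -> T' -> T').
Hypothesis h_inj : injective h.
Hypothesis hF : forall c x, h (F c x) = F' c (h x).

Lemma foldl_add_new_map s b :
  foldl (@add_new _) (map h b) (map h s) = map h (foldl (@add_new _) b s).
Proof.
elim: s b => //= y s IH b; rewrite -IH; congr foldl.
by rewrite /add_new mem_map //; case: ifP => // _; rewrite map_rcons.
Qed.

(** Injectivity of [h] makes the membership tests agree, so points are discovered in the same order.
    Two uses: [h] the inclusion of ['I_n] in the naturals, to pass from permutations to codes, and
    [h] a permutation, to get invariance under conjugation. *)
Lemma explore_map k cs i :
  explore k (map F' cs) (h i) = map h (explore k (map F cs) i).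
Proof.
elim: k => //= k ->; rewrite /explore_step -foldl_add_new_map; congr foldl.
rewrite map_allpairs; elim: (explore _ _ _) => //= x s ->; congr cat.
by rewrite -!map_comp; apply: eq_map => c /=; rewrite hF.
Qed.

Lemma relabel_map cs b :
  relabel (map F' cs) (map h b) = relabel (map F cs) b.
Proof.
rewrite /relabel -!map_comp; apply: eq_map => c /=.
by rewrite -map_comp; apply: eq_map => x /=; rewrite -hF index_map.
Qed.

Lemma closed_under_map cs b :
  closed_under (map F' cs) (map h b) = closed_under (map F cs) b.
Proof.
rewrite /closed_under all_map; apply: eq_all => x /=.
by rewrite !all_map; apply: eq_all => c /=; rewrite -hF mem_map.
Qed.

End Equivariance.
Arguments explore : simpl never.
Arguments relabel : simpl never.
Arguments closed_under : simpl never.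

(** * Permutations as lists of their values *)

Section Codes.
Variable n : nat.
Local Open Scope group_scope.
Implicit Types (s u : 'S_n) (a c : seq nat).

Definition code s : seq nat := [seq val (s i) | i <- enum 'I_n].

Lemma size_code s : size (code s) = n.
Proof. by rewrite size_map size_enum_ord. Qed.

Lemma nth_code s (i : 'I_n) : nth 0 (code s) i = s i.
Proof. by rewrite (nth_map i) ?size_enum_ord ?ltn_ord // nth_ord_enum. Qed.

Lemma code_inj : injective code.
Proof.
by move=> s u E; apply/permP => i; apply/val_inj; rewrite /= -!nth_code E.
Qed.

Lemma codeP s a : size a = n -> (forall i : 'I_n, nth 0 a i = s i) -> code s = a.
Proof.
move=> sa E; apply: (@eq_from_nth _ 0); rewrite size_code // => k kn.
by rewrite -[k]/(nat_of_ord (Ordinal kn)) E nth_code.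
Qed.

Definition is_code a := [&& size a == n, uniq a & all (fun x => x < n) a].

Lemma is_codeP a : is_code a -> exists s, code s = a.
Proof.
case/and3P => /eqP sa ua /allP la.
have lan (i : 'I_n) : nth 0 a i < n by apply/la/mem_nth; rewrite sa.
have finj : injective (fun i : 'I_n => Ordinal (lan i)).
  move=> i j /(congr1 val) /= /eqP; rewrite nth_uniq ?sa // => /eqP.
  exact: val_inj.
by exists (perm finj); apply: codeP => // i; rewrite permE.
Qed.

Lemma code_is_code s : is_code (code s).
Proof.
rewrite /is_code size_code eqxx map_inj_uniq ?enum_uniq /=; last first.
  by move=> i j /val_inj /perm_inj.
by apply/allP => _ /mapP[i _ ->] /=.
Qed.

Definition code_mul a c := [seq nth 0 c x | x <- a].
Definition code_inv a := [seq index i a | i <- iota 0 (size a)].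
Definition code_conj a c := code_mul (code_inv c) (code_mul a c).

Lemma code_mulE s u : code (s * u) = code_mul (code s) (code u).
Proof.
apply: codeP => [|i]; first by rewrite size_map size_code.
by rewrite (nth_map 0) ?size_code // !nth_code permM.
Qed.

Lemma code_invE s : code s^-1 = code_inv (code s).
Proof.
apply: codeP => [|i]; first by rewrite size_map size_iota size_code.
rewrite (nth_map 0) ?size_iota ?size_code // nth_iota ?size_code // add0n.
rewrite -{1}(permKV s i) -nth_code index_uniq ?size_code //.
by case/and3P: (code_is_code s).
Qed.

Lemma code_conjE s u : code (s ^ u) = code_conj (code s) (code u).
Proof. by rewrite conjgE !code_mulE code_invE. Qed.

Definition code_tperm x y :=
  [seq if z == x then y else if z == y then x else z | z <- iota 0 n].

Lemma code_tpermE (x y : 'I_n) : code (tperm x y) = code_tperm x y.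
Proof.
apply: codeP => [|i]; first by rewrite size_map size_iota.
rewrite (nth_map 0) ?size_iota // nth_iota // add0n.
case: tpermP => [->|->|/eqP ix /eqP iy]; rewrite ?eqxx //.
  by case: eqP.
by rewrite -!(inj_eq val_inj) in ix iy; rewrite (negPf ix) (negPf iy).
Qed.

End Codes.

(** * Cycle types and standard representatives *)

Section CycleTypes.
Variable n : nat.
Local Open Scope group_scope.
Implicit Types (s u : 'S_n) (a c : seq nat).

Lemma count_cycle_type s (P : pred nat) :
  count P (cycle_type s) = #|[set c in porbits s | P #|c| ]|.
Proof.
rewrite /cycle_type count_sort count_map -sum1_count big_enum_cond /= -sum1_card.
by apply: eq_bigl => C; rewrite !inE.
Qed.

Lemma size_cycle_type s : size (cycle_type s) = #|porbits s|.
Proof. by rewrite /cycle_type size_sort size_map -cardE. Qed.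

Lemma cycle_type_sorted s : sorted leq (cycle_type s).
Proof. exact/sort_sorted/leq_total. Qed.

Lemma cycle_type_gt0 s : all (fun k => 0 < k) (cycle_type s).
Proof.
rewrite /cycle_type all_sort; apply/allP => k /mapP[C].
rewrite mem_enum => /imsetP[i _ ->] ->.
by rewrite lt0n card_porbit_neq0.
Qed.

Lemma card_porbit_set s (P : pred nat) :
  #|[set i | P #|porbit s i| ]| = \sum_(C in porbits s | P #|C|) #|C|.
Proof.
rewrite -sum1dep_card.
rewrite (partition_big (porbit s) (fun C => (C \in porbits s) && P #|C|)) /=.
  apply: eq_bigr => _ /andP[/imsetP[x _ ->] Px]; rewrite -sum1_card.
  apply: eq_bigl => i; rewrite eq_porbit_mem; apply: andb_idl.
  by rewrite -eq_porbit_mem => /eqP->.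
by move=> i ->; rewrite andbT; apply: imset_f.
Qed.

Lemma card_porbit_count s k :
  #|[set i | #|porbit s i| == k]| = (count_mem k (cycle_type s) * k)%N.
Proof.
rewrite (card_porbit_set s (pred1 k)) (eq_bigr (fun=> k)); last by move=> C /andP[_ /eqP].
rewrite sum_nat_const count_cycle_type; congr (_ * _)%N.
by apply: eq_card => C; rewrite inE.
Qed.

Lemma sumn_cycle_type s : sumn (cycle_type s) = n.
Proof.
rewrite sumnE (perm_big [seq #|c| | c : {set 'I_n} in porbits s]) ?perm_sort //=.
rewrite big_map big_enum /=.
transitivity #|[set i | predT #|porbit s i| ]|; last first.
  by rewrite -[RHS]card_ord; apply: eq_card => i; rewrite !inE.
by rewrite card_porbit_set; apply: eq_bigl => C; rewrite andbT.
Qed.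

(** The weight [k] loses the multiplicity of 0, which positivity of the entries supplies. *)
Lemma sorted_count_eq (a c : seq nat) :
  sorted leq a -> sorted leq c -> all (fun k => 0 < k) a ->
  all (fun k => 0 < k) c ->
  (forall k, 0 < k -> (count_mem k a * k)%N = (count_mem k c * k)%N) -> a = c.
Proof.
move=> sa sc /allP pa /allP pc E.
apply: (sorted_eq leq_trans anti_leq) => //; apply/allP => k _ /=; apply/eqP.
case: k => [|k].
  rewrite (count_memPn _) ?(count_memPn _) //.
    by apply/negP => /pc.
  by apply/negP => /pa.
by apply/eqP; rewrite -(@eqn_pmul2r k.+1) // E.
Qed.

Lemma cycle_type_eq s u :
  (forall k, #|[set i | #|porbit s i| == k]| = #|[set i | #|porbit u i| == k]|) ->
  cycle_type s = cycle_type u.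
Proof.
move=> E; apply: sorted_count_eq; rewrite ?cycle_type_sorted ?cycle_type_gt0 //.
by move=> k _; rewrite -!card_porbit_count E.
Qed.

Lemma porbit_conj s u i : porbit (s ^ u) (u i) = u @: porbit s i.
Proof.
apply/setP => j; apply/porbitP/imsetP => [[k ->]|[_ /porbitP[k ->] ->]].
  by exists ((s ^+ k) i); [exact: mem_porbit|rewrite -conjXg permJ].
by exists k; rewrite -conjXg permJ.
Qed.

Lemma cycle_type_conj s u : cycle_type (s ^ u) = cycle_type s.
Proof.
apply: cycle_type_eq => k; rewrite -[in RHS](card_imset _ (@perm_inj _ u)).
apply: eq_card => i; rewrite inE -[ i ](permKV u) porbit_conj.
by rewrite card_imset ?(mem_imset _ _ (@perm_inj _ u)) ?inE //; exact: perm_inj.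
Qed.

(** The trajectory starts at the image of [x], so [x] first occurs at an index one less than the
    length of its cycle. No cycle has more than [n] points, so [n] terms suffice. *)
Definition orbit_length c x := (index x (traject (nth 0 c) (nth 0 c x) n)).+1.

Lemma orbit_lengthE s (i : 'I_n) : orbit_length (code s) i = #|porbit s i|.
Proof.
rewrite /orbit_length nth_code.
have -> m : forall j : 'I_n, traject (nth 0 (code s)) j m = map val (traject s j m).
  by elim: m => //= m IH j; rewrite nth_code IH.
rewrite index_map; last exact: val_inj.
have p0 : 0 < #|porbit s i| by rewrite lt0n card_porbit_neq0.
have pE : porbit s (s i) = porbit s i by rewrite -[s i]/((s ^+ 1) i) porbit_perm.
have ple : #|porbit s i| <= n by rewrite -[X in _ <= X]card_ord max_card.
have -> : traject s (s i) n = traject s (s i) (#|porbit s i| + (n - #|porbit s i|)).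
  by rewrite subnKC.
rewrite trajectD index_cat.
have nthE : nth i (traject s (s i) #|porbit s i|) #|porbit s i|.-1 = i.
  by rewrite (set_nth_default (s i)) ?size_traject ?nth_traject ?prednK // -iterSr
    prednK // iter_porbit.
have -> : i \in traject s (s i) #|porbit s i|.
  by rewrite -{1}nthE mem_nth // size_traject prednK.
rewrite -[X in index X _]nthE index_uniq ?prednK ?size_traject ?prednK //.
by rewrite -pE uniq_traject_porbit.
Qed.

(** Points are counted instead of cycles: the cycles of length [k] contain [k] points each, so no
    list of cycles has to be built. *)
Definition has_cycle_type l c :=
  [&& sorted leq l, all (fun k => 0 < k) l, sumn l == n &
  let ls := [seq orbit_length c x | x <- iota 0 n] in
  all (fun k => (count_mem k l * k)%N == count_mem k ls) (iota 1 n)].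

Lemma leq_sumn_mem (l : seq nat) k : k \in l -> k <= sumn l.
Proof.
elim: l => //= x l IH; rewrite inE => /orP[/eqP->|/IH]; first exact: leq_addr.
by move/leq_trans; apply; exact: leq_addl.
Qed.

Lemma has_cycle_typeE l s : has_cycle_type l (code s) = (cycle_type s == l).
Proof.
have lsE k : count_mem k [seq orbit_length (code s) x | x <- iota 0 n] =
    (count_mem k (cycle_type s) * k)%N.
  rewrite -card_porbit_count -val_enum_ord -map_comp count_map -sum1_count.
  rewrite big_enum_cond /= -sum1dep_card; apply: eq_bigl => i /=.
  by rewrite orbit_lengthE.
apply/and4P/eqP => [[sl pl /eqP nl /allP H]|<-].
  apply: sorted_count_eq; rewrite ?cycle_type_sorted ?cycle_type_gt0 //.
  move=> k k0; have [kn|kn] := leqP k n.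
    by rewrite -lsE; apply/esym/eqP/H; rewrite mem_iota k0 add1n ltnS.
  rewrite !(count_memPn _) //; apply/negP => /leq_sumn_mem.
    by rewrite nl leqNgt kn.
  by rewrite sumn_cycle_type leqNgt kn.
rewrite cycle_type_sorted cycle_type_gt0 sumn_cycle_type eqxx; split=> //.
by apply/allP => k _; rewrite lsE.
Qed.

(* The permutation whose cycles, of lengths l, are blocks of consecutive integers. *)
Definition standard l := flatten [seq rot 1 p | p <- reshape l (iota 0 (sumn l))].

(** Writing the cycles one after another, by increasing length and each as a trajectory, lists all
    points in [L]; the conjugating permutation sends a point to its position in [L]. *)
Lemma conj_standard s : exists u, code (s ^ u) = standard (cycle_type s).
Proof.
pose tr (C : {set 'I_n}) := if [pick x in C] is Some x then traject s x #|C| else [::].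
have trP C : C \in porbits s ->
    [/\ size (tr C) = #|C|, tr C =i C & map s (tr C) = rot 1 (tr C)].
  case/imsetP => y _ ->; rewrite /tr; case: pickP => [x xy|/(_ y)]; last first.
    by rewrite porbit_id.
  have -> : porbit s y = porbit s x by apply/esym/eqP; rewrite eq_porbit_mem.
  split; first exact: size_traject.
    by move=> z; rewrite porbit_traject.
  have := iter_porbit s x; have := card_porbit_neq0 s x.
  case: #|porbit s x| => // m _ E; rewrite /= rot1_cons.
  have -> k z : map s (traject s z k) = traject s (s z) k.
    by elim: k z => //= k IH z; rewrite IH.
  by rewrite -[s x :: _]/(traject s (s x) m.+1) trajectSr -iterSr E.
pose cs := sort (relpre (fun C : {set 'I_n} => #|C|) leq) (enum (porbits s)).
have csE : cycle_type s = [seq #|C| | C : {set 'I_n} <- cs].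
  by rewrite /cycle_type sort_map.
have mcs C : (C \in cs) = (C \in porbits s) by rewrite mem_sort mem_enum.
pose L := flatten [seq tr C | C <- cs].
have shL : [seq size p | p <- [seq tr C | C <- cs]] = cycle_type s.
  rewrite csE -map_comp; apply/eq_in_map => C; rewrite mcs.
  by case/trP.
have sL : size L = n by rewrite /L size_flatten /shape shL sumn_cycle_type.
have mL i : i \in L.
  have iP : porbit s i \in porbits s by apply: imset_f.
  apply/flattenP; exists (tr (porbit s i)); first by rewrite map_f // mcs.
  by case/trP: iP => _ -> _; apply: porbit_id.
have uL : uniq L.
  apply: (@leq_size_uniq _ (enum 'I_n)); first exact: enum_uniq.
    by move=> i _; apply: mL.
  by rewrite sL size_enum_ord.
have idxP i : index i L < n by have := mL i; rewrite -index_mem sL.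
have uinj : injective (fun i => Ordinal (idxP i)).
  by move=> i j /(congr1 val) /= /(congr1 (nth i L)); rewrite !nth_index.
exists (perm uinj).
have idxL : [seq index i L | i <- L] = iota 0 n.
  apply: (@eq_from_nth _ 0); rewrite size_map ?size_iota // sL => k kn.
  have i0 : 'I_n by exists k.
  by rewrite (nth_map i0) ?sL // nth_iota // add0n index_uniq ?sL.
(* Replacing points by positions turns [L] into [iota 0 n], cut into blocks by the cycle lengths,
   while [s] acts on each trajectory as [rot 1]. *)
have stdE : standard (cycle_type s) = [seq index (s i) L | i <- L].
  rewrite /standard sumn_cycle_type -idxL -shL.
  rewrite -map_reshape -/(shape _) flattenK -map_comp.
  rewrite {2}/L map_flatten; congr flatten; rewrite -!map_comp.
  apply/eq_in_map => C; rewrite mcs /= => /trP[_ _ E].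
  by rewrite -map_rot -E -map_comp.
apply: codeP => [|i].
  by rewrite stdE size_map sL.
rewrite -[ i ](permKV (perm uinj)); set j := _ i.
by rewrite permJ !permE /= stdE (nth_map j) ?sL // nth_index.
Qed.

End CycleTypes.

(** * Conjugacy of transitive constellations *)

Section Conjugacy.
Variable n : nat.
Local Open Scope group_scope.
Implicit Types (g h : seq 'S_n) (q : seq (seq nat)).

Definition perm_funs g : seq ('I_n -> 'I_n) := [seq (s : 'I_n -> 'I_n) | s : 'S_n <- g].
Definition code_funs q : seq (nat -> nat) := [seq nth 0 c | c <- q].

(** A round that adds nothing ends the exploration, so 8 rounds suffice in degree at most 8. No
    proof relies on this: fullness or closedness of the list is always tested. *)
Definition reach q i := explore 8 (code_funs q) i.
Definition normal_form q i := relabel (code_funs q) (reach q i).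

Definition qcode g : seq (seq nat) := [seq code s | s <- g].

Lemma reach_qcode g (i : 'I_n) :
  reach (qcode g) i = map (@nat_of_ord n) (explore 8 (perm_funs g) i).
Proof.
rewrite /reach /code_funs /qcode -map_comp.
rewrite (@explore_map _ _ (@nat_of_ord n) _ (fun s : 'S_n => (s : 'I_n -> 'I_n))) //.
  exact: ord_inj.
by move=> s x /=; rewrite nth_code.
Qed.

Lemma normal_form_qcode g (i : 'I_n) :
  normal_form (qcode g) i = relabel (perm_funs g) (explore 8 (perm_funs g) i).
Proof.
rewrite /normal_form reach_qcode /code_funs /qcode -map_comp.
rewrite (@relabel_map _ _ (@nat_of_ord n) _ (fun s : 'S_n => (s : 'I_n -> 'I_n))) //.
  exact: ord_inj.
by move=> s x /=; rewrite nth_code.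
Qed.

Definition conj_seq g u : seq 'S_n := [seq s ^ u | s <- g].

Lemma normal_form_conj g u (i : 'I_n) :
  normal_form (qcode (conj_seq g u)) (u i) = normal_form (qcode g) i.
Proof.
rewrite !normal_form_qcode /perm_funs /conj_seq -!map_comp.
have uF (s : 'S_n) x : u (s x) = (s ^ u) (u x) by rewrite permJ.
rewrite (explore_map (@perm_inj _ u) uF) (relabel_map (@perm_inj _ u) uF) //.
Qed.

(** The conjugating permutation sends the k-th point discovered from [i] to the k-th point
    discovered from [j]. Equality of the relabelled lists says exactly that it intertwines [g] and
    [h]. *)
Lemma normal_form_conj_inj g h (i j : 'I_n) :
  size (reach (qcode g) i) = n -> size (reach (qcode h) j) = n ->
  normal_form (qcode g) i = normal_form (qcode h) j -> exists u, h = conj_seq g u.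
Proof.
rewrite !reach_qcode !size_map !normal_form_qcode.
have := explore_uniq 8 (perm_funs g) i; have := explore_uniq 8 (perm_funs h) j.
move: (explore _ _ i) (explore _ _ j) => b c uc ub sb sc.
have full (d : seq 'I_n) : uniq d -> size d = n -> forall x, x \in d.
  move=> ud sd x; have := @uniq_min_size _ d (enum 'I_n) ud.
  case=> [y _||_ ->]; rewrite ?mem_enum //.
  by rewrite sd size_enum_ord.
have ic x : index x b < size c.
  by rewrite sc; have := full b ub sb x; rewrite -index_mem sb.
have finj : injective (fun x => nth i c (index x b)).
  move=> x y /eqP; rewrite nth_uniq // => /eqP E.
  by rewrite -(nth_index i (full b ub sb x)) E nth_index ?full.
move=> E; exists (perm finj).
apply: (@eq_from_nth _ 1) => [|k kh].
  by rewrite size_map; have := congr1 size E; rewrite !size_map.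
have kg : k < size g by have := congr1 size E; rewrite !size_map => ->.
rewrite (nth_map 1) //; set s := nth 1 g k; set t := nth 1 h k.
have Ek : [seq index (s x) b | x <- b] = [seq index (t x) c | x <- c].
  have := congr1 (fun e => nth [::] e k) E; rewrite /relabel /perm_funs -!map_comp.
  by rewrite !(nth_map 1).
apply/permP => y; rewrite -[y](permKV (perm finj)); set x := _ y.
rewrite permJ !permE; have xb := full b ub sb x.
have := congr1 (fun e => nth 0 e (index x b)) Ek.
rewrite (nth_map i) ?index_mem // nth_index // => ->.
by rewrite (nth_map i) // nth_index // full.
Qed.

Definition mon_group g := <<[set s in g]>>.

Lemma reach_transitive g (i : 'I_n) : size (reach (qcode g) i) = n ->
  [transitive mon_group g, on [set: 'I_n] | 'P].
Proof.
rewrite reach_qcode size_map => sb.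
have sub x : x \in explore 8 (perm_funs g) i -> x \in orbit 'P (mon_group g) i.
  apply: explore_ind => [|y yi]; first exact: orbit_refl.
  rewrite all_map; apply/allP => s sg /=.
  rewrite -(orbit_eqP yi); apply/orbitP; exists s => //.
  by apply: mem_gen; rewrite inE.
have full x : x \in explore 8 (perm_funs g) i.
  have := @uniq_min_size _ (explore 8 (perm_funs g) i) (enum 'I_n) (explore_uniq _ _ _).
  by case=> [y _||_ ->]; rewrite ?mem_enum // sb size_enum_ord.
apply/imsetP; exists i => //; apply/setP => x.
by rewrite inE sub.
Qed.

(** A closed list is an invariant set containing [i], hence contains its orbit. In the enumeration
    this discards the candidates whose exploration stalls early. *)
Lemma transitive_reach g (i : 'I_n) :
  [transitive mon_group g, on [set: 'I_n] | 'P] ->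
  closed_under (code_funs (qcode g)) (reach (qcode g) i) ->
  size (reach (qcode g) i) = n.
Proof.
move=> tr; rewrite reach_qcode /code_funs /qcode -map_comp.
rewrite (@closed_under_map _ _ (@nat_of_ord n) _ (fun s : 'S_n => (s : 'I_n -> 'I_n))) //;
  first last.
- by move=> s x /=; rewrite nth_code.
- exact: ord_inj.
rewrite -/(perm_funs g) size_map; set b := explore _ _ _ => /allP cl.
have acts : [acts mon_group g, on [set x in b] | 'P].
  rewrite gen_subG; apply/fintype.subsetP => s; rewrite inE => sg; rewrite !inE /=.
  apply/fintype.subsetP => x; rewrite !inE => /cl; rewrite all_map => /allP /(_ s sg).
  by [].
rewrite -[RHS]card_ord -(card_uniqP (explore_uniq _ _ _)) -/b.
apply: eq_card => x; rewrite inE.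
have /fintype.subsetP : orbit 'P (mon_group g) i \subset [set x in b].
  by rewrite acts_sub_orbit // inE mem_explore.
rewrite (atransP tr) ?inE // => /(_ x); rewrite !inE; exact.
Qed.

End Conjugacy.
Arguments reach : simpl never.
Arguments normal_form : simpl never.

(** * Enumeration of involutions *)

Section Involutions.
Variable n : nat.

(** Here [p] holds the values at the points below [size p], and [v] is proposed as the value at
    [size p]. A smaller [v] must already be sent to [size p]; otherwise neither number may have been
    used, and [v = size p] is a fixed point. This pruning leaves 764 lists in degree 8 instead of
    40320. *)
Definition next_involution p v :=
  if v < size p then nth 0 p v == size p else (size p \notin p) && (v \notin p).

Fixpoint involutions k : seq (seq nat) :=
  if k is k'.+1 then
    [seq rcons p v | p <- involutions k',
                     v <- [seq v <- iota 0 n | next_involution p v]]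
  else [:: [::]].

Lemma mem_involutions (s : 'S_n) : (forall i, s (s i) = i) ->
  code s \in involutions n.
Proof.
move=> ss; suff H k : k <= n -> take k (code s) \in involutions k.
  by have := H n (leqnn n); rewrite take_oversize ?size_code.
elim: k => [|k IH] kn; first by rewrite take0 mem_seq1.
pose i := Ordinal kn; have kE : k = i :> nat by [].
rewrite /= (take_nth 0) ?size_code // kE nth_code.
apply: allpairs_f_dep; first exact/IH/ltnW.
rewrite mem_filter mem_iota /= add0n ltn_ord andbT /next_involution.
have sz : size (take i (code s)) = i by rewrite size_take size_code ltn_ord.
have memP (x : nat) : x \in take i (code s) -> exists2 j : 'I_n, j < i & x = s j.
  case/(nthP 0) => j; rewrite sz => ji; rewrite nth_take // => <-.
  by exists (Ordinal (ltn_trans ji kn)); rewrite // -nth_code.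
rewrite sz; case: ltnP => [si|le_is].
  by rewrite nth_take // nth_code ss.
apply/andP; split; apply/negP => /memP[j ji /val_inj E].
  by move: le_is; rewrite [in s i]E ss leqNgt ji.
by move: ji; rewrite (perm_inj E) ltnn.
Qed.

Lemma involutive_cycle_type (s : 'S_n) : all (fun k => k <= 2) (cycle_type s) ->
  forall i, s (s i) = i.
Proof.
move=> /allP H i; have := iter_porbit s i; have := card_porbit_neq0 s i.
have /H : #|porbit s i| \in cycle_type s.
  rewrite mem_sort; apply/mapP; exists (porbit s i) => //.
  by rewrite mem_enum imset_f.
by case: #|_| => [|[|[|]]] //= _ _ E; rewrite !E.
Qed.

End Involutions.

(** * Braids *)

Section Braids.
Variable n : nat.
Local Open Scope group_scope.
Implicit Types (g h : quad n) (s u : 'S_n) (q : seq (seq nat)) (A : {set quad n}).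

Lemma entry_sigma (i : 'I_3) g j : j < 4 -> entry (sigma n i g) j =
   if j == i :> nat then entry g i.+1
   else if j == i.+1 :> nat then entry g i ^ entry g i.+1
   else entry g j.
Proof. by move=> lj; rewrite permE /entry -(tnth_nth _ _ (Ordinal lj)) tnth_mktuple. Qed.

Lemma entry_conj g u j : entry (conj_quad g u) j = entry g j ^ u.
Proof.
rewrite /entry /=; have [jg|gj] := ltnP j (size g); first by rewrite (nth_map 1).
by rewrite !nth_default ?size_map // conj1g.
Qed.

Lemma quad_eqP g h : (forall j, j < 4 -> entry g j = entry h j) -> g = h.
Proof.
by move=> E; apply/val_inj/(@eq_from_nth _ 1); rewrite !size_tuple.
Qed.

Lemma sigma_conj (i : 'I_3) g u : sigma n i (conj_quad g u) = conj_quad (sigma n i g) u.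
Proof.
apply: quad_eqP => j lj; rewrite entry_conj !entry_sigma // !entry_conj.
by case: ifP => // _; case: ifP => // _; rewrite -conjJg.
Qed.

Lemma mem_entry g j : j < 4 -> entry g j \in (g : seq _).
Proof. by move=> lj; rewrite mem_nth ?size_tuple. Qed.

Lemma entry_group g j : j < 4 -> entry g j \in mon_group g.
Proof. by move=> lj; rewrite mem_gen // inE mem_entry. Qed.

Lemma mon_group_subP g (G : {group 'S_n}) :
  (forall j, j < 4 -> entry g j \in G) -> mon_group g \subset G.
Proof.
move=> H; rewrite gen_subG; apply/fintype.subsetP => s; rewrite inE.
by case/(nthP 1) => j; rewrite size_tuple => lj <-; apply: H.
Qed.

(** The old entry [i] is recovered from its conjugate and the conjugating entry. One inclusion is
    enough, since transitivity passes to larger groups. *)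
Lemma sigma_group (i : 'I_3) g : mon_group g \subset mon_group (sigma n i g).
Proof.
have li := ltn_ord i.
have e1 : entry g i.+1 \in mon_group (sigma n i g).
  by have := entry_group (sigma n i g) (ltnW li); rewrite entry_sigma ?eqxx // ltnW.
apply: mon_group_subP => j lj; have [->//|ni1] := eqVneq j i.+1.
have [->|ni] := eqVneq j i; last first.
  have := entry_group (sigma n i g) lj.
  by rewrite entry_sigma // (negPf ni) (negPf ni1).
have := @entry_group (sigma n i g) i.+1 li.
rewrite entry_sigma // eqxx gtn_eqF // => ec.
by have := groupJ ec (groupVr e1); rewrite conjgK.
Qed.

Definition entry_product g := entry g 0 * entry g 1 * entry g 2 * entry g 3.

(** This is [x * y = y * x ^ y] at the two positions concerned. *)
Lemma sigma_product (i : 'I_3) g : entry_product (sigma n i g) = entry_product g.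
Proof.
rewrite /entry_product !entry_sigma //.
case: i => [[|[|[|]]]] //= _; first by rewrite -conjgC.
  by rewrite -(mulgA (entry g 0)) -conjgC mulgA.
by rewrite -mulgA -conjgC mulgA.
Qed.

(** The properties are attached to a braid together with its permutation of positions, which makes
    them stable under products; for a pure braid each entry is conjugate to the entry at the same
    position. *)
Definition braid_spec (ps : 'S_4 * {perm quad n}) : Prop :=
  [/\ forall g, entry_product (ps.2 g) = entry_product g,
      forall g, mon_group g \subset mon_group (ps.2 g),
      forall g (j : 'I_4), exists u, entry (ps.2 g) (ps.1 j) = entry g j ^ u &
      forall g u, ps.2 (conj_quad g u) = conj_quad (ps.2 g) u].

Lemma braid_spec1 : braid_spec (1, 1).
Proof.
split=> [g|g|g j|g u]; rewrite /= ?perm1 //.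
by exists 1; rewrite conjg1.
Qed.

Lemma braid_specM x y : braid_spec x -> braid_spec y -> braid_spec (x.1 * y.1, x.2 * y.2).
Proof.
move=> [xp xg xe xc] [yp yg ye yc]; split=> [g|g|g j|g u]; rewrite /= permM.
- by rewrite yp xp.
- exact: fintype.subset_trans (xg g) (yg _).
- rewrite permM; have [u Eu] := xe g j; have [v Ev] := ye (x.2 g) (x.1 j).
  by exists (u * v); rewrite Ev Eu conjgM.
by rewrite permM xc yc.
Qed.

Lemma braid_spec_sigma i : braid_spec (position_swap i, sigma n i).
Proof.
split=> [g|g|g j|g u] /=; [exact: sigma_product|exact: sigma_group| |exact: sigma_conj].
have li := ltn_ord i; rewrite /position_swap entry_sigma //.
have v0 : @inord 3 i = i :> nat by rewrite inordK // ltnW.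
have v1 : @inord 3 i.+1 = i.+1 :> nat by rewrite inordK.
case: tpermP => [->|->|ji ji1].
- by exists (entry g i.+1); rewrite v0 v1 eqxx gtn_eqF.
- by exists 1; rewrite v0 v1 eqxx conjg1.
exists 1; rewrite conjg1; case: eqP => [E|_].
  by case: ji; apply: val_inj; rewrite /= v0.
by case: eqP => // E; case: ji1; apply: val_inj; rewrite /= v1.
Qed.

(** In a finite group a generated subgroup consists of products of generators, so inverses need no
    separate treatment. *)
Lemma braid_imageP ps : ps \in braid_image n -> braid_spec ps.
Proof.
case/gen_prodgP => m [c cP ->]; elim/big_ind: _ => [||k _].
- exact: braid_spec1.
- exact: braid_specM.
by have /imsetP[i _ ->] := cP k; exact: braid_spec_sigma.
Qed.

Lemma pure_braid_group_set : group_set (pure_braid_image n).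
Proof.
apply/group_setP; split=> [|s u]; rewrite !inE; first exact: group1.
by move=> hs hu; rewrite -[X in (X, _)](mulg1 1); exact: (groupM hs hu).
Qed.

Definition pure_braid_group := Group pure_braid_group_set.

Lemma pure_braidP (s : {perm quad n}) : s \in pure_braid_image n -> braid_spec (1, s).
Proof. by rewrite inE; apply: braid_imageP. Qed.

Lemma conj_quad1 g : conj_quad g 1 = g.
Proof. by apply: quad_eqP => j _; rewrite entry_conj conjg1. Qed.

Lemma conj_quadM g u v : conj_quad g (u * v) = conj_quad (conj_quad g u) v.
Proof. by apply: quad_eqP => j _; rewrite !entry_conj conjgM. Qed.

Lemma mem_conj_class g : g \in conj_class g.
Proof. by apply/imsetP; exists 1; rewrite ?conj_quad1. Qed.

Lemma conj_class_conj g u : conj_class (conj_quad g u) = conj_class g.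
Proof.
apply/setP => h; apply/imsetP/imsetP => -[v _ ->].
  by exists (u * v); rewrite // conj_quadM.
by exists (u^-1 * v); rewrite // -conj_quadM mulKVg.
Qed.

(** Braids commute with simultaneous conjugation, so orbits of classes can be computed on
    representatives. *)
Lemma pure_braid_class (s : {perm quad n}) g : s \in pure_braid_image n ->
  ('P^*)%act (conj_class g) s = conj_class (s g).
Proof.
move=> /pure_braidP[_ _ _ sc]; apply/setP => h.
apply/imsetP/imsetP => [[_ /imsetP[u _ ->] ->]|[u _ ->]].
  by exists u; rewrite //= -sc.
by exists (conj_quad g u); [exact: imset_f|rewrite /= [aperm _ _]sc].
Qed.

Lemma mem_pure_braid_orbit g B : B \in pure_braid_orbit (conj_class g) ->
  exists2 s, s \in pure_braid_image n & B = conj_class (s g).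
Proof.
by case/imsetP => s sP ->; exists s => //; rewrite pure_braid_class.
Qed.

Lemma quad_pattern_pure (s : {perm quad n}) g : s \in pure_braid_image n ->
  quad_pattern (s g) = quad_pattern g.
Proof.
move=> /pure_braidP[_ _ se _].
have E j (lj : j < 4) : cycle_type (entry (s g) j) = cycle_type (entry g j).
  by have [u] := se g (Ordinal lj); rewrite perm1 /= => ->; rewrite cycle_type_conj.
by rewrite /quad_pattern !E.
Qed.

Lemma is_2cycle_conj u v : is_2cycle u -> is_2cycle (u ^ v).
Proof.
case/existsP => x /existsP[y /andP[xy /eqP->]].
apply/existsP; exists (v x); apply/existsP; exists (v y).
by rewrite (inj_eq perm_inj) xy tpermJ /=.
Qed.

Lemma quad_pattern_conj g u : quad_pattern (conj_quad g u) = quad_pattern g.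
Proof. by rewrite /quad_pattern !entry_conj !cycle_type_conj. Qed.

Lemma transitive_sub (G H : {group 'S_n}) : G \subset H ->
  [transitive G, on [set: 'I_n] | 'P] -> [transitive H, on [set: 'I_n] | 'P].
Proof.
move=> GH tr; case/imsetP: (tr) => i _ _; apply/imsetP; exists i => //.
apply/setP => x; rewrite inE; apply/esym.
have : x \in orbit 'P G i by rewrite (atransP tr) inE.
by apply: fintype.subsetP; apply: imsetS.
Qed.

Lemma constellation_pure (s : {perm quad n}) g : s \in pure_braid_image n ->
  constellation g -> constellation (s g).
Proof.
move=> /pure_braidP[sp sg _ _] /andP[/eqP p1 tr]; apply/andP; split.
  by apply/eqP; have := sp g; rewrite /entry_product /= => ->.
by apply: transitive_sub tr; apply: sg.
Qed.

Lemma is_2cycle_pure (s : {perm quad n}) g j : j < 4 -> s \in pure_braid_image n ->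
  is_2cycle (entry g j) -> is_2cycle (entry (s g) j).
Proof.
move=> lj /pure_braidP[_ _ se _].
by have [u] := se g (Ordinal lj); rewrite perm1 /= => ->; apply: is_2cycle_conj.
Qed.

Lemma constellation_conj g u : constellation g -> constellation (conj_quad g u).
Proof.
case/andP => /eqP p1 tr; rewrite /constellation !entry_conj -!conjMg p1 conj1g eqxx /=.
case/imsetP: (tr) => i _ _; apply/imsetP; exists (u i) => //.
apply/setP => x; rewrite inE; apply/esym.
have : u^-1 x \in orbit 'P (mon_group g) i by rewrite (atransP tr) inE.
case/orbitP => s sg /= E; apply/orbitP; exists (s ^ u); last first.
  by rewrite /= /aperm permJ -[s i]/(aperm i s) E permKV.
rewrite -[<<_>>]/(mon_group (conj_quad g u)) -groupV.
have : s \in mon_group (conj_quad g u) :^ u^-1.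
  apply: (fintype.subsetP _ s sg); apply: (@mon_group_subP _ [group of _ :^ _]) => j lj.
  by rewrite /= mem_conjgV -entry_conj entry_group.
by rewrite groupV mem_conjgV.
Qed.

(** A transposition is the identity, which has [n] cycles, multiplied by a transposition that merges
    two of them. *)
Lemma card_porbits_2cycle s : is_2cycle s -> #|porbits s|.+1 = n.
Proof.
case/existsP => x /existsP[y /andP[xy /eqP->]].
have := porbits_mul_tperm 1 x y; rewrite /= mulg1 xy.
have p1 z : porbit (1 : 'S_n) z = [set z].
  by apply/setP => t; rewrite inE; apply/porbitP/eqP => [[k]|->];
    [rewrite expg1n perm1|exists 0; rewrite perm1].
rewrite p1 inE xy; have -> : #|porbits (1 : 'S_n)| = n.
  rewrite /porbits card_imset ?cardsT ?card_ord //.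
  by move=> z t; rewrite !p1 => /set1_inj.
by rewrite addn2 addn1 => -[].
Qed.

End Braids.

(** * Certified enumeration of almost-dessins *)

Section Invariants.
Variable n : nat.
Local Open Scope group_scope.
Implicit Types (g : quad n).

Lemma numE_cycle_type m g : numE m g =
  (size (cycle_type (entry g 0)) + count odd (cycle_type (entry g 1))
   + count (fun k => ~~ (m %| k)) (cycle_type (entry g 3)))%N.
Proof. by rewrite /numE size_cycle_type !count_cycle_type. Qed.

Lemma leq_card_porbits (s : 'S_n) : #|porbits s| <= n.
Proof. by rewrite -[X in _ <= X]card_ord leq_imset_card. Qed.

(** As g_t has n - 1 cycles, the genus formula reads 4n - (c_0 + c_1 + c_oo) - (n - 1) = 2n - 2,
    with c_i the number of cycles of g_i. The bounds by [n] make the truncated subtractions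
    exact. *)
Lemma planar_2cycle g : is_2cycle (entry g 2) ->
  planar g = (size (cycle_type (entry g 0)) + size (cycle_type (entry g 1))
              + size (cycle_type (entry g 3)) == n + 3)%N.
Proof.
move=> /card_porbits_2cycle c2; rewrite /planar !big_ord_recl big_ord0 /=.
rewrite !size_cycle_type.
have := leq_card_porbits (entry g 0); have := leq_card_porbits (entry g 1).
have := leq_card_porbits (entry g 3).
have : 0 < #|porbits (entry g 0)|.
  have [z _] : {z : 'I_n | true} by case: n g c2 => [//|k] *; exists ord0.
  by rewrite card_gt0; apply/set0Pn; exists (porbit (entry g 0) z); exact: imset_f.
rewrite -[bump 0 0]/1%N -[bump 0 (bump 0 0)]/2%N -[bump 0 (bump 0 (bump 0 0))]/3%N.
move: #|porbits (entry g 0)| #|porbits (entry g 1)| #|porbits (entry g 2)|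
  #|porbits (entry g 3)| c2 => a b c d; lia.
Qed.

End Invariants.

(** * Computable certificates and their soundness *)

Section Certificates.
Variable n : nat.
Implicit Types (q : seq (seq nat)) (w : seq nat) (W : seq (seq nat)) (p : pattern).

Definition code_sigma i q :=
  [seq if j == i then nth [::] q i.+1
       else if j == i.+1 then code_conj (nth [::] q i) (nth [::] q i.+1)
       else nth [::] q j | j <- iota 0 4].

(* The palindromic braids s_1 .. s_k s_k .. s_1 are pure. *)
Definition code_palindrome w q := foldl (fun q i => code_sigma i q) q (w ++ rev w).
Definition code_pure W q := foldl (fun q w => code_palindrome w q) q W.

Definition normal_forms q := [seq normal_form q i | i <- iota 0 n].

Definition candidates p : seq (seq (seq nat)) :=
  let c3 := standard p.2 in
  [seq q <- [seq [:: code_inv (code_mul (code_mul a t) c3); a; t; c3]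
      | a <- [seq a <- involutions n n | has_cycle_type n p.1.2 a],
        t <- [seq code_tperm n x y | x <- iota 0 n, y <- [seq y <- iota 0 n | x < y]]]
   | has_cycle_type n p.1.1 (nth [::] q 0)].

(** A list that stalls on a proper closed subset is intransitive and may be ignored. If the
    exploration is neither full nor closed the test fails, so too few rounds could never give a
    false conclusion. The base point 0 is enough here because [nfs] is built from all base
    points. *)
Definition recognized (nfs : seq (seq (seq nat))) q :=
  if size (reach q 0) == n then normal_form q 0 \in nfs
  else closed_under (code_funs q) (reach q 0).

(** Cycle lengths at most 2 make g_1 an involution, so that [candidates] misses no conjugacy class
    with this pattern. *)
Definition complete p (qs : seq (seq (seq nat))) :=
  all (fun k => k <= 2) p.1.2 &&
  all (recognized (flatten [seq normal_forms q | q <- qs])) (candidates p).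

Definition valid_rep m e p q :=
  [&& size q == 4, all (is_code n) q,
      foldl code_mul (nth [::] q 0) [:: nth [::] q 1; nth [::] q 2; nth [::] q 3]
        == iota 0 n,
      has_cycle_type n p.1.1 (nth [::] q 0),
      has_cycle_type n p.1.2 (nth [::] q 1),
      has_cycle_type n p.2 (nth [::] q 3),
      has (fun x => has (fun y => (x < y) && (nth [::] q 2 == code_tperm n x y))
                        (iota 0 n)) (iota 0 n),
      size p.1.1 + size p.1.2 + size p.2 == n + 3 &
      size p.1.1 + count odd p.1.2 + count (fun k => ~~ (m %| k)) p.2 == e].

(** The empty word puts [q] itself among the images. The normal form of one image at 0 is compared
    with those of another at all base points, which is what conjugacy would require; the orbit
    length is then [size Ws]. *)
Definition row_certificate m e p q Ws :=
  let qs := [seq code_pure W q | W <- Ws] in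
  [&& valid_rep m e p q,
      all (fun q => all (fun i => size (reach q i) == n) (iota 0 n)) qs,
      pairwise (fun q q' => normal_form q 0 \notin normal_forms q') qs,
      all (all (all (fun i => i < 3))) Ws,
      [::] \in Ws & complete p qs].

Arguments candidates : simpl never.
Local Open Scope group_scope.
Implicit Types (g h : quad n).

Lemma nth_qcode g j : j < 4 -> nth [::] (qcode g) j = code (entry g j).
Proof. by move=> lj; rewrite (nth_map 1) ?size_tuple. Qed.

Lemma qcode_sigma (i : 'I_3) g : qcode (sigma n i g) = code_sigma i (qcode g).
Proof.
have li := ltn_ord i; apply: (@eq_from_nth _ [::]) => [|j].
  by rewrite !size_map size_iota size_tuple.
rewrite size_map size_tuple => lj; rewrite nth_qcode // entry_sigma //.
rewrite (nth_map 0) ?size_iota // nth_iota // add0n !nth_qcode //; last exact: ltnW.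
by case: ifP => // _; case: ifP => // _; rewrite code_conjE.
Qed.

Lemma qcode_inj : injective (fun g => qcode g).
Proof. by move=> g h /(inj_map (@code_inj n)) /val_inj. Qed.

(** Surrounding a pure braid by the same [sigma] on both sides applies a swap of positions twice, so
    the result is again pure. *)
Lemma palindrome_pure w : all (fun i => i < 3) w ->
  exists2 s : {perm quad n}, s \in pure_braid_image n &
    forall g, qcode (s g) = code_palindrome w (qcode g).
Proof.
elim: w => [_|i w IH /= /andP[li /IH[s]]].
  by exists 1 => [|g]; rewrite ?inE ?group1 // perm1.
rewrite inE => sP sE; pose x := (position_swap (Ordinal li), sigma n (Ordinal li)).
have xP : x \in braid_image n by apply/mem_gen/imset_f.
exists (x.2 * s * x.2) => [|g].
  have : x * (1, s) * x \in braid_image n by rewrite !groupM.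
  have -> : x * (1, s) * x = (x.1 * 1 * x.1, x.2 * s * x.2) by [].
  by rewrite inE mulg1 tperm2.
rewrite !permM qcode_sigma sE qcode_sigma /code_palindrome.
by rewrite rev_cons cat_cons -rcons_cat /= foldl_rcons.
Qed.

Lemma code_pureP W : all (all (fun i => i < 3)) W ->
  exists2 s : {perm quad n}, s \in pure_braid_image n &
    forall g, qcode (s g) = code_pure W (qcode g).
Proof.
elim: W => [_|w W IH /= /andP[/palindrome_pure[s sP sE] /IH[u uP uE]]].
  by exists 1 => [|g]; rewrite ?inE ?group1 // perm1.
exists (s * u) => [|g]; last by rewrite permM uE sE.
exact: (@groupM _ (pure_braid_group n)).
Qed.

(** Conjugation by [u] moves the base point [k] to [u k]; only the set of normal forms over all base
    points is an invariant. *)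
Lemma normal_forms_conj g u : normal_forms (qcode (conj_quad g u)) =i normal_forms (qcode g).
Proof.
move=> e; apply/mapP/mapP => -[k]; rewrite mem_iota add0n => li ->.
  exists (val (u^-1 (Ordinal li))); first by rewrite mem_iota /=.
  by have := normal_form_conj g u (u^-1 (Ordinal li)); rewrite permKV.
exists (val (u (Ordinal li))); first by rewrite mem_iota /=.
by have := normal_form_conj g u (Ordinal li).
Qed.

Lemma is_2cycle_code (s : 'S_n) : is_2cycle s ->
  code s \in [seq code_tperm n x y | x <- iota 0 n, y <- [seq y <- iota 0 n | x < y]].
Proof.
case/existsP => x /existsP[y /andP[xy /eqP->]].
wlog lt_xy : x y xy / x < y.
  move=> H; case: (ltngtP x y) => [|yx|E]; first exact: H.
    by rewrite tpermC; apply: H; rewrite // eq_sym.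
  by move: xy; rewrite (val_inj E) eqxx.
rewrite code_tpermE; apply: allpairs_f_dep; first by rewrite mem_iota /=.
by rewrite mem_filter mem_iota /= lt_xy ltn_ord.
Qed.

Lemma completeP p qs g : complete p qs -> constellation g -> is_2cycle (entry g 2) ->
  quad_pattern g = p ->
  exists q u (z : 'I_n), [/\ q \in qs, size (reach (qcode (conj_quad g u)) z) = n &
    exists i : 'I_n, normal_form (qcode (conj_quad g u)) z = normal_form q i].
Proof.
case: p => [[l0 l1] l3]. rewrite /complete. move=> /andP[l1_le2 comp].
move=> cg tg [p0 p1 p3].
have {}comp := allP comp.
have [u uE] := conj_standard (entry g 3); rewrite p3 in uE.
set h := conj_quad g u.
have ch : constellation h by exact: constellation_conj.
have th : is_2cycle (entry h 2) by rewrite entry_conj; exact: is_2cycle_conj.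
have n0 : 0 < n by case/existsP: tg => x _; exact: leq_ltn_trans (ltn_ord x).
have pE : quad_pattern h = (l0, l1, l3) by rewrite quad_pattern_conj /quad_pattern p0 p1 p3.
case: pE => h0 h1 h3.
have e0 : entry h 0 = (entry h 1 * entry h 2 * entry h 3)^-1.
  case/andP: ch => /eqP E _; apply/eqP.
  by rewrite -eq_invg_sym eq_invg_mul !mulgA E.
have c3 : code (entry h 3) = standard l3 by rewrite entry_conj.
have hq : qcode h \in candidates (l0, l1, l3).
  rewrite mem_filter nth_qcode // has_cycle_typeE h0 eqxx /=.
  have -> : qcode h = [:: code_inv (code_mul (code_mul (code (entry h 1))
      (code (entry h 2))) (standard l3)); code (entry h 1); code (entry h 2); standard l3].
    rewrite -c3 -!code_mulE -code_invE -e0.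
    apply: (@eq_from_nth _ [::]); first by rewrite size_map size_tuple.
    move=> j; rewrite size_map size_tuple => lj; rewrite nth_qcode //.
    by case: j lj => [|[|[|[|]]]].
  have := is_2cycle_code th; set ts := [seq _ | x <- _, y <- _]; move=> tts.
  apply/allpairsP; exists (code (entry h 1), code (entry h 2)); split=> //=.
  rewrite mem_filter has_cycle_typeE h1 eqxx /=.
  by apply/mem_involutions/involutive_cycle_type; rewrite h1.
have tr := andP ch.
have := comp _ hq; rewrite /recognized.
case: eqP => [sz /flattenP[_ /mapP[q qqs ->] /mapP[k]]|sz cl].
  rewrite mem_iota add0n => li nE; exists q, u, (Ordinal n0).
  split; [exact: qqs|exact: sz|exists (Ordinal li); exact: nE].
(* The stalled case contradicts transitivity of the conjugate. *)
by case: sz; exact: (@transitive_reach n h (Ordinal n0) tr.2 cl).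
Qed.

End Certificates.

(** * From a certificate to a pure braid orbit *)

Section RowOrbit.
Variables (n m e : nat) (p : pattern).
Local Open Scope group_scope.
Implicit Types (g h : quad n) (q : seq (seq nat)) (s : {perm quad n}).

Lemma mem_orbit_class g : conj_class g \in pure_braid_orbit (conj_class g).
Proof. exact: (@orbit_refl _ _ _ ('P^*)%act (pure_braid_group n)). Qed.

Lemma pure_braid_orbit_eq (A B : {set quad n}) :
  A \in pure_braid_orbit B -> pure_braid_orbit A = pure_braid_orbit B.
Proof.
exact: (elimT (@orbit_eqP _ _ ('P^*)%act (pure_braid_group n) A B)).
Qed.

Lemma orbit_has_patternP g :
  reflect (quad_pattern g = p) (orbit_has_pattern p (pure_braid_orbit (conj_class g))).
Proof.
apply: (iffP forall_inP) => [/(_ _ (mem_orbit_class g)) /forall_inP|gp B].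
  by move/(_ _ (mem_conj_class g)) => /eqP.
case/mem_pure_braid_orbit => s sP ->; apply/forall_inP => h /imsetP[u _ ->].
by rewrite quad_pattern_conj quad_pattern_pure // gp.
Qed.

Lemma mem_pure_braid_orbits (O : {set {set quad n}}) : O \in pure_braid_orbits m e n ->
  exists g, [/\ O = pure_braid_orbit (conj_class g), almost_dessin_rep g & numE m g = e].
Proof.
case/imsetP => A /imsetP[g]; rewrite inE => /andP[ag /eqP eg] -> ->.
by exists g.
Qed.

Lemma valid_repP q : valid_rep n m e p q -> size (reach q 0) = n ->
  exists g, [/\ qcode g = q, almost_dessin_rep g,
                numE m g = e & quad_pattern g = p].
Proof.
case/and5P => /eqP sz /allP codes /eqP prod h0 /and5P[h1 h3].
have [a [b [c [d qE]]]] : exists a b c d, q = [:: a; b; c; d].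
  by case: (q) sz => [|a [|b [|c [|d []]]]] // _; exists a, b, c, d.
rewrite qE in codes prod h0 h1 h3 *.
rewrite -[foldl _ _ _]/(code_mul (code_mul (code_mul a b) c) d) in prod.
rewrite -[nth _ _ _]/a in h0; rewrite -[nth _ _ _]/b in h1.
rewrite -[nth _ _ _]/d in h3; rewrite -[nth _ _ 2]/c.
have cP x : x \in [:: a; b; c; d] -> exists s : 'S_n, code s = x by move/codes/is_codeP.
have [g0 E0] := cP a (@mem_nth _ [::] [:: a; b; c; d] 0 isT).
have [g1 E1] := cP b (@mem_nth _ [::] [:: a; b; c; d] 1 isT).
have [gt Et] := cP c (@mem_nth _ [::] [:: a; b; c; d] 2 isT).
have [g3 E3] := cP d (@mem_nth _ [::] [:: a; b; c; d] 3 isT).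
case/hasP => x; rewrite mem_iota add0n => xn /hasP[y]; rewrite mem_iota add0n => yn.
case/andP => xy /eqP ct /eqP pl /eqP nE sr.
pose g : quad n := [tuple g0; g1; gt; g3].
have qg : qcode g = [:: a; b; c; d] by rewrite /qcode /= E0 E1 Et E3.
have tE : gt = tperm (Ordinal xn) (Ordinal yn).
  by apply: code_inj; rewrite code_tpermE Et.
have tg : is_2cycle (entry g 2).
  apply/existsP; exists (Ordinal xn); apply/existsP; exists (Ordinal yn).
  by rewrite -(inj_eq val_inj) /= neq_ltn xy /entry /= tE eqxx.
have gp : quad_pattern g = p.
  move: h0 h1 h3; rewrite -E0 -E1 -E3 !has_cycle_typeE /quad_pattern /entry /=.
  by move=> /eqP-> /eqP-> /eqP->; case: (p) => [[]].
have [gp0 gp1 gp3] : [/\ cycle_type (entry g 0) = p.1.1,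
   cycle_type (entry g 1) = p.1.2 & cycle_type (entry g 3) = p.2] by rewrite -gp.
exists g; split=> //; last by rewrite numE_cycle_type gp0 gp1 gp3.
rewrite /almost_dessin_rep tg planar_2cycle // gp0 gp1 gp3 pl eqxx !andbT.
apply/andP; split.
  apply/eqP/code_inj; rewrite !code_mulE /entry /= E0 E1 Et E3 prod.
  apply/esym/codeP => [|i]; first by rewrite size_iota.
  by rewrite nth_iota // perm1.
have n0 : 0 < n := leq_ltn_trans (leq0n _) xn.
by apply: (@reach_transitive n g (Ordinal n0)); rewrite qg.
Qed.

(** By completeness every constellation with pattern [p] is conjugate to a listed image. Applied to
    the pure braid images of [G0], this identifies the orbit with the listed classes; applied to an
    arbitrary almost-dessin, it shows that no other orbit has the pattern. *)
Theorem row_orbit q Ws : row_certificate n m e p q Ws ->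
  exists O : {set {set quad n}},
    [set O' in pure_braid_orbits m e n | orbit_has_pattern p O'] = [set O]
    /\ #|O| = size Ws.
Proof.
case/and5P => vq /allP reachP distinct /allP words_ok /andP[idW cmpl].
pose qs := [seq code_pure W q | W <- Ws].
have qqs : q \in qs by apply/mapP; exists [::].
have szq q' i : q' \in qs -> i < n -> size (reach q' i) = n.
  by move=> /reachP/allP/(_ i) H li; apply/eqP/H; rewrite mem_iota add0n.
have n0 : 0 < n by case/and5P: vq => _ _ _ _ /and5P[_ _ /hasP[x]]; rewrite mem_iota; case: (n).
have [G0 [qG0 adG0 eG0 pG0]] := valid_repP vq (szq q 0 qqs n0).
have sP q' : q' \in qs -> exists2 s, s \in pure_braid_image n & qcode (s G0) = q'.
  case/mapP => W /words_ok/(@code_pureP n)[s sP sE] ->; exists s => //.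
  by rewrite sE qG0.
(* The default [G0] is not reached for [q'] in [qs], by [sP]. *)
pose dec q' := odflt G0 [pick g : quad n | qcode g == q'].
have decK q' : q' \in qs -> qcode (dec q') = q'.
  case/sP => s _ sE; rewrite /dec; case: pickP => [g /eqP//|/(_ (s G0))].
  by rewrite sE eqxx.
have decP q' : q' \in qs -> exists2 s, s \in pure_braid_image n & dec q' = s G0.
  by move=> q'qs; have [s ss sE] := sP _ q'qs; exists s => //; apply: qcode_inj;
    rewrite decK // sE.
have cover g : constellation g -> is_2cycle (entry g 2) -> quad_pattern g = p ->
    exists2 q', q' \in qs & conj_class g = conj_class (dec q').
  move=> cg tg gp; have [q' [u [z [q'qs sz [i nE]]]]] := completeP cmpl cg tg gp.
  exists q' => //.
  have := @normal_form_conj_inj n (conj_quad g u) (dec q') z i sz.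
  rewrite decK // szq // => /(_ erefl nE) [v vE].
  have -> : dec q' = conj_quad (conj_quad g u) v by apply: val_inj.
  by rewrite !conj_class_conj.
have okP s : s \in pure_braid_image n ->
    [/\ constellation (s G0), is_2cycle (entry (s G0) 2) & quad_pattern (s G0) = p].
  case/and3P: adG0 => cG0 _ tG0 sPb; split; first exact: constellation_pure.
    exact: is_2cycle_pure.
  by rewrite quad_pattern_pure.
pose O := pure_braid_orbit (conj_class G0).
have OE : O = [set B in [seq conj_class (dec q') | q' <- qs]].
  apply/setP => B; rewrite inE; apply/idP/mapP => [|[q' q'qs ->]].
    case/mem_pure_braid_orbit => s sP' ->; have [cs ts ps] := okP s sP'.
    by have [q' q'qs E] := cover _ cs ts ps; exists q'.
  have [s sP' ->] := decP _ q'qs; rewrite -pure_braid_class //.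
  by apply/imsetP; exists s.
exists O; split.
  apply/setP => O'; rewrite finset.in_set1 inE; apply/andP/eqP => [[]|->]; last first.
    split; last exact/orbit_has_patternP.
    by apply/imset_f/imset_f; rewrite inE adG0 eG0 eqxx.
  case/mem_pure_braid_orbits => g [-> /and3P[cg _ tg] _] /orbit_has_patternP gp.
  have [q' q'qs E] := cover _ cg tg gp; apply: pure_braid_orbit_eq.
  by rewrite E -/O OE inE; apply/mapP; exists q'.
rewrite OE cardsE; have -> : size Ws = size [seq conj_class (dec q') | q' <- qs].
  by rewrite !size_map.
(* Two images in the same class would share their normal forms, against the pairwise test. *)
apply/card_uniqP; rewrite uniq_pairwise pairwise_map.
apply: (sub_in_pairwise (P := mem qs) _ _ distinct); last exact/allP.
move=> q1 q2 q1qs q2qs /=; apply: contraNneq => E.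
have : dec q1 \in conj_class (dec q2) by rewrite -E mem_conj_class.
case/imsetP => u _ uE; rewrite -(decK q1) // uE.
rewrite -[X in _ \in normal_forms n X](decK q2) //.
rewrite -(normal_forms_conj (dec q2) u); apply/mapP; exists 0 => //.
by rewrite mem_iota.
Qed.

End RowOrbit.

(* For each row, the codes of [g_0, g_1, g_t, g_oo] for one dessin, and for each dessin of
   the orbit a list of palindromes carrying the first one to it. *)
Definition certificatesO : seq (seq (seq nat) * seq (seq (seq nat))) := [::
  ([:: [:: 1; 0]; [:: 0; 1]; [:: 1; 0]; [:: 0; 1]],
   [:: [::]]);
  ([:: [:: 0; 1]; [:: 0; 1]; [:: 1; 0]; [:: 1; 0]],
   [:: [::]]);
  ([:: [:: 2; 0; 1]; [:: 0; 2; 1]; [:: 1; 0; 2]; [:: 0; 1; 2]],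
   [:: [::]]);
  ([:: [:: 2; 1; 0]; [:: 0; 2; 1]; [:: 1; 0; 2]; [:: 0; 2; 1]],
   [:: [::]; [:: [:: 0]]; [:: [:: 1]]; [:: [:: 1; 2]]]);
  ([:: [:: 0; 1; 2]; [:: 0; 2; 1]; [:: 2; 1; 0]; [:: 1; 2; 0]],
   [:: [::]]);
  ([:: [:: 2; 1; 0; 3]; [:: 0; 1; 3; 2]; [:: 1; 0; 2; 3]; [:: 1; 2; 3; 0]],
   [:: [::]; [:: [:: 0]]; [:: [:: 1; 2]]; [:: [:: 0]; [:: 1]]]);
  ([:: [:: 3; 0; 1; 2]; [:: 1; 0; 3; 2]; [:: 2; 1; 0; 3]; [:: 0; 1; 2; 3]],
   [:: [::]]);
  ([:: [:: 3; 0; 2; 1]; [:: 1; 0; 3; 2]; [:: 2; 1; 0; 3]; [:: 0; 1; 3; 2]],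
   [:: [::]; [:: [:: 0]]; [:: [:: 1; 2]]]);
  ([:: [:: 3; 2; 1; 0]; [:: 2; 3; 0; 1]; [:: 1; 0; 2; 3]; [:: 0; 1; 3; 2]],
   [:: [::]; [:: [:: 1]]]);
  ([:: [:: 0; 2; 1; 3]; [:: 1; 0; 3; 2]; [:: 1; 0; 2; 3]; [:: 0; 2; 3; 1]],
   [:: [::]; [:: [:: 0]]; [:: [:: 0]; [:: 1]]]);
  ([:: [:: 0; 3; 2; 1]; [:: 1; 0; 3; 2]; [:: 2; 1; 0; 3]; [:: 1; 0; 3; 2]],
   [:: [::]; [:: [:: 0]]]);
  ([:: [:: 1; 3; 2; 0; 4]; [:: 0; 2; 1; 4; 3]; [:: 2; 1; 0; 3; 4]; [:: 0; 2; 3; 4; 1]],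
   [:: [::]; [:: [:: 0]]; [:: [:: 1]]; [:: [:: 1; 2]]; [:: [:: 0]; [:: 0]];
     [:: [:: 1]; [:: 0]]; [:: [:: 1]; [:: 1; 2]]; [:: [:: 1; 2]; [:: 1; 2]];
     [:: [:: 1]; [:: 0]; [:: 1]]; [:: [:: 1; 2]; [:: 1; 2]; [:: 1]]]);
  ([:: [:: 2; 3; 0; 1; 4]; [:: 0; 2; 1; 4; 3]; [:: 1; 0; 2; 3; 4]; [:: 0; 2; 3; 4; 1]],
   [:: [::]; [:: [:: 0]]; [:: [:: 1]]; [:: [:: 1; 2]]; [:: [:: 0]; [:: 0]];
     [:: [:: 1]; [:: 0]]; [:: [:: 1]; [:: 1; 2]]; [:: [:: 1; 2]; [:: 1; 2]]]);
  ([:: [:: 2; 0; 4; 3; 1; 5]; [:: 1; 0; 3; 2; 5; 4]; [:: 3; 1; 2; 0; 4; 5]; [:: 0; 1; 3; 4; 5; 2]],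
   [:: [::]; [:: [:: 0]]; [:: [:: 1; 2]]; [:: [:: 0]; [:: 0]];
     [:: [:: 1; 2]; [:: 1; 2]]; [:: [:: 1; 2]; [:: 1; 2]; [:: 1]]]);
  ([:: [:: 3; 0; 4; 1; 2; 5]; [:: 1; 0; 3; 2; 5; 4]; [:: 2; 1; 0; 3; 4; 5]; [:: 0; 1; 3; 4; 5; 2]],
   [:: [::]; [:: [:: 0]]; [:: [:: 1; 2]]; [:: [:: 0]; [:: 0]]; [:: [:: 1; 2]; [:: 1]];
     [:: [:: 1; 2]; [:: 1; 2]]; [:: [:: 0]; [:: 0]; [:: 1]];
     [:: [:: 1; 2]; [:: 1]; [:: 1; 2]]; [:: [:: 1; 2]; [:: 1]; [:: 1; 2]; [:: 1]]]);
  ([:: [:: 0; 2; 4; 3; 1; 5]; [:: 1; 0; 3; 2; 5; 4]; [:: 3; 1; 2; 0; 4; 5]; [:: 1; 0; 3; 4; 5; 2]],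
   [:: [::]; [:: [:: 0]]]);
  ([:: [:: 0; 3; 4; 1; 2; 5]; [:: 1; 0; 3; 2; 5; 4]; [:: 2; 1; 0; 3; 4; 5]; [:: 1; 0; 3; 4; 5; 2]],
   [:: [::]; [:: [:: 0]]; [:: [:: 1; 2]]; [:: [:: 1; 2]; [:: 1]]]);
  ([:: [:: 2; 1; 4; 3; 6; 5; 0; 7]; [:: 1; 0; 3; 2; 5; 4; 7; 6];
     [:: 0; 5; 2; 3; 4; 1; 6; 7]; [:: 1; 2; 3; 0; 5; 6; 7; 4]],
   [:: [::]; [:: [:: 0]]]);
  ([:: [:: 2; 4; 0; 3; 6; 5; 1; 7]; [:: 1; 0; 3; 2; 5; 4; 7; 6];
     [:: 5; 1; 2; 3; 4; 0; 6; 7]; [:: 1; 2; 3; 0; 5; 6; 7; 4]],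
   [:: [::]; [:: [:: 0]]; [:: [:: 1; 2]]; [:: [:: 0]; [:: 0]]; [:: [:: 1; 2]; [:: 1]];
     [:: [:: 0]; [:: 0]; [:: 1]]]);
  ([:: [:: 2; 5; 0; 3; 6; 1; 4; 7]; [:: 1; 0; 3; 2; 5; 4; 7; 6];
     [:: 4; 1; 2; 3; 0; 5; 6; 7]; [:: 1; 2; 3; 0; 5; 6; 7; 4]],
   [:: [::]; [:: [:: 0]]; [:: [:: 1; 2]]; [:: [:: 0]; [:: 0]]])].

Definition certificatesP : seq (seq (seq nat) * seq (seq (seq nat))) := [::
  ([:: [:: 1; 0]; [:: 0; 1]; [:: 1; 0]; [:: 0; 1]],
   [:: [::]]);
  ([:: [:: 0; 1]; [:: 0; 1]; [:: 1; 0]; [:: 1; 0]],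
   [:: [::]]);
  ([:: [:: 2; 0; 1]; [:: 0; 2; 1]; [:: 1; 0; 2]; [:: 0; 1; 2]],
   [:: [::]]);
  ([:: [:: 2; 1; 0]; [:: 0; 2; 1]; [:: 1; 0; 2]; [:: 0; 2; 1]],
   [:: [::]; [:: [:: 0]]; [:: [:: 1]]; [:: [:: 1; 2]]]);
  ([:: [:: 0; 1; 2]; [:: 0; 2; 1]; [:: 2; 1; 0]; [:: 1; 2; 0]],
   [:: [::]]);
  ([:: [:: 3; 0; 1; 2]; [:: 1; 0; 3; 2]; [:: 2; 1; 0; 3]; [:: 0; 1; 2; 3]],
   [:: [::]]);
  ([:: [:: 3; 0; 2; 1]; [:: 1; 0; 3; 2]; [:: 2; 1; 0; 3]; [:: 0; 1; 3; 2]],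
   [:: [::]; [:: [:: 0]]; [:: [:: 1; 2]]]);
  ([:: [:: 3; 2; 1; 0]; [:: 2; 3; 0; 1]; [:: 1; 0; 2; 3]; [:: 0; 1; 3; 2]],
   [:: [::]; [:: [:: 1]]]);
  ([:: [:: 0; 2; 1; 3]; [:: 1; 0; 3; 2]; [:: 1; 0; 2; 3]; [:: 0; 2; 3; 1]],
   [:: [::]; [:: [:: 0]]; [:: [:: 0]; [:: 1]]]);
  ([:: [:: 0; 3; 2; 1]; [:: 1; 0; 3; 2]; [:: 2; 1; 0; 3]; [:: 1; 0; 3; 2]],
   [:: [::]; [:: [:: 0]]]);
  ([:: [:: 0; 1; 2; 3]; [:: 1; 0; 3; 2]; [:: 0; 3; 2; 1]; [:: 1; 2; 3; 0]],
   [:: [::]]);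
  ([:: [:: 4; 1; 2; 3; 0; 5]; [:: 1; 0; 3; 2; 5; 4]; [:: 0; 3; 2; 1; 4; 5]; [:: 1; 2; 3; 4; 5; 0]],
   [:: [::]; [:: [:: 0]]])].

(** * Degree bound and admissible patterns *)

Fixpoint partitions fuel k n : seq (seq nat) :=
  if n == 0 then [:: [::]] else
  if fuel is fuel'.+1 then
    [seq i :: l | i <- iota k (n.+1 - k), l <- partitions fuel' i (n - i)]
  else [::].

(** The parameter [k] is a lower bound for the next part, which keeps the lists nondecreasing; the
    fuel bounds the number of parts. *)
Lemma mem_partitions fuel k n l : path leq k l -> all (fun i => 0 < i) l ->
  sumn l = n -> size l <= fuel -> l \in partitions fuel k n.
Proof.
elim: fuel k n l => [|fuel IH] k n [|i l] //=; rewrite ?ltnS.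
- by move=> _ _ <- _; rewrite mem_seq1.
- by move=> _ _ <- _; rewrite mem_seq1.
case/andP=> ki pl /andP[i0 al] nE sl; case: eqP => [n0|_]; first by lia.
apply: allpairs_f_dep; last by apply: IH => //; lia.
by rewrite mem_iota; lia.
Qed.

(** An even part is at least 2, and an odd one at least 2 - 1. *)
Lemma leq_double_size l : all (fun k => 0 < k) l -> (size l).*2 <= sumn l + count odd l.
Proof. by elim: l => //= k l IH /andP[k0 /IH]; case: (odd k) (odd_double_half k); lia. Qed.

(** A part divisible by [m] is at least [m], and any other part is at least m - (m - 1). *)
Lemma leq_mul_size m l : all (fun k => 0 < k) l ->
  m * size l <= sumn l + m.-1 * count (fun k => ~~ (m %| k)) l.
Proof.
elim: l => [|k l IH /= /andP[k0 /IH H]]; first by rewrite muln0.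
rewrite mulnS mulnDr; case: (boolP (m %| k)) => [/(dvdn_leq k0)|_] /=; first by lia.
by rewrite muln1; lia.
Qed.

Definition admissible m n (p : pattern) :=
  (size p.1.1 + size p.1.2 + size p.2 == n + 3) &&
  (size p.1.1 + count odd p.1.2 + count (fun k => ~~ (m %| k)) p.2 == 5).

Definition admissible_in m n (ps : seq pattern) :=
  let parts := partitions n 1 n in
  all (fun l0 => all (fun l1 => all (fun l3 =>
    admissible m n (l0, l1, l3) ==> ((l0, l1, l3) \in ps)) parts) parts) parts.

Lemma cycle_type_partition n (s : 'S_n) : cycle_type s \in partitions n 1 n.
Proof.
apply: mem_partitions; rewrite ?cycle_type_gt0 ?sumn_cycle_type //; last first.
  by rewrite size_cycle_type leq_card_porbits.
rewrite path_min_sorted ?cycle_type_sorted //; exact: cycle_type_gt0.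
Qed.

Lemma almost_dessin_admissible m n (g : quad n) :
  almost_dessin_rep g -> numE m g = 5 -> admissible m n (quad_pattern g).
Proof.
case/and3P => _ pg tg; rewrite numE_cycle_type => E.
by rewrite /admissible /= E eqxx andbT -planar_2cycle.
Qed.

Lemma almost_dessin_pattern m n (g : quad n) ps : admissible_in m n ps ->
  almost_dessin_rep g -> numE m g = 5 -> quad_pattern g \in ps.
Proof.
move=> + ag eg; have := almost_dessin_admissible ag eg.
rewrite /quad_pattern => adm.
move=> /allP/(_ _ (cycle_type_partition (entry g 0)))
       /allP/(_ _ (cycle_type_partition (entry g 1)))
       /allP/(_ _ (cycle_type_partition (entry g 3))).
by rewrite adm.
Qed.

(* From #g_0 + #g_1 + #g_oo = n + 3 and |E| = 5, since 2 #g_1 <= n + (odd cycles) and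
   m #g_oo <= n + (m - 1) (cycles of length not divisible by m). *)
Lemma almost_dessin_degree m n (g : quad n) : 2 <= m ->
  almost_dessin_rep g -> numE m g = 5 -> (m - 2) * n <= 4 * m.
Proof.
move=> m2 ag eg; have /andP[/eqP /= pl /eqP] := almost_dessin_admissible ag eg.
have := leq_double_size (cycle_type_gt0 (entry g 1)).
have := leq_mul_size m (cycle_type_gt0 (entry g 3)).
rewrite !sumn_cycle_type; move: pl => /=.
move: (size _) (size _) (size _) (count _ _) (count _ _) => a b c d o.
case: m m2 {eg} => [|[|m]] // _; nia.
Qed.

Lemma almost_dessin_degree_gt1 n (g : quad n) : almost_dessin_rep g -> 1 < n.
Proof.
case/and3P => _ _ /existsP[x /existsP[y /andP[xy _]]].
have := ltn_ord x; have := ltn_ord y; have : x != y :> nat by [].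
lia.
Qed.

Definition certified m (r : orbit_row) (c : seq (seq nat) * seq (seq (seq nat))) :=
  row_certificate (sumn r.1.1.1.1) m 5 r.1.1 c.1 c.2 && (size c.2 == r.1.2).

Lemma certifiedO : all2 (certified 4) tableO certificatesO.
Proof. by vm_compute. Qed.

Lemma certifiedP : all2 (certified 6) tableP certificatesP.
Proof. by vm_compute. Qed.

Lemma certified_row m t cs r : all2 (certified m) t cs -> r \in t ->
  exists O : {set {set quad (sumn r.1.1.1.1)}},
    [set O' in pure_braid_orbits m 5 _ | orbit_has_pattern r.1.1 O'] = [set O]
    /\ #|O| = r.1.2.
Proof.
elim: t cs => [|r' t IH] [|c cs] //= /andP[rc tc].
rewrite inE => /orP[/eqP->|]; last exact: IH tc.
case/andP: rc => /row_orbit[B [BE cB]] /eqP E.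
by exists B; rewrite cB.
Qed.

(** It meets both numerical conditions: 3 + 3 + 3 = 6 + 3 for planarity, and 3 + 0 + 2 = 5 for
    |E|. *)
Definition exceptional_pattern : pattern := ([:: 2; 2; 2], [:: 2; 2; 2], [:: 1; 1; 4]).

(** With an empty list of representatives nothing can be matched, so [complete] says that the
    exploration of every candidate stalls, that is, every candidate is intransitive. *)
Lemma no_exceptional_dessin (g : quad 6) : constellation g -> is_2cycle (entry g 2) ->
  quad_pattern g <> exceptional_pattern.
Proof.
have cmpl : complete 6 exceptional_pattern [::] by vm_compute.
by move=> cg tg /(completeP cmpl cg tg) [q [u [z []]]].
Qed.

Lemma admissible_inO n : 1 < n <= 8 ->
  admissible_in 4 n (exceptional_pattern :: [seq r.1.1 | r <- tableO]).
Proof.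
move=> nb; have : n \in iota 2 7 by rewrite mem_iota.
by move: n {nb}; apply/allP; vm_compute.
Qed.

Lemma admissible_inP n : 1 < n <= 6 -> admissible_in 6 n [seq r.1.1 | r <- tableP].
Proof.
move=> nb; have : n \in iota 2 5 by rewrite mem_iota.
by move: n {nb}; apply/allP; vm_compute.
Qed.

Lemma pattern_tableO n (g : quad n) : almost_dessin_rep g -> numE 4 g = 5 ->
  exists2 r : orbit_row, r \in tableO & quad_pattern g = r.1.1.
Proof.
move=> ag eg; have n8 : 1 < n <= 8.
  have := almost_dessin_degree (isT : 2 <= 4) ag eg.
  by rewrite (almost_dessin_degree_gt1 ag) /=; lia.
have := almost_dessin_pattern (admissible_inO n8) ag eg.
rewrite inE => /orP[/eqP E|/mapP[r rt ->]]; last by exists r.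
have n6 : n = 6 by rewrite -(sumn_cycle_type (entry g 0)); case: E => ->.
by subst n; case/and3P: ag => cg _ tg; case: (no_exceptional_dessin cg tg E).
Qed.

Lemma pattern_tableP n (g : quad n) : almost_dessin_rep g -> numE 6 g = 5 ->
  exists2 r : orbit_row, r \in tableP & quad_pattern g = r.1.1.
Proof.
move=> ag eg; have n6 : 1 < n <= 6.
  have := almost_dessin_degree (isT : 2 <= 6) ag eg.
  by rewrite (almost_dessin_degree_gt1 ag) /=; lia.
by have /mapP[r rt ->] := almost_dessin_pattern (admissible_inP n6) ag eg; exists r.
Qed.

Lemma orbit_pattern_in m (t : seq orbit_row) :
  (forall n (g : quad n), almost_dessin_rep g -> numE m g = 5 ->
     exists2 r : orbit_row, r \in t & quad_pattern g = r.1.1) ->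
  forall n (O : {set {set quad n}}), O \in pure_braid_orbits m 5 n ->
  exists2 r : orbit_row, r \in t & orbit_has_pattern r.1.1 O.
Proof.
move=> H n O /mem_pure_braid_orbits[g [-> ag eg]].
by have [r rt gp] := H n g ag eg; exists r => //; apply/orbit_has_patternP.
Qed.

Import Order.TTheory GRing.Theory Num.Theory.
Import numFieldNormedType.Exports.

(** * Continuity of the roots of a polynomial *)

Section RootContinuity.
Local Open Scope ring_scope.
Variable K : numFieldType.
Implicit Types (a b : seq K) (P Q D E : {poly K}).

(** It replaces a minimum: the order of [K] is only partial, but positive elements are real and
    hence comparable. *)
Lemma exists_lower_bound (x y : K) : 0 < x -> 0 < y ->
  exists z, [/\ 0 < z, z <= x & z <= y].
Proof.
move=> x0 y0; have [xy|yx] := real_leP (gtr0_real x0) (gtr0_real y0).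
  by exists x.
by exists y; split=> //; exact: ltW.
Qed.

Definition monic_of_roots a : {poly K} := \prod_(z <- a) ('X - z%:P).

Lemma size_monic_of_roots a : size (monic_of_roots a) = (size a).+1.
Proof. exact: size_prod_XsubC. Qed.

(** Synthetic division from the top degree: [D_k = P_(k+1) + b D_(k+1)], which accumulates a
    geometric sum. *)
Lemma coef_quotient_bound P D (b B e : K) n :
  P = ('X - b%:P) * D -> (size D <= n)%N -> `|b| <= B -> 0 <= e ->
  (forall k, `|P`_k| <= e) -> forall k, `|D`_k| <= e * \sum_(j < n) B ^+ j.
Proof.
move=> PD sD bB e0 Pe; have B0 : 0 <= B := le_trans (normr_ge0 _) bB.
have S0 i : 0 <= e * \sum_(j < i) B ^+ j.
  by apply/mulr_ge0/sumr_ge0 => // j _; exact: exprn_ge0.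
have step i k : (k + i = n)%N -> `|D`_k| <= e * \sum_(j < i) B ^+ j.
  elim: i k => [|i IH] k kn.
    by rewrite nth_default ?normr0 // (leq_trans sD) // -kn addn0.
  have -> : D`_k = P`_k.+1 + b * D`_k.+1.
    by rewrite PD mulrBl coefB coefXM coefCM /= subrK.
  apply: le_trans (ler_normD _ _) _; rewrite big_ord_recl mulrDr expr0 mulr1 lerD //.
  rewrite normrM (le_trans (ler_pM _ _ bB (IH k.+1 _))) ?normr_ge0 ?addSnnS //.
  rewrite mulrCA mulr_sumr; under [in leRHS]eq_bigr do rewrite exprS.
  by rewrite lexx.
move=> k; have [kn|nk] := leqP k n; last by rewrite nth_default ?normr0 // (leq_trans sD) // ltnW.
apply: le_trans (step (n - k)%N k _) _; first by rewrite subnKC.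
apply: ler_wpM2l => //; rewrite -(big_mkord predT (fun j => B ^+ j)).
rewrite -[X in _ <= X](big_mkord predT (fun j => B ^+ j)).
by rewrite (big_cat_nat (n := n - k) _ (leq_subr _ _)) //= lerDl sumr_ge0 // => j _;
  exact: exprn_ge0.
Qed.

(** Induction on the number of roots. If the coefficients are close, the second polynomial is small
    at a root x of the first, so it has a root y near x; dividing by X - x and X - y leaves two
    polynomials that are still close. The permutation [b'] pairs the roots by index. *)
Lemma roots_continuous a (rho : K) : 0 < rho -> exists2 d, 0 < d &
  forall b, size b = size a ->
    (forall k, `|(monic_of_roots a - monic_of_roots b)`_k| <= d) ->
  exists2 b', perm_eq b' b & forall i, (i < size a)%N -> `|a`_i - b'`_i| < rho.
Proof.
move=> rho0; elim: a => [|x a [d' d'0 IH]].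
  by exists 1 => // b /size0nil -> _; exists [::].
(* [B] bounds the root found near [x], [S] is the factor lost in the division by a linear term, [M]
   bounds the coefficients of [monic_of_roots a], and [T] turns a bound on coefficients into a bound
   on the value at [x]. *)
pose n := size a; pose B := `|x| + 1; pose S := \sum_(j < n.+1) B ^+ j.
pose M := 1 + \sum_(k < n.+1) `|(monic_of_roots a)`_k|.
pose T := \sum_(k < n.+2) `|x| ^+ k.
have B1 : 1 <= B by rewrite lerDr.
have S0 : 0 < S.
  rewrite /S big_ord_recl expr0 ltr_pwDl // sumr_ge0 // => j _.
  exact/exprn_ge0/(le_trans ler01).
have M0 : 0 < M by rewrite ltr_pwDl // sumr_ge0.
have T0 : 0 < T.
  by rewrite /T big_ord_recl expr0 ltr_pwDl // sumr_ge0 // => j _; exact: exprn_ge0.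
have q0 : 0 < d' / S / 2 by rewrite !divr_gt0.
have [e1 [e10 e1r e1q]] := exists_lower_bound rho0 (divr_gt0 q0 M0).
have [e [e0 ee1 e_1]] := exists_lower_bound e10 (ltr01 : 0 < (1 : K)).
have two0 : 0 < (2 : K) by rewrite ltr0n.
have [d [d0 dq dT]] := exists_lower_bound q0 (divr_gt0 (exprn_gt0 n.+1 e0) (mulr_gt0 T0 two0)).
exists d => // b sb Hb; set P := monic_of_roots (x :: a) in Hb; set Q := monic_of_roots b in Hb.
have sPQ : (size (P - Q)%R <= n.+2)%N.
  by rewrite (leq_trans (size_polyD _ _)) // size_polyN !size_monic_of_roots sb maxnn.
have PxE : (P - Q).[x] = - Q.[x].
  by rewrite hornerD hornerN /P /monic_of_roots big_cons hornerM hornerXsubC subrr mul0r add0r.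
have Qx : `|Q.[x]| < e ^+ n.+1.
  rewrite -normrN -PxE (horner_coef_wide _ sPQ).
  apply: le_lt_trans (ler_norm_sum _ _ _) _.
  apply: (@le_lt_trans _ _ (d * T)).
    rewrite /T mulr_sumr; apply: ler_sum => k _.
    by rewrite normrM normrX ler_wpM2r // exprn_ge0.
  rewrite -ltr_pdivlMr //; apply: le_lt_trans dT _.
  by rewrite ltr_pM2l ?exprn_gt0 // ltf_pV2 ?posrE ?mulr_gt0 // ltr_pMr // ltr1n.
(* The value of Q at x is, in modulus, the product of the n + 1 distances from x to the roots, so
   not all of them can be at least e. *)
have [y yb xy] : exists2 y, y \in b & `|x - y| < e.
  apply/hasP; apply: contraLR Qx => /hasPn far.
  rewrite -(real_leNgt (gtr0_real (exprn_gt0 _ e0)) (normr_real _)).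
  rewrite /Q /monic_of_roots horner_prod normr_prod -/n.
  have -> : n.+1 = size b by rewrite sb.
  elim: (b) far => [|z s IHs] far; first by rewrite big_nil.
  rewrite big_cons [size _]/= exprS hornerXsubC ler_pM ?exprn_ge0 ?(ltW e0) //.
    rewrite (real_leNgt (gtr0_real e0) (normr_real _)); apply: far; exact: mem_head.
  by apply: IHs => t ts; apply: far; rewrite inE ts orbT.
have [b1 pb1] : exists b1, perm_eq b (y :: b1) by exists (rem y b); exact: perm_to_rem.
have sb1 : size b1 = size a by have := perm_size pb1; rewrite sb => -[].
have QE : Q = ('X - y%:P) * monic_of_roots b1.
  by rewrite /Q /monic_of_roots (perm_big _ pb1) big_cons.
have PE : P = ('X - x%:P) * monic_of_roots a by rewrite /P /monic_of_roots big_cons.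
(* [E] is P with its root x moved to y, minus Q; hence it is divisible by X - y, and it is small
   because y is close to x. *)
pose E := P - Q - (y - x) *: monic_of_roots a.
have ED : E = ('X - y%:P) * (monic_of_roots a - monic_of_roots b1).
  by rewrite /E PE QE -mul_polyC polyCB; ring.
have Ee k : `|E`_k| <= d' / S.
  rewrite /E coefB coefZ; apply: le_trans (ler_normB _ _) _.
  rewrite [leRHS]splitr lerD //; first exact: le_trans (Hb k) dq.
  rewrite normrM distrC.
  have Mk : `|(monic_of_roots a)`_k| <= M.
    have [kn|nk] := ltnP k n.+1; last first.
      by rewrite nth_default ?normr0 ?(ltW M0) // size_monic_of_roots.
    by rewrite /M (bigD1 (Ordinal kn)) //= addrCA lerDl addr_ge0 // sumr_ge0.
  apply: le_trans (ler_pM _ _ (ltW xy) Mk) _ => //.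
  by rewrite -ler_pdivlMr // (le_trans ee1).
have yB : `|y| <= B.
  have -> : y = x - (x - y) by ring.
  by rewrite (le_trans (ler_normB _ _)) // lerD2l (le_trans (ltW xy)).
have sD : (size (monic_of_roots a - monic_of_roots b1)%R <= n.+1)%N.
  by rewrite (leq_trans (size_polyD _ _)) // size_polyN !size_monic_of_roots sb1 maxnn.
have Dd := coef_quotient_bound ED sD yB (ltW (divr_gt0 d'0 S0)) Ee.
have [|b2 pb2 b2P] := IH b1 sb1; first by move=> k; have := Dd k; rewrite divfK ?gt_eqF.
exists (y :: b2); first by rewrite perm_sym (permPl pb1) perm_cons perm_sym.
case=> [|i] /= ia; last exact: b2P.
exact: lt_le_trans xy (le_trans ee1 e1r).
Qed.

End RootContinuity.

(** * A coordinate in which all points of a fibre are finite *)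

Section Charts.
Local Open Scope ring_scope.
Variable K : numClosedFieldType.
Implicit Types (P Q : {poly K}) (x : option K) (r ys : seq K).

(** The reciprocal polynomial X^n P(1/X) for the formal degree [n]. *)
Definition rev_poly n P : {poly K} := \poly_(k < n.+1) P`_(n - k).

Lemma coef_rev_poly n P k : (rev_poly n P)`_k = if (k <= n)%N then P`_(n - k) else 0.
Proof. by rewrite coef_poly ltnS. Qed.

Lemma rev_polyZ n c P : rev_poly n (c *: P) = c *: rev_poly n P.
Proof.
by apply/polyP => k; rewrite coefZ !coef_rev_poly coefZ; case: ifP; rewrite ?mulr0.
Qed.

Lemma rev_polyB n P Q : rev_poly n (P - Q) = rev_poly n P - rev_poly n Q.
Proof.
by apply/polyP => k; rewrite coefB !coef_rev_poly coefB; case: ifP; rewrite ?subr0.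
Qed.

Lemma rev_polyS n P : (size P <= n.+1)%N -> rev_poly n.+1 P = 'X * rev_poly n P.
Proof.
move=> sP; apply/polyP => -[|k]; rewrite coefXM !coef_rev_poly //=.
by rewrite subn0 nth_default.
Qed.

Lemma rev_polyM n w P : (size P <= n.+1)%N ->
  rev_poly n.+1 (('X - w%:P) * P) = (1 - w *: 'X) * rev_poly n P.
Proof.
move=> sP; rewrite !mulrBl mul1r rev_polyB mul_polyC rev_polyZ -scalerAl.
rewrite [rev_poly _ P]rev_polyS //.
congr (_ - _); apply/polyP => k; rewrite !coef_rev_poly coefXM.
have [kn|nk] := leqP k n; first by rewrite (leqW kn) subSn.
by case: ifP => // kn; have -> : k = n.+1 by [apply/eqP; rewrite eqn_leq kn]; rewrite subnn.
Qed.

(** A factor X - w becomes 1 - w X = -w (X - 1/w), and each of the [m] missing degrees contributes a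
    root 0. *)
Lemma rev_poly_roots r m : 0 \notin r ->
  rev_poly (size r + m) (monic_of_roots r)
  = (\prod_(w <- r) - w) *: monic_of_roots ([seq w^-1 | w <- r] ++ nseq m 0).
Proof.
elim: r => [_|w r IH].
  rewrite add0n /monic_of_roots !big_nil scale1r /=; elim: m => [|m IH].
    by rewrite big_nil; apply/polyP => -[|k]; rewrite coef_rev_poly !coef1.
  by rewrite rev_polyS ?IH ?size_poly1 //= big_cons polyC0 subr0.
rewrite inE negb_or eq_sym => /andP[w0 /IH E].
rewrite /monic_of_roots /= !big_cons addSn rev_polyM; last first.
  by rewrite size_monic_of_roots ltnS leq_addr.
rewrite -/(monic_of_roots r) E -/(monic_of_roots (_ ++ _)).
rewrite -!mul_polyC polyCM polyCN.
have wK : w%:P * (w^-1)%:P = 1 :> {poly K} by rewrite -polyCM mulfV.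
set U := monic_of_roots _; set c := _%:P; move: wK; set u := (w^-1)%:P => wK.
have -> : 1 - w%:P * 'X = - w%:P * ('X - u) by rewrite mulNr mulrBr wK opprB.
by ring.
Qed.

(** This is y^n P(s + 1/y), that is, P in the coordinate y = 1/(z - s), where oo becomes y = 0. If
    P(s) is nonzero it has degree exactly n and leading coefficient P(s), so no root escapes to
    infinity when P varies. *)
Definition chart_poly n s P := rev_poly n (P \Po ('X + s%:P)).

Definition chart_point s x : K := if x is Some z then (z - s)^-1 else 0.

Definition multiplicity n P x : nat := if x is Some z then mup z P else n.+1 - size P.

Lemma chart_point_inj s : {in [pred x | x != Some s] &, injective (chart_point s)}.
Proof.
move=> [y|] [z|]; rewrite !inE /= => ys zs //.
- by move/invr_inj/(congr1 (+%R^~ s)); rewrite !subrK => ->.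
- by move/eqP; rewrite invr_eq0 subr_eq0 => /eqP E; rewrite E eqxx in ys.
by move/esym/eqP; rewrite invr_eq0 subr_eq0 => /eqP E; rewrite E eqxx in zs.
Qed.

Lemma chart_roots n s P : (size P <= n.+1)%N -> P.[s] != 0 ->
  exists ys, [/\ size ys = n, chart_poly n s P = P.[s] *: monic_of_roots ys &
    forall x, x != Some s -> count_mem (chart_point s x) ys = multiplicity n P x].
Proof.
move=> sP Ps; have [r rE] := closed_field_poly_normal P; set c := lead_coef P in rE.
have P0 : P != 0 by apply: contraNneq Ps => ->; rewrite horner0.
have c0 : c != 0 by rewrite lead_coef_eq0.
have szr : size P = (size r).+1 by rewrite rE size_scale // size_prod_XsubC.
have rn : (size r <= n)%N by rewrite -ltnS -szr.
have sr : s \notin r.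
  apply: contraNN Ps => sr; rewrite rE hornerZ.
  have : root (monic_of_roots r) s by rewrite root_prod_XsubC.
  by move/eqP => ->; rewrite mulr0.
have inj1 : injective (fun z => (z - s)^-1).
  by move=> y z /invr_inj/(congr1 (+%R^~ s)); rewrite !subrK.
exists ([seq (z - s)^-1 | z <- r] ++ nseq (n - size r) 0).
split=> [||[z|] xs].
- by rewrite size_cat size_map size_nseq subnKC.
- rewrite /chart_poly [in LHS]rE comp_polyZ rmorph_prod /=.
  have -> : \prod_(z <- r) (('X - z%:P) \Po ('X + s%:P)) = monic_of_roots [seq z - s | z <- r].
    rewrite /monic_of_roots big_map; apply: eq_bigr => z _.
    by rewrite comp_polyB comp_polyX comp_polyC polyCB opprB addrA addrAC.
  rewrite rev_polyZ -{1}(subnKC rn) -{1}(size_map (fun z => z - s) r) rev_poly_roots; last first.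
    by apply: contraNN sr => /mapP[z zr /esym/eqP]; rewrite subr_eq0 => /eqP <-.
  rewrite -map_comp scalerA; congr (_ *: _).
  rewrite rE hornerZ horner_prod big_map; congr (_ * _); apply: eq_bigr => z _.
  by rewrite opprB hornerXsubC.
- have zs : z != s by apply: contraNneq xs => ->.
  rewrite count_cat count_map -[RHS]/(mup z P) rE -mul_polyC mupMr; last first.
    by rewrite rootC.
  rewrite mu_prod_XsubC.
  have -> : count (preim (fun z => (z - s)^-1) (pred1 (chart_point s (Some z)))) r = count_mem z r.
    by apply: eq_count => y; exact: (inj_eq inj1).
  by rewrite count_nseq /= eq_sym invr_eq0 subr_eq0 (negPf zs) mul0n addn0.
rewrite count_cat count_nseq /= eqxx mul1n szr subSS.
rewrite (count_memPn _) //; apply: contraNN sr => /mapP[z zr /esym/eqP].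
by rewrite invr_eq0 subr_eq0 => /eqP <-.
Qed.

Lemma chart_polyB n s P Q : chart_poly n s (P - Q) = chart_poly n s P - chart_poly n s Q.
Proof. by rewrite /chart_poly comp_polyB rev_polyB. Qed.

Lemma chart_polyZ n s c P : chart_poly n s (c *: P) = c *: chart_poly n s P.
Proof. by rewrite /chart_poly comp_polyZ rev_polyZ. Qed.

Lemma size_chart_poly n s P : (size (chart_poly n s P) <= n.+1)%N.
Proof. exact: size_poly. Qed.

(* The fibres of a rational function near a given one are pencils P - v R, with v small. *)
Lemma pencil_roots n (s : K) (P R : {poly K}) (rho : K) ys :
  (size P <= n.+1)%N -> (size R <= n.+1)%N ->
  P.[s] != 0 -> 0 < rho -> size ys = n ->
  chart_poly n s P = P.[s] *: monic_of_roots ys ->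
  exists2 d : K, 0 < d & forall v : K, `|v| < d -> (P - v *: R).[s] != 0 /\
  exists zs, [/\ size zs = n,
    forall x, x != Some s -> count_mem (chart_point s x) zs = multiplicity n (P - v *: R) x &
    forall i, (i < n)%N -> `|ys`_i - zs`_i| < rho].
Proof.
move=> sP sR Ps rho0 sys ysE; have [d d0 rootsP] := roots_continuous ys rho0.
set p := P.[s] in Ps ysE; set r := R.[s].
pose C := 1 + \sum_(k < n.+1)
  `|p * (chart_poly n s R)`_k - r * (chart_poly n s P)`_k|.
have C0 : 0 < C by rewrite ltr_pwDl // sumr_ge0.
have p0 : 0 < `|p| by rewrite normr_gt0.
have two0 : 0 < (2 : K) by rewrite ltr0n.
have r1 : 0 < `|r| + 1 by rewrite ltr_wpDl.
have [e [e0 er ed]] := exists_lower_bound (divr_gt0 p0 (mulr_gt0 two0 r1))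
  (divr_gt0 (mulr_gt0 d0 (mulr_gt0 p0 p0)) (mulr_gt0 two0 C0)).
exists e => // v ve; set Q := P - v *: R.
have QsE : Q.[s] = p - v * r by rewrite hornerD hornerN hornerZ.
have vr : `|v * r| <= `|p| / 2.
  rewrite normrM; apply: le_trans (_ : e * (`|r| + 1) <= _).
    by rewrite ler_pM // ?ltW // ltrDl.
  by move: er; rewrite invfM mulrA ler_pdivlMr.
have Qs : `|p| / 2 <= `|Q.[s]|.
  rewrite QsE; apply: le_trans (lerB_dist _ _).
  by rewrite lerBrDr (le_trans (lerD (lexx _) vr)) // -splitr.
have Qs0 : 0 < `|Q.[s]| by apply: lt_le_trans Qs; exact: divr_gt0.
have Qsn0 : Q.[s] != 0 by rewrite -normr_gt0.
split=> //.
have sQ : (size Q <= n.+1)%N.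
  rewrite (leq_trans (size_polyD _ _)) // geq_max sP size_polyN.
  exact: leq_trans (size_scale_leq _ _) sR.
have [zs0 [szs zsE cntQ]] := chart_roots sQ Qsn0.
have [||zs pzs zsP] := rootsP zs0; first by rewrite szs sys.
  move=> k.
  (* Once divided by the leading coefficients P(s) and Q(s), the two polynomials differ by a
     multiple of v, with a denominator of modulus at least |P(s)|^2 / 2. *)
  have -> : (monic_of_roots ys - monic_of_roots zs0)`_k =
    v * (p * (chart_poly n s R)`_k - r * (chart_poly n s P)`_k) / (p * Q.[s]).
    have yk : (monic_of_roots ys)`_k = (chart_poly n s P)`_k / p.
      by rewrite ysE coefZ mulrAC mulfV // mul1r.
    have zk : (monic_of_roots zs0)`_k = (chart_poly n s Q)`_k / Q.[s].
      by rewrite zsE coefZ mulrAC mulfV // mul1r.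
    rewrite coefB yk zk /Q chart_polyB chart_polyZ coefB coefZ -/Q.
    have Qsn0' : p - v * r != 0 by rewrite -QsE.
    by rewrite QsE; field; rewrite Ps Qsn0'.
  rewrite !normrM normfV normrM.
  have Ck : `|p * (chart_poly n s R)`_k - r * (chart_poly n s P)`_k| <= C.
    have [kn|nk] := ltnP k n.+1; last first.
      rewrite !nth_default ?mulr0 ?subrr ?normr0 ?(ltW C0) //.
        exact: leq_trans (size_chart_poly _ _ _) nk.
      exact: leq_trans (size_chart_poly _ _ _) nk.
    by rewrite /C (bigD1 (Ordinal kn)) //= addrCA lerDl addr_ge0 // sumr_ge0.
  rewrite ler_pdivrMr ?mulr_gt0 //.
  apply: le_trans (_ : e * C <= _); first by rewrite ler_pM // ltW.
  apply: le_trans (_ : d * (`|p| * (`|p| / 2)) <= _); last first.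
    by rewrite ler_pM2l // ler_pM2l.
  move: ed; rewrite ler_pdivlMr ?mulr_gt0 // => h; rewrite !mulrA ler_pdivlMr //.
  by have -> : e * C * 2 = e * (2 * C) by [ring]; rewrite -mulrA.
exists zs; split=> [|x xs|i]; last by rewrite -sys; exact: zsP.
  by rewrite (perm_size pzs).
by rewrite -cntQ //; apply/seq.permP.
Qed.

End Charts.

(** * Charts of the Riemann sphere *)

Section SphereCharts.
Local Open Scope classical_set_scope.
Local Open Scope ring_scope.
Variable R : realType.
Local Notation C := R[i].
Implicit Types (x : P1 R) (s z : C).

Lemma complex_gt0_real (e : C) : 0 < e -> exists2 r : R, 0 < r & e = r%:C%C.
Proof.
case: e => a b; rewrite ltcE /= => /andP[/eqP -> a0].
by exists a.
Qed.

Lemma complex_norm_le (a b : R) : `|a +i* b|%C <= (`|a| + `|b|)%:C%C.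
Proof.
have -> : (a +i* b)%C = a%:C%C + 'i%C * b%:C%C.
  by apply/eqP; rewrite eq_complex /= !mul0r !mul1r !(addr0, subr0, add0r, oppr0) !eqxx.
rewrite rmorphD /=; apply: le_trans (ler_normD _ _) _.
by rewrite normrM !normc_def /= !expr0n /= !(addr0, add0r) expr1n sqrtr1 mul1r !sqrtr_sqr.
Qed.

Lemma norm_Re_le (z : C) : `|complex.Re z|%:C%C <= `|z|.
Proof. 
case: z => a b; rewrite normc_def lecR /= -sqrtr_sqr ler_wsqrtr // lerDl sqr_ge0 //.
Qed.

Lemma norm_Im_le (z : C) : `|complex.Im z|%:C%C <= `|z|.
Proof. 
case: z => a b; rewrite normc_def lecR /= -sqrtr_sqr ler_wsqrtr // lerDr sqr_ge0 //.
Qed.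

Lemma continuous_complex : continuous ((fun p => (p.1 +i* p.2)%C) : R * R -> R[i]^o).
Proof.
move=> p; apply/cvgrPdist_lt => /= e /complex_gt0_real[r r0 ->].
have : \forall q \near p, ball p (r / 2) q by apply: nbhsx_ballx; rewrite divr_gt0.
apply: filterS => q [q1 q2].
have -> : ((p.1 +i* p.2) - (q.1 +i* q.2))%C = ((p.1 - q.1) +i* (p.2 - q.2))%C by [].
apply: le_lt_trans (complex_norm_le _ _) _; rewrite ltcR.
by rewrite [ltRHS]splitr ltrD.
Qed.

(** Neighbourhoods of oo are given by complements of closed compact sets; a square serves because it
    is a product of segments. *)
Lemma compact_square s (m : R) : exists K : set R[i]^o,
  [/\ compact K, closed K & forall z, ~ K z -> m%:C%C < `|z - s|].
Proof.
pose I (a : R) := `[a - m, a + m]%classic.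
pose K : set R[i]^o := (fun p => (p.1 +i* p.2)%C) @` (I (complex.Re s) `*` I (complex.Im s)).
have cK : compact K.
  apply: continuous_compact.
    exact/continuous_subspaceT/continuous_complex.
  by apply: compact_setX; exact: segment_compact.
exists K; split=> //; first by apply: compact_closed => //; exact: norm_hausdorff.
move=> z nKz; have [lt_m|le_m] := ltP m (Num.max `|complex.Re (z - s)| `|complex.Im (z - s)|).
  move: lt_m; rewrite lt_max => /orP[h|h].
    by apply: lt_le_trans (norm_Re_le _); rewrite ltcR.
  by apply: lt_le_trans (norm_Im_le _); rewrite ltcR.
case: nKz; move: le_m; rewrite ge_max => /andP[hr hi].
exists (complex.Re z, complex.Im z); last by case: (z).
move: hr hi; rewrite !ler_norml; case: (z) (s) => a b [c d] /= /andP[h1 h2] /andP[h3 h4].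
by split; rewrite /I /= in_itv /=; apply/andP; split; lra.
Qed.

Lemma compact_norm_bounded (K : set R[i]^o) : compact K ->
  exists M : R, forall z, K z -> `|z| <= M%:C%C.
Proof.
move=> /compact_near_coveringP cK.
have := cK R (pinfty_nbhs R) (fun M z => `|z| <= M%:C%C) _.
case=> [z Kz|M [_ MP]]; last first.
  by exists (M + 1) => z Kz; apply: (MP (M + 1)) Kz; rewrite ltrDl.
have z0 : 0 <= `|z| := normr_ge0 z.
have [r zr] : exists r : R, `|z| = r%:C%C.
  by rewrite normc_def; eexists.
exists ([set z' : R[i]^o | `|z - z'| < 1], [set M | r + 1 < M]).
  split; first by apply/nbhs_ballP; exists 1 => //=.
  by exists (r + 1); split => //; rewrite num_real.
move=> [z' M] [/= zz' rM].
have -> : z' = z - (z - z') by ring.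
apply: le_trans (ler_normB _ _) _; rewrite zr.
apply: le_trans (lerD (lexx _) (ltW zz')) _.
by rewrite -[1]/(1%:C%C) -rmorphD lecR ltW.
Qed.

Lemma nbhs_some z (W : set (P1 R)) : nbhs (Some z : P1 R) W <->
  exists2 e : C, 0 < e & forall z', `|z - z'| < e -> W (Some z').
Proof.
split; first by move=> /nbhs_ballP[e e0 H]; exists e => // z' zz'; apply: H.
by move=> [e e0 H]; apply/nbhs_ballP; exists e => // z' zz'; apply: H.
Qed.

Lemma inv_near (y z : C) (e : C) : y != 0 -> 0 < e ->
  exists2 d, 0 < d & forall z, `|y - z| < d -> z != 0 /\ `|y^-1 - z^-1| < e.
Proof.
move=> y0 e0; have ny : 0 < `|y| by rewrite normr_gt0.
have two0 : 0 < (2 : C) by rewrite ltr0n.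
have [d [d0 dy de]] := exists_lower_bound (divr_gt0 ny two0)
  (divr_gt0 (mulr_gt0 e0 (mulr_gt0 ny ny)) two0).
exists d => // t yt.
have ty : `|y| / 2 < `|t|.
  have : `|y| <= `|y - t| + `|t| by rewrite -{1}[y](subrK t) ler_normD.
  rewrite -lerBlDl => /(lt_le_trans _); apply.
  rewrite ltrBrDr -ltrBrDl; have -> : `|y| - `|y| / 2 = `|y| / 2 by field.
  exact: lt_le_trans yt dy.
have t0 : t != 0 by rewrite -normr_gt0 (lt_trans _ ty) // divr_gt0.
split=> //; have -> : y^-1 - t^-1 = (t - y) / (y * t) by field; rewrite y0 t0.
rewrite normrM normfV normrM distrC ltr_pdivrMr ?mulr_gt0 ?normr_gt0 //.
apply: lt_le_trans yt (le_trans de _).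
rewrite -!mulrA ler_pM2l // ler_pM2l //; exact: ltW.
Qed.

(** With [chart_basis], this says that [chart_point s] identifies the topology of the sphere minus
    [s] with that of the plane, so estimates on roots become statements about neighbourhoods. *)
Lemma chart_open s x (rho : C) : x != Some s -> 0 < rho ->
  nbhs x [set x' : P1 R | x' != Some s /\ `|chart_point s x - chart_point s x'| < rho].
Proof.
case: x => [z|] xs rho0.
  have zs : z - s != 0 by rewrite subr_eq0; apply: contraNneq xs => ->.
  have [d d0 dP] := inv_near 0 zs rho0.
  apply/nbhs_some; exists d => // z' zz' /=.
  have [|z's lt_rho] := dP (z' - s); first by rewrite opprB addrA subrK.
  by split=> //; apply: contraNneq z's => -[->]; rewrite subrr.
have [r r0 rE] := complex_gt0_real rho0.
have [K [cK clK KP]] := compact_square s (r^-1).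
exists K => // _ [[z /KP nK <-]|->] /=; last by rewrite subrr normr0.
have zs : 0 < `|z - s| by apply: lt_trans nK; rewrite ltcR invr_gt0.
split; first by apply: contraTneq zs => -[->]; rewrite subrr normr0 ltxx.
have rC0 : 0 < r%:C%C by rewrite ltcR.
rewrite sub0r normrN normfV rE invf_plt ?posrE //.
by move: nK; rewrite fmorphV.
Qed.

Lemma chart_basis s x (W : set (P1 R)) : x != Some s -> nbhs x W ->
  exists2 rho : C, 0 < rho & forall x', x' != Some s ->
    `|chart_point s x - chart_point s x'| < rho -> W x'.
Proof.
case: x => [z|] xs; last first.
  case=> K [cK _] KW; have [M MP] := compact_norm_bounded cK.
  have N0 : 0 < `|M%:C%C| + `|s| + 1 by rewrite ltr_wpDl // addr_ge0.
  exists (`|M%:C%C| + `|s| + 1)^-1; first by rewrite invr_gt0.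
  move=> [z'|] x's /=; last by move=> _; apply: KW; right.
  have z's : 0 < `|z' - s|.
    by rewrite normr_gt0 subr_eq0; apply: contraNneq x's => ->.
  rewrite sub0r normrN normfV ltf_pV2 ?posrE // => far; apply: KW; left; exists z' => //.
  move=> /MP z'M; move: far; apply/negP; rewrite -real_leNgt ?normr_real ?gtr0_real //.
  apply: le_trans (ler_normB _ _) _; apply: ler_wpDr => //; rewrite lerD2r.
  exact: le_trans z'M (real_ler_norm (ger0_real (le_trans (normr_ge0 _) z'M))).
move=> /nbhs_some[e e0 eW].
have zs : z - s != 0 by rewrite subr_eq0; apply: contraNneq xs => ->.
have [d d0 dP] := inv_near 0 (invr_neq0 zs) e0.
exists d => // -[z'|] x's /= H; last by have [] := dP 0 H; rewrite eqxx.
apply: eW; have [_] := dP _ H; rewrite !invrK.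
by rewrite opprB addrA subrK.
Qed.

End SphereCharts.

(** * Fibres of a rational function as roots of polynomials *)

Section Fibres.
Local Open Scope classical_set_scope.
Local Open Scope ring_scope.
Variable R : realType.
Local Notation C := R[i].
Implicit Types (f : ratfun R) (x w : P1 R) (s z c : C).

Lemma multiplicityZ n (a : C) (P : {poly C}) (x : option C) : a != 0 ->
  multiplicity n (a *: P) x = multiplicity n P x.
Proof.
move=> a0; case: x => [z|] /=; last by rewrite size_scale.
by rewrite -mul_polyC mupMr // rootC.
Qed.

Lemma ratfun_coprime f : coprimep (ratnum f) (ratden f).
Proof. by case: f. Qed.

Lemma size_ratnum f : (size (ratnum f) <= (ratdeg f).+1)%N.
Proof. by apply: leq_trans (leqSpred _); exact: leq_maxl. Qed.

Lemma size_ratden f : (size (ratden f) <= (ratdeg f).+1)%N.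
Proof. by apply: leq_trans (leqSpred _); exact: leq_maxr. Qed.

Lemma size_fibre_poly f w : (size (fibre_poly f w) <= (ratdeg f).+1)%N.
Proof.
case: w => [c|] /=; last exact: size_ratden.
rewrite (leq_trans (size_polyD _ _)) // geq_max size_ratnum size_polyN.
exact: leq_trans (size_scale_leq _ _) (size_ratden f).
Qed.

Lemma fibre_poly_neq0 f w : (0 < ratdeg f)%N -> fibre_poly f w != 0.
Proof.
move=> n0; have cop := ratfun_coprime f; apply/eqP => P0.
have : (size (ratnum f) <= 1)%N /\ (size (ratden f) <= 1)%N.
  case: w P0 => [c|] /= P0.
    have numE : ratnum f = c *: ratden f by apply/eqP; rewrite -subr_eq0 P0.
    have d1 : (size (ratden f) <= 1)%N.
      have /coprimepP/(_ (ratden f)) := cop; rewrite numE -mul_polyC dvdp_mull //.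
      by move=> /(_ isT (dvdpp _)) /eqp_size; rewrite size_poly1 => ->.
    by split=> //; rewrite numE (leq_trans (size_scale_leq _ _)).
  by move: cop; rewrite P0 coprimep0 size_poly0 => /eqp_size; rewrite size_poly1 => ->.
case=> h1 h2; move: n0; rewrite /ratdeg.
have : (maxn (size (ratnum f)) (size (ratden f)) <= 1)%N by rewrite geq_max h1 h2.
by case: maxn => [|[]].
Qed.

Lemma coef_ratdeg f : (ratnum f)`_(ratdeg f) = 0 -> (ratden f)`_(ratdeg f) != 0.
Proof.
move=> num0; apply/eqP => den0.
have sz (P : {poly C}) : (size P <= (ratdeg f).+1)%N -> P`_(ratdeg f) = 0 -> (size P <= ratdeg f)%N.
  move=> sP P0; rewrite leqNgt; apply/negP => lt_P.
  have sE : size P = (ratdeg f).+1 by apply/eqP; rewrite eqn_leq sP.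
  by move: P0; rewrite -[ratdeg f]/((ratdeg f).+1.-1) -sE => /eqP; 
    rewrite -/(lead_coef P) lead_coef_eq0 -size_poly_eq0 sE.
have := sz _ (size_ratnum f) num0; have := sz _ (size_ratden f) den0.
rewrite /ratdeg; set a := size (ratnum f); set b := size (ratden f) => hb ha.
have ab : (maxn a b <= (maxn a b).-1)%N by rewrite geq_max ha hb.
have m0 : maxn a b = 0%N by move: ab; case: maxn => // k; rewrite ltnn.
have a0 : ratnum f = 0 by apply/eqP; rewrite -size_poly_leq0 -m0 leq_maxl.
have b0 : ratden f = 0 by apply/eqP; rewrite -size_poly_leq0 -m0 leq_maxr.
by have := ratfun_coprime f; rewrite a0 b0 coprimep0 eqp01.
Qed.

(** Numerator and denominator have no common zero, and at oo their coefficients of index [ratdeg f]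
    do not both vanish; so the value is [w] exactly where the fibre polynomial vanishes. *)
Lemma ratval_eq f x w : (0 < ratdeg f)%N ->
  ratval f x = w <-> (0 < multiplicity (ratdeg f) (fibre_poly f w) x)%N.
Proof.
move=> n0; have Pn0 := fibre_poly_neq0 w n0; set n := ratdeg f in n0 *.
have -> : (0 < multiplicity n (fibre_poly f w) x)%N =
    match x with Some z => (fibre_poly f w).[z] == 0 | None => (fibre_poly f w)`_n == 0 end.
  case: x => [z|] /=; first by rewrite -XsubC_dvd // dvdp_XsubCl.
  rewrite subn_gt0 ltnS; apply/idP/eqP => [/leq_sizeP/(_ n (leqnn n))//|Pn].
  have := size_fibre_poly f w; rewrite leq_eqVlt -/n => /orP[/eqP sE|]; last by rewrite ltnS.
  by move/eqP: Pn; rewrite -[n]/(n.+1.-1) -sE -/(lead_coef _) lead_coef_eq0 (negPf Pn0).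
pose b (t : C * C) := t.2 == 0.
have key (p q : C) : (q = 0 -> p != 0) ->
    (if q == 0 then None else Some (p / q)) = w <->
    match w with Some c => p - c * q == 0 | None => q == 0 end.
  move=> pq; case: w {Pn0} => [c|]; case: eqP => [q0|/eqP q0] //.
  - by split=> //; rewrite q0 mulr0 subr0 (negPf (pq q0)).
  - split=> [[<-]|]; first by rewrite divfK // subrr.
    by rewrite subr_eq0 => /eqP ->; rewrite mulfK.
case: x => [z|] /=.
  rewrite key; last first.
    move=> q0; have := ratfun_coprime f; rewrite coprimep_sym => /coprimep_root; apply.
    by rewrite /root q0.
  by case: w {Pn0 key} => [c|] //=; rewrite hornerD hornerN hornerZ.
rewrite key; last first.
  by move=> q0; apply/eqP => p0; have := coef_ratdeg p0; rewrite q0 eqxx.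
by case: w {Pn0 key} => [c|] //=; rewrite coefB coefZ.
Qed.

Lemma ramificationE f x :
  ramification f x = multiplicity (ratdeg f) (fibre_poly f (ratval f x)) x.
Proof. by case: x. Qed.

Lemma ramification_gt0 f x : (0 < ratdeg f)%N -> (0 < ramification f x)%N.
Proof. by move=> n0; rewrite ramificationE; apply/ratval_eq. Qed.

(** It provides the centre of a chart. The witness exceeds every root in modulus. *)
Lemma exists_nonroot (P : {poly C}) : P != 0 -> exists s, P.[s] != 0.
Proof.
move=> P0; have [r rE] := closed_field_poly_normal P.
exists (1 + \sum_(z <- r) `|z|).
rewrite rE hornerZ mulf_neq0 ?lead_coef_eq0 //.
rewrite -/(monic_of_roots r) -/(root _ _) root_prod_XsubC.
apply/negP => sr; have : `|1 + \sum_(z <- r) `|z| | <= \sum_(z <- r) `|z|.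
  by rewrite [leRHS](big_rem _ sr) /= lerDl sumr_ge0.
have s0 : 0 <= \sum_(z <- r) `|z| by apply: sumr_ge0.
rewrite ger0_norm ?addr_ge0 // -lerBrDr subrr => /le_lt_trans /(_ ltr01).
by rewrite ltxx.
Qed.

End Fibres.

(** * Distribution of nearby fibres around the points of a fibre *)

Section LocalFibres.
Local Open Scope classical_set_scope.
Local Open Scope ring_scope.
Variable R : realType.
Local Notation C := R[i].
Implicit Types (x a : P1 R) (s z c y w : C).

Definition unchart s y : P1 R := if y == 0 then None else Some (s + y^-1).

Lemma unchartK s : cancel (unchart s) (chart_point s).
Proof.
move=> y; rewrite /unchart; case: eqP => [->//|_] /=.
by rewrite addrAC subrr add0r invrK.
Qed.

Lemma unchart_neq s y : unchart s y != Some s.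
Proof.
rewrite /unchart; have [//|y0] := eqVneq y 0; apply/eqP => -[/eqP].
by rewrite -subr_eq0 addrAC subrr add0r invr_eq0 (negPf y0).
Qed.

Lemma chart_pointK s x : x != Some s -> unchart s (chart_point s x) = x.
Proof.
move=> xs; apply: (@chart_point_inj _ s) => //; last exact: unchartK.
by rewrite inE unchart_neq.
Qed.

(** Near oo the condition [w != 0] is essential, since 0 has inverse 0 by convention. *)
Definition near_target a (d : C) (w : C) : Prop :=
  if a is Some c then `|w - c| < d else w != 0 /\ `|w^-1| < d.

Section Fixed.
Variable f : ratfun R.
Local Notation n := (ratdeg f).
Hypothesis n0 : (0 < n)%N.

(** Finite targets and oo both become a pencil with small parameter: v = w - c with the denominator,
    or v = 1/w with the numerator. In the second case the pencil is -1/w times the fibre polynomial,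
    which changes neither roots nor multiplicities. *)
Lemma near_fibre_poly a : exists Q : {poly C}, (size Q <= n.+1)%N /\
  forall d w, near_target a d w -> exists v, [/\ `|v| < d,
    forall s, (fibre_poly f a - v *: Q).[s] != 0 -> (fibre_poly f (Some w)).[s] != 0 &
    forall x, multiplicity n (fibre_poly f a - v *: Q) x =
              multiplicity n (fibre_poly f (Some w)) x].
Proof.
case: a => [c|].
  exists (ratden f); split; first exact: size_ratden.
  move=> d w wc; exists (w - c); have E : fibre_poly f (Some c) - (w - c) *: ratden f =
      fibre_poly f (Some w) by rewrite /= scalerBl; ring.
  by rewrite E.
exists (ratnum f); split; first exact: size_ratnum.
move=> d w [w0 wd]; exists w^-1; have E : fibre_poly f None - w^-1 *: ratnum f =
    (- w^-1) *: fibre_poly f (Some w).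
  by rewrite /= scalerBr scalerA mulNr mulVf // scaleN1r opprK addrC scaleNr.
have w1 : - w^-1 != 0 by rewrite oppr_eq0 invr_eq0.
rewrite E; split=> // [s|x]; last exact: multiplicityZ.
by rewrite hornerZ mulf_eq0 negb_or => /andP[].
Qed.

Lemma fibre_neq a s x : (fibre_poly f a).[s] != 0 -> ratval f x = a -> x != Some s.
Proof.
move=> Ps /(ratval_eq _ _ n0) m0; apply: contraTneq m0 => -> /=.
by rewrite mupNroot.
Qed.

Lemma fibre_roots a s : (fibre_poly f a).[s] != 0 -> exists ys : seq C,
  [/\ size ys = n,
      forall x, x != Some s -> count_mem (chart_point s x) ys = multiplicity n (fibre_poly f a) x &
      forall rho : C, 0 < rho -> exists2 d, 0 < d & forall w, near_target a d w ->
        (fibre_poly f (Some w)).[s] != 0 /\ exists zs : seq C, [/\ size zs = n,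
          forall x, x != Some s ->
            count_mem (chart_point s x) zs = multiplicity n (fibre_poly f (Some w)) x &
          forall i, (i < n)%N -> `|ys`_i - zs`_i| < rho]].
Proof.
move=> Ps; have [ys [sys ysE ysP]] := chart_roots (size_fibre_poly f a) Ps.
exists ys; split=> // rho rho0; have [Q [sQ QP]] := near_fibre_poly a.
have [d d0 dP] := pencil_roots (size_fibre_poly f a) sQ Ps rho0 sys ysE.
exists d => // w /QP[v [vd Ns Nm]]; have [Qs [zs [szs zsP near]]] := dP v vd.
split; first exact: Ns.
by exists zs; split=> // x xs; rewrite zsP // Nm.
Qed.

Lemma ratval_mem_roots a s (ys : seq C) x : (fibre_poly f a).[s] != 0 ->
  (forall x, x != Some s -> count_mem (chart_point s x) ys = multiplicity n (fibre_poly f a) x) ->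
  ratval f x = a <-> x != Some s /\ chart_point s x \in ys.
Proof.
move=> Ps ysP; split=> [xa|[xs]].
  have xs := fibre_neq Ps xa; split=> //.
  by rewrite -has_pred1 has_count ysP // -(ratval_eq _ _ n0).
by rewrite -has_pred1 has_count ysP // => /(ratval_eq _ _ n0).
Qed.

(** The root representing [x] is followed: the root with the same index in the fibre over a nearby
    [w] stays close to it. *)
Lemma ratval_open c x (W : set (P1 R)) : ratval f x = Some c -> nbhs x W ->
  exists2 d : C, 0 < d & forall w, `|w - c| < d -> exists2 x', W x' & ratval f x' = Some w.
Proof.
move=> xc xW; have [s Ps] := exists_nonroot (fibre_poly_neq0 (Some c) n0).
have [ys [sys ysP ysN]] := fibre_roots Ps.
have [xs xys] := (ratval_mem_roots x Ps ysP).1 xc.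
have [rho rho0 rhoW] := chart_basis xs xW.
have [d d0 dP] := ysN rho rho0; exists d => // w wc.
have [Pw [zs [szs zsP near]]] := dP w wc.
pose i := index (chart_point s x) ys.
have i_n : (i < n)%N by rewrite -sys index_mem.
exists (unchart s zs`_i).
  apply: rhoW; first exact: unchart_neq.
  by rewrite unchartK -{1}(nth_index 0 xys); apply: near.
apply/(ratval_mem_roots _ Pw zsP); rewrite unchart_neq unchartK; split=> //.
by rewrite mem_nth ?szs.
Qed.

(** Without ramification the [n] roots of the chart polynomial are distinct, and they enumerate the
    fibre. *)
Lemma simple_fibre_enum (w : P1 R) : (forall x, ratval f x = w -> ramification f x = 1%N) ->
  exists lab : 'I_n -> P1 R, injective lab /\ forall x, ratval f x = w <-> exists i, x = lab i.
Proof.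
move=> simple; have [s Ps] := exists_nonroot (fibre_poly_neq0 w n0).
have [ys [sys ysP _]] := fibre_roots Ps; have onF x := ratval_mem_roots x Ps ysP.
have uys : uniq ys.
  apply/count_mem_uniq => y; case: (boolP (y \in ys)) => yys; last exact/count_memPn.
  have /onF xw : unchart s y != Some s /\ chart_point s (unchart s y) \in ys.
    by rewrite unchart_neq unchartK.
  rewrite -[y in LHS](unchartK s) ysP ?unchart_neq // -xw -ramificationE; exact: simple.
exists (fun i => unchart s ys`_i); split=> [i j /(congr1 (chart_point s))|x].
  by rewrite !unchartK => /eqP; rewrite nth_uniq ?sys // => /eqP/val_inj.
split=> [/onF[xs xys]|[i ->]]; last first.
  by apply/onF; rewrite unchart_neq unchartK mem_nth ?sys.
have i_n : (index (chart_point s x) ys < n)%N by rewrite -sys index_mem.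
by exists (Ordinal i_n); rewrite /= nth_index // chart_pointK.
Qed.

(** Twice the radius, so that balls of radius [rho] around distinct members are disjoint. *)
Lemma exists_separation (ys : seq C) : exists2 rho : C, 0 < rho &
  forall y z, y \in ys -> z \in ys -> `|y - z| < rho + rho -> y = z.
Proof.
have one y (zs : seq C) : exists2 rho : C, 0 < rho & forall z, z \in zs -> `|y - z| < rho -> y = z.
  elim: zs => [|z zs [rho rho0 IH]]; first by exists 1.
  case: (eqVneq y z) IH => [->|yz] IH.
    by exists rho => // t; rewrite inE => /orP[/eqP->//|]; exact: IH.
  have yz0 : 0 < `|y - z| by rewrite normr_gt0 subr_eq0.
  have [e [e0 e1 e2]] := exists_lower_bound rho0 yz0; exists e => // t.
  rewrite inE => /orP[/eqP->|tz te]; last by apply: IH => //; exact: lt_le_trans te e1.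
  by move=> /lt_le_trans/(_ e2); rewrite ltxx.
have [rho rho0 rhoP] : exists2 rho : C, 0 < rho &
    forall y z, y \in ys -> z \in ys -> `|y - z| < rho -> y = z.
  elim: ys => [|y ys [rho rho0 IH]]; first by exists 1.
  have [r r0 rP] := one y ys; have [e [e0 e1 e2]] := exists_lower_bound rho0 r0.
  exists e => // u v; rewrite !inE => /orP[/eqP->|uy] /orP[/eqP->|vy] uv //.
  - by apply: rP => //; exact: lt_le_trans uv e2.
  - by apply/esym/rP => //; rewrite distrC; exact: lt_le_trans uv e2.
  by apply: IH => //; exact: lt_le_trans uv e1.
exists (rho / 2); first by rewrite divr_gt0 ?ltr0n.
by rewrite -splitr.
Qed.

(** The sets [V x] are disjoint balls in a chart. The [n] distinct labels over [w] must be all the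
    roots of a polynomial of degree [n]; these are matched by index with the roots over [a], among
    which [x] occurs [ramification f x] times. *)
Lemma local_fibres a : exists (V : P1 R -> set (P1 R)) (d : C),
  [/\ 0 < d, forall x, ratval f x = a -> V x x /\ forall y : P1 R, V x y -> nbhs y (V x),
      forall x x' (y : P1 R), ratval f x = a -> ratval f x' = a -> V x y -> V x' y -> x = x' &
      forall w, near_target a d w -> forall lab : 'I_n -> P1 R,
        injective lab -> (forall i, ratval f (lab i) = Some w) ->
        (forall i, exists2 x, ratval f x = a & V x (lab i)) /\
        (forall x, ratval f x = a -> #|[set i | `[< V x (lab i) >]]%SET| = ramification f x)].
Proof.
have [s Ps] := exists_nonroot (fibre_poly_neq0 a n0).
have [ys [sys ysP ysN]] := fibre_roots Ps; have onF x := ratval_mem_roots x Ps ysP.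
have [rho rho0 sep] := exists_separation ys; have [d d0 dP] := ysN rho rho0.
exists (fun x => [set x' | x' != Some s /\ `|chart_point s x - chart_point s x'| < rho]), d.
split=> // [x /onF[xs _]|x x' y /onF[xs xys] /onF[xs' xys'] [_ h] [_ h']|w wa lab inj_lab labP].
- split=> [|y [y_s yx]]; first by split=> //; rewrite subrr normr0.
  have yrho : 0 < rho - `|chart_point s x - chart_point s y| by rewrite subr_gt0.
  apply: filterS (chart_open y_s yrho) => y' [y's]; rewrite ltrBrDl => h; split=> //.
  apply: le_lt_trans h; apply: le_trans (ler_normD _ _).
  by have -> : chart_point s x - chart_point s y + (chart_point s y - chart_point s y')
     = chart_point s x - chart_point s y' by ring.
- apply: (@chart_point_inj _ s) => //; apply: sep => //.
  have -> : chart_point s x - chart_point s x' = (chart_point s x - chart_point s y)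
     - (chart_point s x' - chart_point s y) by ring.
  by apply: le_lt_trans (ler_normB _ _) _; rewrite ltrD.
have [Pw [zs [szs zsP near]]] := dP w wa; have onW x := ratval_mem_roots x Pw zsP.
have labs i : lab i != Some s by have [] := (onW (lab i)).1 (labP i).
pose cl := [seq chart_point s (lab i) | i <- enum 'I_n].
have ucl : uniq cl.
  rewrite map_inj_in_uniq ?enum_uniq // => i j _ _ /chart_point_inj.
  by rewrite !inE => /(_ (labs i) (labs j)) /inj_lab.
have scl : size cl = n by rewrite size_map size_enum_ord.
have sub : {subset cl <= zs} by move=> _ /mapP[i _ ->]; have [] := (onW (lab i)).1 (labP i).
have pcl : perm_eq cl zs.
  have le_zs : (size zs <= size cl)%N by rewrite szs scl.
  apply: uniq_perm => //; first exact: leq_size_uniq ucl sub le_zs.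
  by have [] := uniq_min_size ucl sub le_zs.
split=> [i|x xa].
  have yzs : chart_point s (lab i) \in zs.
    by rewrite -(perm_mem pcl); apply/mapP; exists i; rewrite ?mem_enum.
  pose k := index (chart_point s (lab i)) zs.
  have kn : (k < n)%N by rewrite -szs index_mem.
  exists (unchart s ys`_k).
    by apply/onF; rewrite unchart_neq unchartK mem_nth ?sys.
  by split=> //; rewrite unchartK -(nth_index 0 yzs) near.
have [xs xys] := (onF x).1 xa.
pose near_x := [pred z : C | `|chart_point s x - z| < rho].
transitivity (count near_x cl).
  rewrite count_map -sum1_count big_enum_cond /= -sum1dep_card; apply: eq_bigl => i /=.
  by apply/asboolP/idP => [[]//|h]; split.
rewrite ((seq.permP pcl) near_x) ramificationE xa -ysP //.
have -> : count near_x zs = count id [seq near_x z | z <- zs] by rewrite count_map.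
have -> : count_mem (chart_point s x) ys = count id [seq pred1 (chart_point s x) y | y <- ys].
  by rewrite count_map.
(* By the separation, the k-th nearby root lies in the ball around [x] exactly when the k-th root
   over [a] represents [x]. *)
congr count; apply: (@eq_from_nth _ false); rewrite !size_map ?szs ?sys // => k kn.
rewrite !(nth_map 0) ?szs ?sys //=; apply/idP/eqP => [h|<-]; last exact: near.
apply/esym/sep; rewrite ?mem_nth ?sys //.
have -> : chart_point s x - ys`_k = (chart_point s x - zs`_k) - (ys`_k - zs`_k) by ring.
by apply: le_lt_trans (ler_normB _ _) _; rewrite ltrD // near.
Qed.

End Fixed.
End LocalFibres.

(** * Lifting paths and squares *)

Section Lifts.
Local Open Scope classical_set_scope.
Local Open Scope ring_scope.
Variable R : realType.
Local Notation C := R[i].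

Lemma within_continuousP (T S : topologicalType) (A : set T) (h : T -> S) :
  {within A, continuous h} <->
  forall p, A p -> forall W, nbhs (h p) W -> nbhs p [set q | A q -> W (h q)].
Proof. by rewrite subspace_continuousP. Qed.

Lemma within_continuous_comp (T S Z : topologicalType) (A : set T) (B : set S)
    (g : T -> S) (h : S -> Z) :
  {within A, continuous g} -> (forall p, A p -> B (g p)) -> {within B, continuous h} ->
  {within A, continuous (h \o g)}.
Proof.
move=> /within_continuousP cg AB /within_continuousP ch; apply/within_continuousP.
move=> p Ap W /(ch _ (AB p Ap)) /(cg _ Ap); apply: filterS => q H Aq.
exact: H Aq (AB q Aq).
Qed.

Lemma connected_locally_constant (T : topologicalType) (A : set T) (P : T -> Prop) p0 :
  connected A -> (forall p, A p -> nbhs p [set q | A q -> (P p <-> P q)]) ->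
  A p0 -> P p0 -> forall p, A p -> P p.
Proof.
move=> cA loc Ap0 Pp0.
pose O (Q : T -> Prop) := \bigcup_(U in [set U : set T | open U /\ forall q, U q -> A q -> Q q]) U.
have oO Q : open (O Q) by apply: bigcup_open => U [].
have OP (Q : T -> Prop) p : A p -> nbhs p [set q | A q -> Q q] -> O Q p.
  move=> Ap; rewrite nbhsE => -[U [oU Up] UQ]; exists U => //; split=> //.
have memP p : A p -> P p -> O P p.
  by move=> Ap Pp; apply: OP => //; apply: filterS (loc p Ap) => q H Aq; apply/(H Aq).
have memN p : A p -> ~ P p -> O (fun q => ~ P q) p.
  by move=> Ap Pp; apply: OP => //; apply: filterS (loc p Ap) => q H Aq /(H Aq).
suff H : A `&` [set p | P p] = A.
  by move=> p Ap; have [] : (A `&` [set p | P p]) p by rewrite H.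
apply: cA.
- by exists p0.
- exists (O P) => //; apply/seteqP; split=> p [Ap]; first by move=> Pp; split; [|exact: memP].
  by case=> U [_ UP] Up; split=> //; exact: UP Up Ap.
- exists (~` O (fun q => ~ P q)); first exact: open_closedC.
  apply/seteqP; split=> p [Ap] H; split=> //; first by case=> U [_ UP] Up; exact: UP Up Ap H.
  by apply: contrapT => nP; apply: H; exact: memN.
Qed.

Variable f : ratfun R.
Local Notation n := (ratdeg f).
Hypothesis n0 : (0 < n)%N.

Definition simple_over (w : C) := forall x, ratval f x = Some w -> ramification f x = 1%N.

Definition is_lift (T : topologicalType) (A : set T) (h : T -> C) (c : T -> P1 R) :=
  (forall p, A p -> ratval f (c p) = Some (h p)) /\ {within A, continuous c}.

(** Agreement of the lifts is locally constant. As the fibre is simple, only one point over a nearby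
    value lies in [V (c p)], so agreement spreads; as the sets [V] are disjoint, disagreement
    spreads too. *)
Lemma lift_unique (T : topologicalType) (A : set T) (h : T -> C) (c c' : T -> P1 R) p0 :
  connected A -> {within A, continuous (h : T -> R[i]^o)} ->
  (forall p, A p -> simple_over (h p)) ->
  is_lift A h c -> is_lift A h c' -> A p0 -> c p0 = c' p0 -> forall p, A p -> c p = c' p.
Proof.
move=> cA /within_continuousP ch sh [lc /within_continuousP cc] [lc' /within_continuousP cc'].
apply: (@connected_locally_constant _ _ (fun p => c p = c' p)) => // p Ap.
have [V [d [d0 Vn Vd VP]]] := local_fibres n0 (Some (h p)).
have near_h := ch p Ap _ (nbhsx_ballx (h p : R[i]^o) d d0).
have near_c := cc p Ap _ ((Vn _ (lc p Ap)).2 _ (Vn _ (lc p Ap)).1).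
have near_c' := cc' p Ap _ ((Vn _ (lc' p Ap)).2 _ (Vn _ (lc' p Ap)).1).
apply: filterS3 near_h near_c near_c' => q hq cq cq' Aq.
split=> [E|E]; last by apply: Vd (cq Aq) _; rewrite ?lc ?lc' // E; exact: cq'.
have [lab [inj_lab labP]] := simple_fibre_enum n0 (sh q Aq).
have [i iE] := (labP (c q)).1 (lc q Aq); have [j jE] := (labP (c' q)).1 (lc' q Aq).
have labE k : ratval f (lab k) = Some (h q) by apply/labP; exists k.
have near_q : near_target (Some (h p)) d (h q).
  by rewrite /= distrC; exact: hq.
have [_ /(_ _ (lc p Ap))] := VP _ near_q lab inj_lab labE.
rewrite (sh p Ap _ (lc p Ap)) => /eqP/cards1P[k kE].
have memk l x : x = lab l -> V (c p) x -> l = k.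
  move=> -> Vx; apply/eqP; rewrite -finset.in_set1 -kE finset.in_set; exact/asboolP.
rewrite iE jE (memk i _ iE (cq Aq)) (memk j _ jE) // E; exact: cq'.
Qed.

End Lifts.

(** * Even covering outside the branch points *)

Section Trivializations.
Local Open Scope classical_set_scope.
Local Open Scope ring_scope.
Variable R : realType.
Local Notation C := R[i].
Variable f : ratfun R.
Local Notation n := (ratdeg f).
Hypothesis n0 : (0 < n)%N.

Definition trivial_over (T : topologicalType) (h : T -> C) (A : set T) :=
  exists K : 'I_n -> T -> P1 R,
    (forall p, A p -> injective (K ^~ p)) /\ forall i, is_lift f A h (K i).

Lemma fibre_onto (w : C) (lab : 'I_n -> P1 R) x : simple_over f w -> injective lab ->
  (forall i, ratval f (lab i) = Some w) -> ratval f x = Some w -> exists i, x = lab i.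
Proof.
move=> sw inj_lab labP xw; have [lab0 [inj0 lab0P]] := simple_fibre_enum n0 sw.
have /choice[s sE] : forall i, exists j, lab i = lab0 j by move=> i; apply/lab0P.
have inj_s : injective s by move=> i j E; apply: inj_lab; rewrite !sE E.
have [j ->] := (lab0P x).1 xw.
have /codomP[i ->] : j \in codom s by rewrite (injF_onto inj_s).
by exists i.
Qed.

Lemma local_sheets (w0 : C) : simple_over f w0 ->
  exists (V : 'I_n -> set (P1 R)) (d : C),
  [/\ 0 < d, forall i y, V i y -> nbhs y (V i),
     forall i j y, V i y -> V j y -> i = j &
     forall w, `|w0 - w| < d -> simple_over f w -> forall i,
       exists2 y, V i y /\ ratval f y = Some w &
         forall y', V i y' -> ratval f y' = Some w -> y' = y].
Proof.
move=> s0; have [lab0 [inj0 lab0P]] := simple_fibre_enum n0 s0.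
have lab0E i : ratval f (lab0 i) = Some w0 by apply/lab0P; exists i.
have [V [d [d0 Vn Vd VP]]] := local_fibres n0 (Some w0).
exists (fun i => V (lab0 i)), d; split=> // [i y|i j y Vi Vj|w ww sw i].
- by apply: (Vn _ (lab0E i)).2.
- by apply: inj0; apply: Vd Vi Vj.
have [lab [inj_lab labP]] := simple_fibre_enum n0 sw.
have labE k : ratval f (lab k) = Some w by apply/labP; exists k.
have near_w : near_target (Some w0) d w by rewrite /= distrC.
have [_ /(_ _ (lab0E i))] := VP _ near_w lab inj_lab labE.
rewrite (s0 _ (lab0E i)) => /eqP/cards1P[k kE].
have Vk l : V (lab0 i) (lab l) <-> l = k.
  split=> [Vl|->].
    by apply/eqP; rewrite -finset.in_set1 -kE finset.in_set; exact/asboolP.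
  by apply/asboolP; have := set11 k; rewrite -kE finset.in_set.
exists (lab k); first by split; [exact/Vk|].
by move=> y' Vy' /labP[l lE]; move: Vy'; rewrite lE => /Vk ->.
Qed.

(** The i-th sheet takes the unique point of [V i] over [h q]. It is continuous because [f] is open:
    a nearby value has a preimage in the prescribed neighbourhood, and uniqueness identifies it with
    the sheet. *)
Lemma trivial_local (T : topologicalType) (S : set T) (h : T -> C) p :
  {within S, continuous (h : T -> R[i]^o)} -> (forall q, S q -> simple_over f (h q)) -> S p ->
  exists2 N, nbhs p N & forall A, A `<=` S -> A `<=` N -> trivial_over h A.
Proof.
move=> /within_continuousP ch sh Sp; have [V [d [d0 Vn Vd VP]]] := local_sheets (sh p Sp).
exists [set q | S q -> `|h p - h q| < d].
  exact: ch p Sp _ (nbhsx_ballx (h p : R[i]^o) d d0).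
move=> A AS AN.
have ex iq : exists y, A iq.2 -> V iq.1 y /\ ratval f y = Some (h iq.2).
  have [Aq|nAq] := pselect (A iq.2); last by exists None.
  by have [y] := VP _ (AN _ Aq (AS _ Aq)) (sh _ (AS _ Aq)) iq.1; exists y.
have [K KP] := choice ex.
have Kuniq i q y : A q -> V i y -> ratval f y = Some (h q) -> y = K (i, q).
  move=> Aq Viy yq; have [z _ uz] := VP _ (AN _ Aq (AS _ Aq)) (sh _ (AS _ Aq)) i.
  by have [V1 V2] := KP (i, q) Aq; rewrite (uz _ Viy yq) (uz _ V1 V2).
exists (fun i q => K (i, q)); split=> [q Aq i j Kij|i].
  have [Vi _] := KP (i, q) Aq; have [Vj _] := KP (j, q) Aq.
  by apply: (Vd i j _ Vi); rewrite /= in Kij *; rewrite Kij.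
split=> [q /(KP (i, q))[]//|]; apply/within_continuousP => q Aq W KW.
have [Vi Kq] := KP (i, q) Aq.
have [d' d'0 d'P] := ratval_open n0 Kq (filterI KW (Vn _ _ Vi)).
have := ch q (AS _ Aq) _ (nbhsx_ballx (h q : R[i]^o) d' d'0).
apply: filterS => r hr Ar; have hr' : `|h r - h q| < d' by rewrite distrC; exact: hr (AS _ Ar).
by have [y [Wy Vy] yr] := d'P _ hr'; rewrite -(Kuniq i r y).
Qed.

(** The sheets over [A] and [B] are matched at [p0] by a renumbering [t]; connectedness of the
    overlap and uniqueness of lifts extend the match, and closedness makes the pasted sheets
    continuous. *)
Lemma trivial_glue (T : topologicalType) (A B : set T) (h : T -> C) p0 :
  closed A -> closed B -> connected (A `&` B) -> A p0 -> B p0 ->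
  {within A `|` B, continuous (h : T -> R[i]^o)} ->
  (forall q, (A `|` B) q -> simple_over f (h q)) ->
  trivial_over h A -> trivial_over h B -> trivial_over h (A `|` B).
Proof.
move=> cA cB cAB Ap0 Bp0 ch sh [K [injK liftK]] [L [injL liftL]].
have s0 : simple_over f (h p0) by apply: sh; left.
have /choice[t tE] i : exists j, K i p0 = L j p0.
  apply: (fibre_onto s0 (injL _ Bp0)); last exact: (liftK i).1.
  by move=> j; exact: (liftL j).1.
have chAB : {within A `&` B, continuous (h : T -> R[i]^o)}.
  by apply: continuous_subspaceW ch => q [Aq _]; left.
have KL i q : A q -> B q -> K i q = L (t i) q.
  move=> Aq Bq; apply: (lift_unique n0 cAB chAB _ _ _ (conj Ap0 Bp0)) => //.
  - by move=> r [Ar _]; apply: sh; left.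
  - split=> [r [Ar _]|]; first exact: (liftK i).1.
    by apply: continuous_subspaceW (liftK i).2 => r [].
  split=> [r [_ Br]|]; first exact: (liftL _).1.
  by apply: continuous_subspaceW (liftL _).2 => r [].
pose M i q := if `[< A q >] then K i q else L (t i) q.
have MA i q : A q -> M i q = K i q by move=> Aq; rewrite /M asboolT.
have MB i q : B q -> M i q = L (t i) q.
  by move=> Bq; rewrite /M; case: asboolP => // Aq; exact: KL.
exists M; split=> [q ABq i j|i].
  case: (pselect (A q)) => [Aq|nAq]; first by rewrite !MA //; exact: injK.
  have Bq : B q by case: ABq.
  rewrite !MB // => /(injL _ Bq) tij.
  by apply: (injK _ Ap0); rewrite !tE tij.
split=> [q [Aq|Bq]|]; [by rewrite MA //; exact: (liftK i).1|by rewrite MB //; exact: (liftL _).1|].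
apply: withinU_continuous => //.
  apply: subspace_eq_continuous (liftK i).2 => q; rewrite inE => Aq; exact/esym/MA.
apply: subspace_eq_continuous (liftL (t i)).2 => q; rewrite inE => Bq; exact/esym/MB.
Qed.

End Trivializations.

(** * Trivialization over the unit square *)

Section Squares.
Local Open Scope classical_set_scope.
Local Open Scope ring_scope.
Variable R : realType.

(** Compactness of the segment as an induction principle on intervals: the supremum of the points
    [x] with [P 0 x] can be passed unless it is 1, and it is attained. *)
Lemma cousin (P : R -> R -> Prop) :
  (forall x, 0 <= x <= 1 -> exists2 e, 0 < e & forall a b, 0 <= a -> a <= b -> b <= 1 ->
     x - e < a -> b < x + e -> P a b) ->
  (forall a b c, 0 <= a -> a <= b -> b <= c -> c <= 1 -> P a b -> P b c -> P a c) -> P 0 1.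
Proof.
move=> loc add; pose E : set R := [set x | 0 <= x <= 1 /\ P 0 x].
have E0 : E 0.
  split; first by rewrite lexx ler01.
  by have [|e e0 eP] := loc 0; [rewrite lexx ler01|apply: eP => //; lra].
have supE : has_sup E by split; [exists 0|exists 1 => x [/andP[]]].
have x0 : 0 <= sup E by apply: sup_upper_bound.
have x1 : sup E <= 1 by apply: ge_sup; [exists 0|move=> x [/andP[]]].
have [|e e0 eP] := loc (sup E); first by rewrite x0.
have [y [/andP[y0 y1] Py] ye] := sup_adherent e0 supE.
have yx : y <= sup E by apply: sup_upper_bound => //; split; rewrite ?y0.
pose z := Num.min 1 (sup E + e / 2).
have zx : sup E <= z by rewrite le_min x1 /=; lra.
have z1 : z <= 1 by rewrite ge_min lexx.
have Pz : P 0 z.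
  apply: (add 0 y z) => //; first exact: le_trans zx.
  apply: eP => //; first exact: le_trans zx.
  by rewrite gt_min; apply/orP; right; lra.
have zE : z <= sup E by apply: sup_upper_bound => //; split=> //; rewrite z1 (le_trans x0).
move: zE; rewrite ge_min => /orP[h|]; last by lra.
by have -> : (1 : R) = z by rewrite /z; apply/esym/min_idPl; lra.
Qed.

Definition rect (a b c d : R) : set (R * R) := [set p | a <= p.1 <= b /\ c <= p.2 <= d].

Lemma rectE a b c d : rect a b c d = (fst @^-1` `[a, b]) `&` (snd @^-1` `[c, d]).
Proof. by apply/seteqP; split=> p /=; rewrite !in_itv. Qed.

Lemma closed_rect a b c d : closed (rect a b c d).
Proof.
by rewrite rectE; apply: closedI; apply: preimage_closed;
  [move=> p _; exact: cvg_fst|exact: itv_closed|move=> p _; exact: cvg_snd|exact: itv_closed].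
Qed.

Lemma connected_vertical a c d : connected (rect a a c d).
Proof.
have -> : rect a a c d = (fun s => (a, s)) @` `[c, d].
  apply/seteqP; split=> [[x y] /= [/andP[ax xa] yP]|_ [y yP <-]] /=.
    by exists y; rewrite ?in_itv //; congr pair; apply/eqP; rewrite eq_le ax xa.
  by split; [rewrite /= lexx|move: yP; rewrite /= in_itv].
apply: connected_continuous_connected; first exact: segment_connected.
by apply: continuous_subspaceT => s;
  apply: (@cvg_pair _ _ _ (nbhs s) (nbhs a) (nbhs s)); [exact: cvg_cst|exact: cvg_id].
Qed.

Lemma connected_horizontal a b c : connected (rect a b c c).
Proof.
have -> : rect a b c c = (fun s => (s, c)) @` `[a, b].
  apply/seteqP; split=> [[x y] /= [xP /andP[cy yc]]|_ [x xP <-]] /=.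
    by exists x; rewrite ?in_itv //; congr pair; apply/eqP; rewrite eq_le cy yc.
  by split; [move: xP; rewrite /= in_itv|rewrite /= lexx].
apply: connected_continuous_connected; first exact: segment_connected.
by apply: continuous_subspaceT => s;
  apply: (@cvg_pair _ _ _ (nbhs s) (nbhs s) (nbhs c)); [exact: cvg_id|exact: cvg_cst].
Qed.

Variable f : ratfun R.
Hypothesis n0 : (0 < ratdeg f)%N.
Variable h : R * R -> R[i].
Hypothesis ch : {within rect 0 1 0 1, continuous (h : R * R -> R[i]^o)}.
Hypothesis sh : forall q, rect 0 1 0 1 q -> simple_over f (h q).

(** [cousin] is applied twice: small rectangles are stacked into a strip of positive width around
    each [u], then strips are put side by side. All overlaps are segments, hence connected. *)
Lemma trivial_square : trivial_over f h (rect 0 1 0 1).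
Proof.
have sub a b c d : 0 <= a -> b <= 1 -> 0 <= c -> d <= 1 -> rect a b c d `<=` rect 0 1 0 1.
  move=> a0 b1 c0 d1 p [/andP[h1 h2] /andP[h3 h4]].
  by split; apply/andP; split; lra.
apply: (@cousin (fun a b => trivial_over f h (rect a b 0 1))) => [u u01|a b c a0 ab bc c1 Pab Pbc].
  pose Q c d := exists2 e, 0 < e & forall a b, 0 <= a -> b <= 1 -> u - e < a -> b < u + e ->
    trivial_over f h (rect a b c d).
  suff [e e0 eP] : Q 0 1 by exists e => // a b a0 _ b1; exact: eP.
  apply: (@cousin Q) => [s s01|c d e c0 cd de e1 [r r0 rP] [r' r'0 r'P]].
    have [N /nbhs_ballP[e e0 eN] NP] := trivial_local n0 ch sh (conj u01 s01 : rect 0 1 0 1 (u, s)).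
    exists e => // c d c0 cd d1 sc ds; exists e => // a b a0 b1 ua bu.
    apply: NP; first exact: sub.
    move=> p [/andP[h1 h2] /andP[h3 h4]]; apply: eN; split; rewrite /ball /= ltr_norml;
      apply/andP; split; lra.
  exists (Num.min r r') => [|a b a0 b1]; first by rewrite lt_min r0.
  move=> h1 h2.
  have [m1 m2] : Num.min r r' <= r /\ Num.min r r' <= r' by rewrite !ge_min !lexx orbT.
  (* For [a > b] the rectangle is empty, and any family of maps trivializes over it. *)
  have [ab|ba] := leP a b; last first.
    have -> : rect a b c e = set0.
      apply/seteqP; split=> // p [/andP[q1 q2] _].
      by have := le_lt_trans (le_trans q1 q2) ba; rewrite ltxx.
    exists (fun _ _ => None); split=> // i; split=> //; exact/within_continuousP.
  have E : rect a b c e = rect a b c d `|` rect a b d e.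
    apply/seteqP; split=> [p [q1 /andP[q2 q3]]|p [] [q1 /andP[q2 q3]]].
    - by have [q|q] := leP p.2 d; [left|right]; split=> //; apply/andP; split=> //; exact: ltW.
    - by split=> //; apply/andP; split=> //; exact: le_trans de.
    - by split=> //; apply/andP; split=> //; exact: le_trans q2.
  have I : rect a b c d `&` rect a b d e = rect a b d d.
    apply/seteqP; split=> [p [[q1 /andP[q2 q3]] [_ /andP[q4 q5]]]|p [q1 /andP[q2 q3]]].
      by split=> //; apply/andP.
    by split; split=> //; apply/andP; split=> //; [exact: le_trans q2|exact: le_trans de].
  have S : rect a b c e `<=` rect 0 1 0 1 by apply: sub.
  rewrite E; apply: (@trivial_glue _ _ n0 _ _ _ _ (a, d)); rewrite -?E ?I.
  - exact: closed_rect.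
  - exact: closed_rect.
  - exact: connected_horizontal.
  - by split; rewrite /= ?lexx ?ab ?cd.
  - by split; rewrite /= ?lexx ?ab ?de.
  - exact: continuous_subspaceW ch.
  - by move=> q /S; exact: sh.
  - by apply: rP => //; lra.
  - by apply: r'P => //; lra.
have E : rect a c 0 1 = rect a b 0 1 `|` rect b c 0 1.
  apply/seteqP; split=> [p [/andP[q2 q3] q1]|p [] [/andP[q2 q3] q1]].
  - by have [q|q] := leP p.1 b; [left|right]; split=> //; apply/andP; split=> //; exact: ltW.
  - by split=> //; apply/andP; split=> //; exact: le_trans bc.
  - by split=> //; apply/andP; split=> //; exact: le_trans q2.
have I : rect a b 0 1 `&` rect b c 0 1 = rect b b 0 1.
  apply/seteqP; split=> [p [[/andP[q2 q3] q1] [/andP[q4 q5] _]]|p [/andP[q2 q3] q1]].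
    by split=> //; apply/andP.
  by split; split=> //; apply/andP; split=> //; [exact: le_trans q2|exact: le_trans bc].
have S : rect a c 0 1 `<=` rect 0 1 0 1 by apply: sub.
rewrite E; apply: (@trivial_glue _ _ n0 _ _ _ _ (b, 0)); rewrite -?E ?I //.
- exact: closed_rect.
- exact: closed_rect.
- exact: connected_vertical.
- by split; rewrite /= ?lexx ?ab ?ler01.
- by split; rewrite /= ?lexx ?bc ?ler01.
- exact: continuous_subspaceW ch.
- by move=> q /S; exact: sh.
Qed.

End Squares.

(** * Local monodromy *)

Section LocalMonodromy.
Local Open Scope classical_set_scope.
Local Open Scope ring_scope.
Variable R : realType.
Local Notation C := R[i].
Local Notation I := ([set` `[0 : R, 1 : R]] : set R).
Implicit Types (t : C) (gam del : R -> C).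

Lemma mem_unit_interval (s : R) : I s <-> 0 <= s <= 1.
Proof. by rewrite /= in_itv. Qed.

Lemma unit_interval0 : I 0. Proof. by apply/mem_unit_interval; rewrite lexx ler01. Qed.
Lemma unit_interval1 : I 1. Proof. by apply/mem_unit_interval; rewrite lexx ler01. Qed.

Section Fixed.
Variable f : ratfun R.
Local Notation n := (ratdeg f).
Hypothesis n0 : (0 < n)%N.
Variable t : C.
Hypothesis simple_t : forall w, punctured t w -> simple_over f w.

(** Over the trivialized square the sheets transport the labelling from the base point of [gam] to
    that of [del]. Because every intermediate curve is closed, the permutation of the sheets does
    not change on the way. *)
Lemma lifts_to_homotopic (H : R -> R -> C) gam del (lab : 'I_n -> P1 R) (g : 'S_n) :
  loop_homotopy t H gam del -> injective lab -> lifts_to f lab gam g ->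
  exists2 lab' : 'I_n -> P1 R, injective lab' & lifts_to f lab' del g.
Proof.
case=> cH HU Hloop H0 H1 inj_lab liftg; pose h (p : R * R) := H p.1 p.2.
have sqE : [set us : R * R | I us.1 /\ I us.2] = rect 0 1 0 1.
  by apply/seteqP; split=> p /=; rewrite !in_itv.
have ch : {within rect 0 1 0 1, continuous (h : R * R -> R[i]^o)} by rewrite -sqE.
have sh q : rect 0 1 0 1 q -> simple_over f (h q).
  by rewrite -sqE => -[q1 q2]; apply/simple_t/HU.
have [K [injK liftK]] := trivial_square n0 ch sh.
have sq (u s : R) : I u -> I s -> rect 0 1 0 1 (u, s) by rewrite -sqE.
have cI : connected I by exact: segment_connected.
have vert u : I u -> {within I, continuous (fun s : R => (u, s))}.
  by move=> _; apply: continuous_subspaceT => s;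
    apply: (@cvg_pair _ _ _ (nbhs s) (nbhs u) (nbhs s)); [exact: cvg_cst|exact: cvg_id].
have horiz s : I s -> {within I, continuous (fun u : R => (u, s))}.
  by move=> _; apply: continuous_subspaceT => u;
    apply: (@cvg_pair _ _ _ (nbhs u) (nbhs u) (nbhs s)); [exact: cvg_id|exact: cvg_cst].
have liftV u i : I u -> is_lift f I (H u) (fun s => K i (u, s)).
  move=> Iu; split=> [s Is|]; first by have [->] := liftK i; last exact: sq.
  apply: (within_continuous_comp (B := rect 0 1 0 1) (vert u Iu)); last exact: (liftK i).2.
  by move=> s; exact: sq.
have liftH s i : I s -> is_lift f I (H^~ s) (fun u => K i (u, s)).
  move=> Is; split=> [u Iu|]; first by have [->] := liftK i; last exact: sq.
  apply: (within_continuous_comp (B := rect 0 1 0 1) (horiz s Is)); last exact: (liftK i).2.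
  by move=> u Iu; exact: sq.
have contV u : I u -> {within I, continuous (H u : R -> R[i]^o)}.
  move=> Iu; apply: (within_continuous_comp (B := rect 0 1 0 1) (vert u Iu) _ ch).
  by move=> s; exact: sq.
have contH s : I s -> {within I, continuous (H^~ s : R -> R[i]^o)}.
  move=> Is; apply: (within_continuous_comp (B := rect 0 1 0 1) (horiz s Is) _ ch).
  by move=> u Iu; exact: sq.
have simple u s : I u -> I s -> simple_over f (H u s) by move=> Iu Is; exact/simple_t/HU.
have /choice[r rE] i : exists j, lab i = K j (0, 0).
  apply: (@fibre_onto _ f n0 (H 0 0) (fun j => K j (0, 0))).
  - exact: simple unit_interval0 unit_interval0.
  - exact: injK (sq _ _ unit_interval0 unit_interval0).
  - by move=> j; exact: (liftV 0 j unit_interval0).1 unit_interval0.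
  - by have [c [_ cE c0 _]] := liftg i; rewrite -c0 cE ?H0 //; exact: unit_interval0.
have left_edge i : K (r i) (0, 1) = lab (g i).
  have [c [cc cE c0 <-]] := liftg i.
  apply: (lift_unique n0 cI (contV 0 unit_interval0) _ (liftV 0 (r i) unit_interval0) _
    unit_interval0 _ unit_interval1) => [s||].
  - exact: simple unit_interval0.
  - by split=> // s Is; rewrite cE ?H0.
  by rewrite c0 rE.
(* The edges s = 0 and s = 1 carry the same path; its two lifts agree at u = 0, hence also at u =
   1. *)
have edges i : K (r i) (1, 1) = K (r (g i)) (1, 0).
  apply: (lift_unique (c' := fun u => K (r (g i)) (u, 0)) n0 cI (contH 1 unit_interval1) _
    (liftH 1 (r i) unit_interval1) _ unit_interval0 _ unit_interval1) => [u Iu||].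
  - exact: simple unit_interval1.
  - have [lk ck] := liftH 0 (r (g i)) unit_interval0; split=> // u Iu.
    by rewrite lk // Hloop.
  by rewrite left_edge rE.
exists (fun i => K (r i) (1, 0)) => [i j /(injK _ (sq _ _ unit_interval1 unit_interval0)) rij|i].
  by apply: inj_lab; rewrite !rE rij.
exists (fun s => K (r i) (1, s)); have [lk ck] := liftV 1 (r i) unit_interval1.
by split=> // s Is; rewrite lk ?H1.
Qed.

(* Label i goes to the point of the fibre over a near which the i-th sheet lies. *)
Lemma lifts_to_near (a : P1 R) : exists2 d : C, 0 < d &
  forall del (lab : 'I_n -> P1 R) (g : 'S_n),
  (forall s, I s -> near_target a d (del s)) -> (forall s, I s -> punctured t (del s)) ->
  injective lab -> lifts_to f lab del g ->
  exists phi : 'I_n -> P1 R, [/\ forall i, ratval f (phi i) = a, forall i, phi (g i) = phi i &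
    forall x, ratval f x = a -> #|[set i | phi i == x]%SET| = ramification f x].
Proof.
have [V [d [d0 Vn Vd VP]]] := local_fibres n0 a; exists d => //.
move=> del lab g near_del U_del inj_lab liftg.
have labP i : ratval f (lab i) = Some (del 0).
  by have [c [_ cE <- _]] := liftg i; rewrite cE //; exact: unit_interval0.
have [near_lab cardV] := VP _ (near_del 0 unit_interval0) lab inj_lab labP.
have /choice[phi phiP] i : exists x, ratval f x = a /\ V x (lab i).
  by have [x xa Vx] := near_lab i; exists x.
exists phi; split=> [i|i|x xa]; first by have [] := phiP i.
  have [c [cc cE c0 c1]] := liftg i; have [pa Vp] := phiP i; have [pa' Vp'] := phiP (g i).
  apply: (Vd _ _ _ pa' pa Vp'); rewrite -c1.
  have cI : connected I by exact: segment_connected.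
  (* The sets [V] cover the fibres along [del], are open there and disjoint, so the lift cannot pass
     from one to another. *)
  have IP : forall s, I s -> nbhs s [set s' | I s' -> (V (phi i) (c s) <-> V (phi i) (c s'))].
    move=> s Is; have sw := simple_t (U_del s Is).
    have [lab' [inj_lab' lab'P]] := simple_fibre_enum n0 sw.
    have lab'E k : ratval f (lab' k) = Some (del s) by apply/lab'P; exists k.
    have [near_lab' _] := VP _ (near_del s Is) lab' inj_lab' lab'E.
    have [k kE] := (lab'P (c s)).1 (cE s Is); have [x xa Vx] := near_lab' k.
    have cx : nbhs (c s) (V x) by apply: (Vn x xa).2; rewrite kE.
    have := (within_continuousP I c).1 cc s Is _ cx; apply: filterS => s' Vs' Is'.
    have pE : V (phi i) (c s) \/ V (phi i) (c s') -> phi i = x.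
      case=> [Vi|Vi]; first by apply: (Vd _ _ _ pa xa Vi); rewrite kE.
      exact: (Vd _ _ _ pa xa Vi (Vs' Is')).
    split=> Vi; rewrite pE; [exact: Vs'|by left|by rewrite kE|by right].
  by apply: (connected_locally_constant cI IP unit_interval0 _ unit_interval1); rewrite c0.
rewrite -cardV //; apply: eq_card => i; rewrite !finset.in_set.
have [pa Vp] := phiP i; apply/eqP/asboolP => [<-//|Vx].
exact: (Vd _ _ _ pa xa Vp Vx).
Qed.

End Fixed.
End LocalMonodromy.

(** * Deformation of loops into circles *)

Section Circles.
Local Open Scope classical_set_scope.
Local Open Scope ring_scope.
Variable R : realType.
Local Notation C := R[i].
Local Notation I := ([set` `[0 : R, 1 : R]] : set R).
Implicit Types (t a : C) (k r : R).

Lemma norm_circle k a r s : 0 <= r -> `|circle k a r s - a| = r%:C%C.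
Proof.
move=> r0; rewrite /circle addrAC subrr add0r normc_def /= !exprMn -mulrDr.
by rewrite cos2Dsin2 mulr1 sqrtr_sqr ger0_norm.
Qed.

Lemma circle_closed k a r : (k = 1 \/ k = -1) -> circle k a r 0 = circle k a r 1.
Proof.
move=> kE; rewrite /circle !mulr0 cos0 sin0 !(mulr1, mulr0).
have [-> ->] : cos (k * (2 * pi)) = 1 /\ sin (k * (2 * pi)) = 0 :> R.
  by case: kE => ->; rewrite ?mulN1r ?mul1r ?cosN ?sinN mulr_natl cos2pi sin2pi ?oppr0.
by rewrite mulr1 mulr0.
Qed.

Lemma continuous_circle k a (rho : R -> R) : continuous rho ->
  continuous ((fun p => circle k a (rho p.1) p.2) : R * R -> R[i]^o).
Proof.
move=> crho p; rewrite /circle; apply: (@cvgD _ R[i]^o); first exact: cvg_cst.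
apply: (@continuous_comp _ _ _ (fun q : R * R => (rho q.1 * cos (k * (2 * pi * q.2)),
  rho q.1 * sin (k * (2 * pi * q.2)))) (fun q => (q.1 +i* q.2)%C : R[i]^o)); last first.
  exact: continuous_complex.
have c1 : (fun q : R * R => rho q.1) @ p --> rho p.1.
  by apply: (@continuous_comp _ _ _ fst rho); [exact: cvg_fst|exact: crho].
have c2 : (fun q : R * R => k * (2 * pi * q.2)) @ p --> k * (2 * pi * p.2).
  by apply: cvgMl_tmp; apply: cvgMl_tmp; exact: cvg_snd.
apply: (@cvg_pair _ _ _ (nbhs p) (nbhs (rho p.1 * cos (k * (2 * pi * p.2))))
  (nbhs (rho p.1 * sin (k * (2 * pi * p.2))))).
  apply: cvgM => //.
  by apply: (@continuous_comp _ _ _ (fun q : R * R => k * (2 * pi * q.2)) cos);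
    [exact: c2|exact: continuous_cos].
apply: cvgM => //.
by apply: (@continuous_comp _ _ _ (fun q : R * R => k * (2 * pi * q.2)) sin);
  [exact: c2|exact: continuous_sin].
Qed.

Lemma circle_homotopy t k a r1 r2 : (k = 1 \/ k = -1) ->
  (forall r s, Num.min r1 r2 <= r -> r <= Num.max r1 r2 -> punctured t (circle k a r s)) ->
  loop_homotopy t (fun u s => circle k a ((1 - u) * r1 + u * r2) s)
    (circle k a r1) (circle k a r2).
Proof.
move=> kE U; split=> [|u s /mem_unit_interval/andP[u0 u1] Is|u _|s _|s _].
- apply: continuous_subspaceT; apply: (@continuous_circle k a (fun u => (1 - u) * r1 + u * r2)).
  move=> u; apply: cvgD; apply: cvgMr_tmp; last exact: cvg_id.
  by apply: cvgB; [exact: cvg_cst|exact: cvg_id].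
- have [r12|r21] := leP r1 r2; apply: U.
  + by rewrite (min_idPl r12); nra.
  + by rewrite (max_idPr r12); nra.
  + by rewrite (min_idPr (ltW r21)); nra.
  + by rewrite (max_idPl (ltW r21)); nra.
- exact: circle_closed.
- by rewrite subr0 mul1r mul0r addr0.
- by rewrite subrr mul1r mul0r add0r.
Qed.

Lemma belyi1_simple (f : ratfun R) t w : (0 < ratdeg f)%N -> belyi1 f t ->
  punctured t w -> simple_over f w.
Proof.
move=> n0 [_ _ _ branch] Uw x xw; apply/eqP; rewrite eqn_leq ramification_gt0 // andbT.
rewrite leqNgt; apply/negP => ram2.
have /branch : branch_point f (Some w) by exists x.
by move: Uw; rewrite /punctured /= !inE => /negP Uw /or4P[/eqP[E]|/eqP[E]|/eqP|/eqP[E]] //;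
  apply: Uw; rewrite E eqxx ?orbT.
Qed.

Definition loop_at t (b : C) (x : P1 R) (gam : R -> C) : Prop :=
  if x is Some c then c \in [:: 0; 1; t] /\ loop_around t b c gam
  else loop_around_infty t b gam.

Theorem local_monodromy (f : ratfun R) t b (x0 : P1 R) gam (lab : 'I_(ratdeg f) -> P1 R)
    (g : 'S_(ratdeg f)) :
  (0 < ratdeg f)%N -> belyi1 f t -> loop_at t b x0 gam -> injective lab ->
  lifts_to f lab gam g ->
  exists phi : 'I_(ratdeg f) -> P1 R,
    [/\ forall i, ratval f (phi i) = x0, forall i, phi (g i) = phi i &
    forall x, ratval f x = x0 -> #|[set i | phi i == x]%SET| = ramification f x].
Proof.
move=> n0 bf loopx inj_lab liftg; have simple w := @belyi1_simple f t w n0 bf.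
have [d d0 near] := lifts_to_near n0 simple x0.
have [e e0 dE] := complex_gt0_real d0.
have e0C : 0 < e%:C%C by rewrite ltcR.
suff [H [k [a [r1 [r2 [hom kE U near_r]]]]]] : exists H k a r1 r2,
    [/\ loop_homotopy t H gam (circle k a r1), (k = 1 \/ k = -1),
     forall r s, Num.min r1 r2 <= r -> r <= Num.max r1 r2 -> punctured t (circle k a r s) &
     forall s, near_target x0 d (circle k a r2 s)].
  have [lab1 inj1 lift1] := lifts_to_homotopic n0 simple hom inj_lab liftg.
  have [lab2 inj2 lift2] := lifts_to_homotopic n0 simple (circle_homotopy kE U) inj1 lift1.
  apply: near inj2 lift2 => s _; first exact: near_r.
  by apply: U; rewrite ?ge_min ?le_max lexx orbT.
case: x0 loopx near => [c [cin [_ [r [r0 rsep [H hom]]]]]|[_ [r [r0 rsep [H hom]]]]] near.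
  (* With radius at most e / 2 the circle is close enough to [c]; on the way the radius stays
     positive and at most [r], so neither [c] nor another puncture is met. *)
  exists H, 1, c, r, (Num.min r (e / 2)).
  have m0 : 0 < Num.min r (e / 2) by rewrite lt_min r0 divr_gt0.
  have mr : Num.min r (e / 2) <= r by rewrite ge_min lexx.
  split=> //; first by left.
    move=> r' s; rewrite (min_idPr mr) (max_idPl mr) => mr' r'r.
    have r'0 : 0 < r' by exact: lt_le_trans mr'.
    have nE := norm_circle 1 c s (ltW r'0).
    apply/negP => /[dup] zin; set z := circle 1 c r' s in nE zin *; move=> _.
    have [zc|zc] := eqVneq z c.
      move: nE; rewrite zc subrr normr0 => /(congr1 (@complex.Re _)) /= E.
      by move: r'0; rewrite -E ltxx.
    have := rsep z zin zc; rewrite nE ltcR => /lt_le_trans /(_ r'r).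
    by rewrite ltxx.
  move=> s; rewrite /= norm_circle ?ltW // dE ltcR gt_min; apply/orP; right; lra.
(* With radius at least 2 / e the inverse has modulus at most e / 2; all punctures have modulus
   below [r] and stay inside. *)
exists H, (-1), 0, r, (Num.max r (2 / e)).
have rm : r <= Num.max r (2 / e) by rewrite le_max lexx.
split=> //; first by right.
  move=> r' s; rewrite (min_idPl rm) (max_idPr rm) => rr' _.
  have r'0 : 0 < r' by exact: lt_le_trans rr'.
  have nE := norm_circle (-1) 0 s (ltW r'0); rewrite subr0 in nE.
  apply/negP => /rsep; rewrite nE ltcR => /lt_le_trans /(_ rr').
  by rewrite ltxx.
move=> s; have m0 : 0 < Num.max r (2 / e) by rewrite lt_max r0.
have := norm_circle (-1) 0 s (ltW m0); rewrite subr0 => nE; split.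
  by rewrite -normr_gt0 nE ltcR.
rewrite normfV nE -fmorphV dE ltcR invf_plt ?posrE // lt_max; apply/orP; right.
by rewrite ltr_pMl ?invr_gt0 // ltr1n.
Qed.

End Circles.

(** * Decompositions *)

Section Decompositions.
Local Open Scope ring_scope.
Variable R : realType.
Local Notation C := R[i].
Implicit Types (P A B D : {poly C}) (f h : ratfun R).

(** Equal roots are grouped, their multiplicities divided by [d], and a d-th root of the leading
    coefficient is taken. *)
Lemma poly_power d P : (0 < d)%N -> P != 0 -> (forall z, (d %| mup z P)%N) ->
  exists A, P = A ^+ d.
Proof.
move=> d0 P0 even; have [r rE] := closed_field_poly_normal P.
exists ((d.-root (lead_coef P))%:P * \prod_(z <- undup r) ('X - z%:P) ^+ (count_mem z r %/ d)).
rewrite exprMn -rmorphXn /= rootCK // {1}rE -mul_polyC; congr (_ * _).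
rewrite -prodrXl -[LHS]big_undup_iterop_count.
apply: eq_bigr => z _; rewrite -exprM divnK //.
have := even z; rewrite rE -mul_polyC mupMr ?mu_prod_XsubC //.
by rewrite rootC lead_coef_eq0.
Qed.

(** The point [a : b] of the projective line, so that finite points and oo are handled by one
    computation. *)
Definition homogeneous_value (a b : C) : P1 R := if b == 0 then None else Some (a / b).

Lemma ratdegP f k : (size (ratnum f) <= k.+1)%N -> (size (ratden f) <= k.+1)%N ->
  ((ratnum f)`_k != 0) || ((ratden f)`_k != 0) -> ratdeg f = k.
Proof.
move=> sn sd nz; rewrite /ratdeg; suff -> : maxn (size (ratnum f)) (size (ratden f)) = k.+1 by [].
apply/eqP; rewrite eqn_leq geq_max sn sd leq_max.
have gt P : P`_k != 0 -> (k < size P)%N.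
  by apply: contraNltn => ?; rewrite nth_default.
by case/orP: nz => /gt ->; rewrite ?orbT.
Qed.

Lemma coprimep_quadratic (al be ga de : C) : al * de - be * ga != 0 ->
  coprimep (al *: 'X^2 + be%:P) (ga *: 'X^2 + de%:P).
Proof.
move=> det; apply/coprimepP => D Dp Dq.
have : D %| (al * de - be * ga)%:P.
  have -> : (al * de - be * ga)%:P = al *: (ga *: 'X^2 + de%:P) - ga *: (al *: 'X^2 + be%:P).
    by rewrite !scalerDr !scalerA (mulrC ga al) polyCB !polyCM -!mul_polyC; ring.
  by rewrite -!mul_polyC dvdp_sub ?dvdp_mull // mul_polyC.
have e1 : (al * de - be * ga)%:P %= 1 by rewrite polyC_eqp1.
by rewrite (eqp_dvdr D e1) dvdp1 size_poly_eq1.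
Qed.

(** Take h = A / B and g = (al X^2 + be) / (ga X^2 + de). The determinant prevents the two forms in
    A^2, B^2 from vanishing together, which gives the degrees and the equality of values, also at
    oo. *)
Lemma square_decomposition f A B (al be ga de : C) : (0 < ratdeg f)%N ->
  ratnum f = al *: A ^+ 2 + be *: B ^+ 2 -> ratden f = ga *: A ^+ 2 + de *: B ^+ 2 ->
  al * de - be * ga != 0 ->
  exists g h, [/\ ratdeg g = 2%N, ratnum h = A, ratden h = B, ratdeg f = (ratdeg h).*2 &
    forall x, ratval f x = ratval g (ratval h x)].
Proof.
move=> n0 numE denE det.
have copAB : coprimep A B.
  have /coprimepP cop := ratfun_coprime f; apply/coprimepP => D DA DB.
  by apply: cop; rewrite ?numE ?denE -!mul_polyC dvdp_add // dvdp_mull // dvdp_exp.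
pose h := RatFun copAB; pose g := RatFun (coprimep_quadratic det).
have nz (a b : C) : (a != 0) || (b != 0) ->
    (al * a ^+ 2 + be * b ^+ 2 != 0) || (ga * a ^+ 2 + de * b ^+ 2 != 0).
  move=> ab; rewrite -negb_and; apply/negP => /andP[/eqP e1 /eqP e2].
  have a2 : (al * de - be * ga) * a ^+ 2 = 0.
    by transitivity (de * (al * a ^+ 2 + be * b ^+ 2) - be * (ga * a ^+ 2 + de * b ^+ 2));
      [ring|rewrite e1 e2 !mulr0 subrr].
  have b2 : (al * de - be * ga) * b ^+ 2 = 0.
    by transitivity (al * (ga * a ^+ 2 + de * b ^+ 2) - ga * (al * a ^+ 2 + be * b ^+ 2));
      [ring|rewrite e1 e2 !mulr0 subrr].
  move/eqP: a2; move/eqP: b2; rewrite !mulf_eq0 (negPf det) /= !orbb => /eqP b0 /eqP a0.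
  by move: ab; rewrite a0 b0 eqxx.
have dg : ratdeg g = 2%N.
  apply: ratdegP; rewrite /= ?(leq_trans (size_polyD _ _)) // ?geq_max.
  - by rewrite (leq_trans (size_scale_leq _ _)) ?size_polyXn // (leq_trans (size_polyC_leq1 _)).
  - by rewrite (leq_trans (size_scale_leq _ _)) ?size_polyXn // (leq_trans (size_polyC_leq1 _)).
  rewrite !coefD !coefZ !coefC !coefXn /= !mulr1 !addr0.
  have := nz 1 0; rewrite oner_eq0 expr0n /= !mulr0 expr1n !mulr1 !addr0; exact.
have gval (a b : C) : (a != 0) || (b != 0) -> ratval g (homogeneous_value a b) =
    homogeneous_value (al * a ^+ 2 + be * b ^+ 2) (ga * a ^+ 2 + de * b ^+ 2).
  rewrite /homogeneous_value; have [->|b0 _] := eqVneq b 0; rewrite /ratval /=.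
    rewrite orbF => a0; rewrite dg !coefD !coefZ !coefC !coefXn /= !mulr1 !addr0.
    rewrite expr0n /= !mulr0 !addr0 mulf_eq0 expf_eq0 /= (negPf a0) orbF.
    by case: eqP => // _; congr Some; rewrite -mulf_div divff ?mulr1 // expf_neq0.
  rewrite !hornerD !hornerZ !hornerXn !hornerC.
  have E (p q : C) : p * (a / b) ^+ 2 + q = (p * a ^+ 2 + q * b ^+ 2) / b ^+ 2.
    by field.
  rewrite !E mulf_eq0 invr_eq0 expf_eq0 /= (negPf b0) orbF.
  case: eqP => // _; congr Some; rewrite -mulf_div divff ?mulr1 //.
  by rewrite invr_eq0 expf_neq0.
have nzk : (A`_(ratdeg h) != 0) || (B`_(ratdeg h) != 0).
  by rewrite -implyNb negbK; apply/implyP => /eqP/(@coef_ratdeg R h).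
have sA : (size A <= (ratdeg h).+1)%N := size_ratnum h.
have sB : (size B <= (ratdeg h).+1)%N := size_ratden h.
(* Values at oo are read off from coefficients of formal degree, which must therefore be compatible
   with squaring. *)
have coefsq P : (size P <= (ratdeg h).+1)%N -> (P ^+ 2)`_(ratdeg h).*2 = P`_(ratdeg h) ^+ 2.
  move=> sP; rewrite expr2 coefM -addnn.
  have kk : (ratdeg h < (ratdeg h + ratdeg h).+1)%N by rewrite ltnS leq_addr.
  rewrite (bigD1 (Ordinal kk)) //= addnK expr2 big1 ?addr0 // => j jk.
  have [lt_j|ge_j] := ltnP (ratdeg h) j.
    by rewrite nth_default ?mul0r // (leq_trans sP).
  rewrite mulrC nth_default ?mul0r // (leq_trans sP) // ltn_subRL ltn_add2r.
  by rewrite ltn_neqAle ge_j andbT; apply: contraNneq jk => jE; apply/eqP/val_inj.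
have sizesq P : (size P <= (ratdeg h).+1)%N -> (size (P ^+ 2) <= (ratdeg h).*2.+1)%N.
  move=> sP; rewrite (leq_trans (size_poly_exp_leq _ _)) // ltnS muln2 leq_double.
  by case: (size P) sP.
have df : ratdeg f = (ratdeg h).*2.
  apply: ratdegP; rewrite ?numE ?denE.
  - rewrite (leq_trans (size_polyD _ _)) // geq_max.
    by rewrite !(leq_trans (size_scale_leq _ _)) ?sizesq.
  - rewrite (leq_trans (size_polyD _ _)) // geq_max.
    by rewrite !(leq_trans (size_scale_leq _ _)) ?sizesq.
  by rewrite !coefD !coefZ !coefsq // nz.
exists g, h; split=> // -[z|].
  rewrite -[ratval h _]/(homogeneous_value A.[z] B.[z]) gval; last first.
    rewrite -implyNb negbK; apply/implyP => /eqP Az.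
    by apply: (coprimep_root copAB); rewrite /root Az.
  by rewrite /ratval numE denE !hornerD !hornerZ !horner_exp.
rewrite -[ratval h _]/(homogeneous_value A`_(ratdeg h) B`_(ratdeg h)) gval //.
by rewrite /ratval df numE denE !coefD !coefZ !coefsq.
Qed.

Lemma ramified_power f (a : P1 R) d : (0 < d)%N -> (0 < ratdeg f)%N ->
  (forall x, ratval f x = a -> (d %| ramification f x)%N) ->
  exists A, fibre_poly f a = A ^+ d.
Proof.
move=> d0 n0 even; apply: poly_power => //; first exact: fibre_poly_neq0.
move=> z; case: (posnP (mup z (fibre_poly f a))) => [->//|mz].
have za : ratval f (Some z) = a by apply/ratval_eq.
by have := even _ za; rewrite ramificationE za.
Qed.

Lemma decomposes_pair f g h : (forall x, ratval f x = ratval g (ratval h x)) ->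
  decomposes f [:: ratdeg g; ratdeg h].
Proof. by move=> fgh; exists [:: g; h]. Qed.

(** The numerator is D^2 and numerator minus denominator is A^2, so the denominator is D^2 - A^2. *)
Lemma decomposes_01 f : (0 < ratdeg f)%N ->
  (forall x, ratval f x = Some 0 -> (2 %| ramification f x)%N) ->
  (forall x, ratval f x = Some 1 -> (2 %| ramification f x)%N) ->
  decomposes f [:: 2%N; (ratdeg f)./2].
Proof.
move=> n0 /(ramified_power _ n0)[//|D] /= DE /(ramified_power _ n0)[//|A] /= AE.
rewrite scale0r subr0 in DE; rewrite scale1r in AE.
have [|||g [h [dg hA hB df fgh]]] := @square_decomposition f D A 1 0 1 (-1) n0.
- by rewrite DE scale1r scale0r addr0.
- by rewrite -DE -AE scale1r scaleN1r; ring.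
- by rewrite mul0r subr0 mul1r oppr_eq0 oner_eq0.
by rewrite df doubleK -dg; exact: (decomposes_pair fgh).
Qed.

(** The denominator is B^2 and numerator minus denominator is A^2, so the numerator is A^2 + B^2. *)
Lemma decomposes_1oo f : (0 < ratdeg f)%N ->
  (forall x, ratval f x = Some 1 -> (2 %| ramification f x)%N) ->
  (forall x, ratval f x = None -> (2 %| ramification f x)%N) ->
  decomposes f [:: 2%N; (ratdeg f)./2].
Proof.
move=> n0 /(ramified_power _ n0)[//|A] /= AE /(ramified_power _ n0)[//|B] /= BE.
rewrite scale1r in AE.
have [|||g [h [dg hA hB df fgh]]] := @square_decomposition f A B 1 1 0 1 n0.
- by rewrite -AE -BE !scale1r; ring.
- by rewrite BE scale0r scale1r add0r.
- by rewrite !mulr1 mulr0 subr0 oner_eq0.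
by rewrite df doubleK -dg; exact: (decomposes_pair fgh).
Qed.

End Decompositions.

Section InvariantSets.
Variables (n : nat) (g : 'S_n).

Lemma porbit_invariant (J : {set 'I_n}) i j : (forall i, i \in J -> g i \in J) ->
  i \in J -> j \in porbit g i -> j \in J.
Proof.
move=> gJ iJ /porbitP[k ->]; rewrite permX.
by elim: k => //= k; apply: gJ.
Qed.

(** An invariant set is a disjoint union of cycles. *)
Lemma dvdn_card_invariant d (J : {set 'I_n}) : (forall i, i \in J -> g i \in J) ->
  (forall i, i \in J -> d %| #|porbit g i|) -> d %| #|J|.
Proof.
move=> gJ dJ; rewrite -sum1_card (partition_big (porbit g) predT) //=.
apply: dvdn_sum => D _; rewrite sum1dep_card.
case: (pickP [pred i in J | porbit g i == D]) => [i /andP[iJ /eqP iD]|none].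
  suff -> : [set x in J | porbit g x == D]%SET = D by rewrite -iD dJ.
  apply/setP => j; rewrite inE -{1}iD eq_porbit_mem -iD.
  by apply: andb_idl; exact: porbit_invariant.
rewrite eq_card0 ?dvdn0 // => i; have := none i.
by rewrite !inE.
Qed.

End InvariantSets.

(** * Triple decompositions in degree 8 *)

Section TripleDecomposition.
Local Open Scope ring_scope.
Variable R : realType.
Local Notation C := R[i].
Implicit Types (P Q A B D : {poly C}) (f h : ratfun R).

Lemma multiplicityM n m P Q (x : option C) : P != 0 -> Q != 0 ->
  (size P <= n.+1)%N -> (size Q <= m.+1)%N ->
  multiplicity (n + m) (P * Q) x = (multiplicity n P x + multiplicity m Q x)%N.
Proof.
move=> P0 Q0 sP sQ; case: x => [z|] /=; first by rewrite mupM.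
rewrite size_mul //.
have : (0 < size P)%N by rewrite size_poly_gt0.
have : (0 < size Q)%N by rewrite size_poly_gt0.
by move: (size P) (size Q) sP sQ => p q; lia.
Qed.

Lemma sum_count_mem (T : eqType) (s : seq T) :
  (\sum_(y <- undup s) count_mem y s)%N = size s.
Proof.
have := perm_size (perm_count_undup s); rewrite size_flatten /shape -map_comp sumnE big_map.
by move=> <-; apply: eq_bigr => y _ /=; rewrite size_nseq.
Qed.

(** Both sides count the roots of the chart polynomial of the fibre with multiplicity. *)
Lemma card_labels_over n (phi : 'I_n -> P1 R) h (a : P1 R) : (0 < ratdeg h)%N ->
  (forall x, ratval h x = a -> #|[set i | phi i == x]%SET| = ramification h x) ->
  #|[set i | ratval h (phi i) == a]%SET| = ratdeg h.
Proof.
move=> n0 cardphi; have [s Ps] := exists_nonroot (fibre_poly_neq0 a n0).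
have [ys [sys ysP _]] := fibre_roots Ps; have onF x := ratval_mem_roots n0 x Ps ysP.
have in_ys i : ratval h (phi i) == a -> chart_point s (phi i) \in undup ys.
  by move=> /eqP/onF[_]; rewrite mem_undup.
rewrite -[RHS]sys -sum_count_mem -sum1dep_card.
transitivity (\sum_(i | ratval h (phi i) == a)
    \sum_(y <- undup ys) (chart_point s (phi i) == y : nat))%N.
  apply: eq_bigr => i ia.
  transitivity (count_mem (chart_point s (phi i)) (undup ys)).
    by rewrite count_uniq_mem ?undup_uniq // in_ys.
  rewrite -sum1_count big_mkcond; apply: eq_bigr => y _ /=.
  by rewrite eq_sym; case: eqP.
rewrite exchange_big /=; apply: eq_big_seq => y; rewrite mem_undup => yys.
have xa : ratval h (unchart s y) = a by apply/onF; rewrite unchart_neq unchartK.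
transitivity (ramification h (unchart s y)); last first.
  by rewrite ramificationE xa -ysP ?unchart_neq // unchartK.
rewrite -cardphi // -sum1dep_card big_mkcond [RHS]big_mkcond /=; apply: eq_bigr => i _.
have [->|xi] := eqVneq (phi i) (unchart s y); first by rewrite xa eqxx unchartK eqxx.
case: ifP => // /eqP/onF[xs _]; apply/eqP; rewrite eqb0; apply: contraNneq xi => <-.
by rewrite chart_pointK.
Qed.

(* Since f = 1 - h^2, the points over 0 split into the fibres of h over 1 and -1; the
   g-fixed labels cannot be spread over both, so one of these fibres is a square. *)
Lemma decomposes_222 f (g : 'S_(ratdeg f)) (phi : 'I_(ratdeg f) -> P1 R) d :
  ratdeg f = 8 -> d \in [:: 2; 4]%N ->
  (forall x, ratval f x = Some 1 -> (2 %| ramification f x)%N) ->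
  (forall x, ratval f x = None -> (4 %| ramification f x)%N) ->
  (forall i, ratval f (phi i) = Some 0) -> (forall i, phi (g i) = phi i) ->
  (forall x, ratval f x = Some 0 -> #|[set i | phi i == x]%SET| = ramification f x) ->
  (forall i, (#|porbit g i| == 1%N) || (d %| #|porbit g i|)%N) ->
  #|[set i | #|porbit g i| == 1%N]%SET| = d ->
  decomposes f [:: 2; 2; 2]%N.
Proof.
move=> f8 d24 even1 even_oo phi0 phi_g card_phi orbits card_fixed.
have n0 : (0 < ratdeg f)%N by rewrite f8.
have [A0 A0E] := ramified_power (isT : 0 < 2)%N n0 even1; rewrite /= scale1r in A0E.
have [B BE] := ramified_power (isT : 0 < 4)%N n0 even_oo; rewrite /= in BE.
(* Here f = (A0^2 + B^4) / B^4; the factor i turns this into f = 1 - h^2 with h = A / B^2, whose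
   zeros are the points with h = 1 or h = -1. *)
pose A := 'i *: A0; have AA : A ^+ 2 = - (A0 ^+ 2) by rewrite exprZn sqrCi scaleN1r.
have [|||g1 [h [dg1 hA hB dh fgh]]] := @square_decomposition R f A (B ^+ 2) (-1) 1 0 1 n0.
- by rewrite AA scaleN1r opprK scale1r -exprM -BE -A0E subrK.
- by rewrite scale0r add0r scale1r -exprM -BE.
- by rewrite mulr1 mulr0 subr0 oppr_eq0 oner_eq0.
have h4 : ratdeg h = 4 by move: dh; rewrite f8; lia.
have h0 : (0 < ratdeg h)%N by rewrite h4.
pose P := fibre_poly h (Some 1); pose Q := fibre_poly h (Some (-1)).
have PQ : fibre_poly f (Some 0) = -1 *: (P * Q).
  rewrite scaleN1r /P /Q /= hA hB !scale1r scaleN1r opprK scale0r subr0.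
  have -> : ratnum f = A0 ^+ 2 + B ^+ 4 by rewrite -A0E -BE subrK.
  have -> : A0 ^+ 2 = - A ^+ 2 by rewrite AA opprK.
  by ring.
have P0 : P != 0 := fibre_poly_neq0 _ h0; have Q0 : Q != 0 := fibre_poly_neq0 _ h0.
have ram_f x : ratval f x = Some 0 -> ramification f x =
    (multiplicity (ratdeg h) P x + multiplicity (ratdeg h) Q x)%N.
  move=> x0; rewrite ramificationE x0 PQ multiplicityZ ?oppr_eq0 ?oner_eq0 //.
  by rewrite dh -addnn multiplicityM ?size_fibre_poly.
have neq1 : Some 1 <> Some (-1) :> P1 R.
  move=> /(congr1 (fun x : option C => complex.Re (odflt 0 x))) /= E.
  have {}E : (1 : R) = -1 by exact: E.
  by clear -E; lra.
have zero a x : ratval h x <> a -> multiplicity (ratdeg h) (fibre_poly h a) x = 0%N.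
  by move=> xa; apply/eqP; rewrite -leqn0 leqNgt; apply/negP => /(ratval_eq _ _ h0).
have val1 x : ratval h x = Some 1 \/ ratval h x = Some (-1) <-> ratval f x = Some 0.
  rewrite (ratval_eq x (Some 0) n0) PQ multiplicityZ ?oppr_eq0 ?oner_eq0 //.
  rewrite dh -addnn multiplicityM ?size_fibre_poly // addn_gt0.
  rewrite !(ratval_eq _ _ h0); split=> [[->|->]|/orP[->|->]]; rewrite ?orbT; auto.
have ram1 x : ratval h x = Some 1 -> ramification f x = ramification h x.
  move=> xh; rewrite ram_f; last by apply/val1; left.
  by rewrite [X in (_ + X)%N]zero ?addn0 ?ramificationE ?xh.
have ram2 x : ratval h x = Some (-1) -> ramification f x = ramification h x.
  move=> xh; rewrite ram_f; last by apply/val1; right.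
  by rewrite [X in (X + _)%N]zero ?add0n ?ramificationE ?xh // => /esym.
pose J : {set 'I_(ratdeg f)} := [set i | ratval h (phi i) == Some 1]%SET.
pose F : {set 'I_(ratdeg f)} := [set i | #|porbit g i| == 1%N]%SET.
have cardJ : #|J| = 4.
  rewrite -h4; apply: card_labels_over => // x xh.
  by rewrite -ram1 // card_phi //; apply/val1; left.
have d_gt0 : (0 < d)%N by move: d24; rewrite !inE => /orP[]/eqP->.
have d4 : (d %| 4)%N by move: d24; rewrite !inE => /orP[]/eqP->.
have d2 : (2 %| d)%N by move: d24; rewrite !inE => /orP[]/eqP->.
have gF i : (g i \in F) = (i \in F).
  by rewrite !inE -[g i]/((g ^+ 1)%g i) porbit_perm.
have gJ i : (g i \in J) = (i \in J) by rewrite !inE phi_g.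
have nonfixed i : i \notin F -> (d %| #|porbit g i|)%N.
  by rewrite inE => /negPf iF; have := orbits i; rewrite iF.
have dJF : (d %| #|J :\: F|)%N.
  apply: (@dvdn_card_invariant _ g) => i; rewrite !finset.in_setD ?gF ?gJ // => /andP[iF _].
  exact: nonfixed.
(* [d] divides the 4 labels over h = 1 and the non-fixed ones among them, hence the fixed ones, of
   which there are at most [d]: all fixed labels lie over h = 1, or none does. *)
have dJ : (d %| #|J :&: F|)%N.
  by rewrite -(dvdn_addl _ dJF) cardsID cardJ.
have leF : (#|J :&: F| <= d)%N by rewrite -card_fixed subset_leq_card // subsetIr.
have even_labels (a : P1 R) : (forall i, ratval h (phi i) = a -> i \notin F) ->
    (forall x, ratval h x = a -> ratval f x = Some 0) ->
    (forall x, ratval h x = a -> ramification f x = ramification h x) ->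
    forall x, ratval h x = a -> (2 %| ramification h x)%N.
  move=> aF a0 ra x xa; rewrite -ra // -card_phi; last exact: a0.
  apply: (@dvdn_card_invariant _ g) => i; rewrite !inE; first by rewrite phi_g.
  by move=> /eqP ix; apply: dvdn_trans d2 (nonfixed _ _); apply: aF; rewrite ix.
suff [g2 [h2 [dg2 dh2 gh2]]] : exists g2 h2, [/\ ratdeg g2 = 2%N, ratdeg h2 = 2%N &
    forall x, ratval h x = ratval g2 (ratval h2 x)].
  exists [:: g1; g2; h2]; first by rewrite /= dg1 dg2 dh2.
  by move=> x; rewrite fgh gh2.
have [J0|Jd] := posnP #|J :&: F|.
  have [|D] := @ramified_power R h (Some 1) 2 isT h0.
    apply: even_labels => // [i hi|x hx]; last by apply/val1; left.
    apply/negP => iF; have := cards0_eq J0 => /setP/(_ i).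
    by rewrite !inE hi eqxx; move: iF; rewrite inE => ->.
  rewrite /= hA hB scale1r => DE.
  have [|||g2 [h2 [dg2 _ _ dh2 gh2]]] := @square_decomposition R h D B 1 1 0 1 h0.
  - by rewrite hA -DE !scale1r subrK.
  - by rewrite hB scale0r scale1r add0r.
  - by rewrite !mulr1 mulr0 subr0 oner_eq0.
  by exists g2, h2; split=> //; move: dh2; rewrite h4; lia.
have FJ : F \subset J.
  apply/finset.setIidPr/eqP; rewrite eqEcard finset.subsetIr card_fixed.
  exact: dvdn_leq.
have [|D] := @ramified_power R h (Some (-1)) 2 isT h0.
  apply: even_labels => // [i hi|x hx]; last by apply/val1; right.
  apply/negP => /(fintype.subsetP FJ); rewrite inE hi => /eqP/esym.
  exact: neq1.
rewrite /= hA hB scaleN1r opprK => DE.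
have [|||g2 [h2 [dg2 _ _ dh2 gh2]]] := @square_decomposition R h D B 1 (-1) 0 1 h0.
- by rewrite hA -DE scale1r scaleN1r addrK.
- by rewrite hB scale0r scale1r add0r.
- by rewrite mulr1 mulr0 subr0 oner_eq0.
by exists g2, h2; split=> //; move: dh2; rewrite h4; lia.
Qed.

End TripleDecomposition.

(** * The two tables *)

Section Rows.
Local Open Scope classical_set_scope.
Variable R : realType.

Lemma mem_cycle_type n (s : 'S_n) i : #|porbit s i| \in cycle_type s.
Proof.
rewrite mem_sort; apply/mapP; exists (porbit s i) => //.
by rewrite mem_enum; apply: imset_f.
Qed.

(** The labels sent to [x] form a [g]-invariant set of size [ramification f x]. *)
Lemma dvdn_ramification (f : ratfun R) (g : 'S_(ratdeg f)) (a : P1 R) d :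
  (exists phi : 'I_(ratdeg f) -> P1 R, [/\ forall i, ratval f (phi i) = a,
     forall i, phi (g i) = phi i &
     forall x, ratval f x = a -> #|[set i | phi i == x]%SET| = ramification f x]) ->
  all (dvdn d) (cycle_type g) -> forall x, ratval f x = a -> d %| ramification f x.
Proof.
case=> phi [_ phi_g card_phi] /allP dg x xa; rewrite -card_phi //.
apply: (@dvdn_card_invariant _ g) => i; first by rewrite !inE phi_g.
by move=> _; apply/dg/mem_cycle_type.
Qed.

Lemma monodromy_fibres (f : ratfun R) t (g : quad (ratdeg f)) (j : nat) (a : P1 R) :
  0 < ratdeg f -> belyi1 f t -> monodromy f t g ->
  (j, a) \in [:: (0, Some 0%R); (1, Some 1%R); (3, None)] ->
  exists phi : 'I_(ratdeg f) -> P1 R,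
    [/\ forall i, ratval f (phi i) = a, forall i, phi (entry g j i) = phi i &
    forall x, ratval f x = a -> #|[set i | phi i == x]%SET| = ramification f x].
Proof.
move=> n0 bf [b [lab [gam0 [gam1 [gamt [gamoo]]]]]].
case=> -[l0 l1 _ loo] _ [inj_lab _] [h0 h1 _ hoo].
rewrite !inE => /or3P[]/eqP[-> ->].
- have L0 : loop_at t b (Some 0%R) gam0 by split; [rewrite !inE eqxx|exact: l0].
  exact: (local_monodromy n0 bf L0 inj_lab h0).
- have L1 : loop_at t b (Some 1%R) gam1 by split; [rewrite !inE eqxx orbT|exact: l1].
  exact: (local_monodromy n0 bf L1 inj_lab h1).
exact: (local_monodromy (x0 := None) n0 bf loo inj_lab hoo).
Qed.

(* The cases, for some u: f = u^2 / (u^2 - 1); f = u^2 + 1; f = 1 - h^2 with h = u^2 + 1 or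
   h = u^2 - 1. *)
Definition decomposable (p : pattern) (degs : seq nat) : bool :=
  [|| [&& all (dvdn 2) p.1.1, all (dvdn 2) p.1.2 & degs == [:: 2; (sumn p.1.1)./2]],
      [&& all (dvdn 2) p.1.2, all (dvdn 2) p.2 & degs == [:: 2; (sumn p.1.1)./2]] |
      [&& sumn p.1.1 == 8, all (dvdn 2) p.1.2, all (dvdn 4) p.2, degs == [:: 2; 2; 2] &
          has (fun d => all (fun k => (k == 1) || (d %| k)) p.1.1 &&
                        (count_mem 1 p.1.1 == d)) [:: 2; 4]]].

Lemma monodromy_decomposes n (f : ratfun R) t (g : quad n) degs :
  ratdeg f = n -> 0 < n -> belyi1 f t -> monodromy f t g ->
  decomposable (quad_pattern g) degs -> decomposes f degs.
Proof.
move=> fn; subst n => n0 bf mg; rewrite /decomposable.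
rewrite -[(quad_pattern g).1.1]/(cycle_type (entry g 0)) sumn_cycle_type.
rewrite -[(quad_pattern g).1.2]/(cycle_type (entry g 1)).
rewrite -[(quad_pattern g).2]/(cycle_type (entry g 3)).
have fib j a := @monodromy_fibres f t g j a n0 bf mg.
have fib0 : _ := fib 0 (Some 0%R) (mem_head _ _).
have fib1 : _ := fib 1 (Some 1%R) (mem_behead (s := _ :: _) (mem_head _ _)).
have fiboo : _ := fib 3 None
  (mem_behead (s := _ :: _) (mem_behead (s := _ :: _) (mem_head _ _))).
case/or3P => [/and3P[e0 e1 /eqP->]|/and3P[e1 eoo /eqP->]|].
- by apply: decomposes_01; [|exact: dvdn_ramification fib0 e0|exact: dvdn_ramification fib1 e1].
- by apply: decomposes_1oo; [|exact: dvdn_ramification fib1 e1|exact: dvdn_ramification fiboo eoo].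
case/and5P => /eqP f8 e1 eoo /eqP-> /hasP[d d24 /andP[/allP orb /eqP fixd]].
have [phi [phi0 phi_g card_phi]] := fib0.
apply: (decomposes_222 f8 d24 _ _ phi0 phi_g card_phi).
- exact: dvdn_ramification fib1 e1.
- exact: dvdn_ramification fiboo eoo.
- by move=> i; apply/orb/mem_cycle_type.
by rewrite card_porbit_count muln1.
Qed.

Lemma row_holds_certified m t cs r : all2 (certified m) t cs -> r \in t ->
  (r.2 == [::]) || decomposable r.1.1 r.2 -> 0 < sumn r.1.1.1.1 -> row_holds R m 5 r.
Proof.
move=> cert rt dec n0; have [B [BE cB]] := certified_row cert rt.
case: r rt dec n0 B BE cB => [[p len] degs] /= rt dec n0 B BE cB.
exists B; split=> // degs0 f [c [g [fn bf mg gO]]].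
case/orP: dec => [/eqP//|]; have : B \in [set B]%SET by rewrite finset.in_set1.
rewrite -BE finset.in_set => /andP[_ /forall_inP/(_ _ gO)/forall_inP/(_ _ (mem_conj_class g))].
by move/eqP <-; exact: monodromy_decomposes bf mg.
Qed.

Definition rows_ok (t : seq orbit_row) :=
  all (fun r : orbit_row => ((r.2 == [::]) || decomposable r.1.1 r.2) && (0 < sumn r.1.1.1.1)) t
  && uniq [seq r.1.1 | r <- t].

Lemma rows_okO : rows_ok tableO. Proof. by vm_compute. Qed.
Lemma rows_okP : rows_ok tableP. Proof. by vm_compute. Qed.

Lemma row_holds_table m t cs : all2 (certified m) t cs -> rows_ok t ->
  forall r, r \in t -> row_holds R m 5 r.
Proof.
move=> cert /andP[/allP ok _] r rt; have /andP[dec n0] := ok r rt.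
exact: row_holds_certified cert rt dec n0.
Qed.

Local Notation orbit := {n : nat & {set {set quad n}}}.
Local Notation Orbit := (existT (fun n : nat => {set {set quad n}})).

Lemma orbit_pattern_unique m n (O : {set {set quad n}}) p q :
  O \in pure_braid_orbits m 5 n -> orbit_has_pattern p O -> orbit_has_pattern q O ->
  p = q /\ sumn p.1.1 = n.
Proof.
case/mem_pure_braid_orbits => g [-> _ _] /orbit_has_patternP <- /orbit_has_patternP <-.
by rewrite sumn_cycle_type.
Qed.

Local Open Scope card_scope.

(** Every row has exactly one orbit, every orbit has the pattern of a row, and distinct rows have
    distinct patterns. A pattern also determines the degree, as the sum of its first list, so rows
    correspond bijectively to orbits of all degrees. *)
Lemma card_all_orbits m t cs : all2 (certified m) t cs -> rows_ok t ->
  (forall n (O : {set {set quad n}}), O \in pure_braid_orbits m 5 n ->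
     exists2 r : orbit_row, r \in t & orbit_has_pattern r.1.1 O) ->
  all_orbits m 5 #= `I_(size t).
Proof.
move=> cert /andP[_ ut] cover.
have /choice[F FP] (r : orbit_row) : exists o : orbit, r \in t ->
   [/\ tagged o \in pure_braid_orbits m 5 (tag o), orbit_has_pattern r.1.1 (tagged o) &
    forall o' : orbit, tagged o' \in pure_braid_orbits m 5 (tag o') ->
      orbit_has_pattern r.1.1 (tagged o') -> o' = o].
  have [rt|nrt] := boolP (r \in t); last by exists (Orbit 0 finset.set0).
  have [B [BE _]] := certified_row cert rt.
  have mB O' : (O' == B) = (O' \in pure_braid_orbits m 5 _) && orbit_has_pattern r.1.1 O'.
    by rewrite -finset.in_set1 -BE finset.in_set.
  have /esym/andP[h1 h2] : true = _ := etrans (esym (eqxx B)) (mB B).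
  exists (Orbit _ B) => _; split=> // -[n O'] /= mO' pO'.
  have [_ nE] := orbit_pattern_unique mO' pO' pO'; subst n.
  by congr existT; apply/eqP; rewrite mB mO' pO'.
pose r0 : orbit_row := (([::], [::], [::]), 0, [::]).
have nth_t i : i < size t -> nth r0 t i \in t by exact: mem_nth.
have -> : all_orbits m 5 = (fun i => F (nth r0 t i)) @` `I_(size t).
  apply/seteqP; split=> [[n O] /= mO|_ [i /= it <-]].
    have [r rt pO] := cover n O mO; exists (index r t); first by rewrite /= index_mem.
    by rewrite nth_index //; have [_ _ uF] := FP r rt; rewrite (uF (Orbit n O)).
  by have [] := FP _ (nth_t i it).
apply: inj_card_eq => i j; rewrite !inE /= => it jt Fij.
have [mi pi _] := FP _ (nth_t i it); have [mj pj _] := FP _ (nth_t j jt).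
rewrite Fij in mi pi; have [E _] := orbit_pattern_unique mj pi pj.
apply/eqP; rewrite -(nth_uniq r0.1.1 _ _ ut) ?size_map //.
by rewrite !(nth_map r0) // E.
Qed.

End Rows.

Local Open Scope card_scope.

Theorem mainTheorem4 (R : realType) :
  (* (a) *)
  ([/\ all_orbits 4 5 #= `I_20,
       forall (n : nat) (O : {set {set quad n}}), O \in pure_braid_orbits 4 5 n ->
         exists2 r : orbit_row, r \in tableO & orbit_has_pattern r.1.1 O,
       forall r : orbit_row, r \in tableO -> row_holds R 4 5 r &
       forall g : quad 6, constellation g -> is_2cycle (entry g 2) ->
         quad_pattern g <> ([:: 2; 2; 2], [:: 2; 2; 2], [:: 1; 1; 4])%N])
  /\
  (* (b) *)
  [/\ all_orbits 6 5 #= `I_12,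
      forall (n : nat) (O : {set {set quad n}}), O \in pure_braid_orbits 6 5 n ->
        exists2 r : orbit_row, r \in tableP & orbit_has_pattern r.1.1 O &
      forall r : orbit_row, r \in tableP -> row_holds R 6 5 r].
Proof.
split; split.
- exact: card_all_orbits certifiedO rows_okO (orbit_pattern_in pattern_tableO).
- exact: orbit_pattern_in pattern_tableO.
- exact: row_holds_table certifiedO rows_okO.
- exact: no_exceptional_dessin.
- exact: card_all_orbits certifiedP rows_okP (orbit_pattern_in pattern_tableP).
- exact: orbit_pattern_in pattern_tableP.
- exact: row_holds_table certifiedP rows_okP.
Qed.
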